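(* Let $m\geq 1$ and let $u: U \to \mathbb{R}$ be a smooth function on an open set $U \subset \mathbb{R}^{2m}$ such that, at every point of $U$, $\mathrm{Hess}(u)$ is positive definite and belongs to $\mathrm{Sp}(2m,\mathbb{R})$. Let $g$ be the associated Hessian metric on $U$, i.e. $g|_x = \mathrm{Hess}(u)|_x$ for all $x \in U$. Then the scalar curvature $R$ of $g$ satisfies $R \geq 0$ and $$\sqrt{R(x)} \leq \frac{3m}{\mathrm{dist}_{g|_x}(x,\partial U)}\quad\text{for all } x\in U.$$ In particular, if $U = \mathbb{R}^{2m}$, then $R \equiv 0$ and consequently $u$ is a quadratic polynomial. Moreover, the constant $3m$ cannot be replaced by a constant smaller than $\sqrt{m}$: for each $m$, if $C$ is a constant such that $\sqrt{R(x)}\leq C/\mathrm{dist}_{g|_x}(x,\partial U)$ holds for every open set $U\subset\mathbb{R}^{2m}$, every smooth function $u:U\to\mathbb{R}$ such that $\mathrm{Hess}(u)$ is positive definite and belongs to $\mathrm{Sp}(2m,\mathbb{R})$ at every point of $U$ (with $g$ the Hessian metric $g|_x=\mathrm{Hess}(u)|_x$ and $R$ its scalar curvature), and all $x\in U$, then $C\geq\sqrt{m}$.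
   Context: $\mathrm{Sp}(2m,\mathbb{R})$ is the group of real $2m\times 2m$ matrices $A$ with $A^\top J A=J$, where $J=\begin{pmatrix}0&-I_m\\ I_m&0\end{pmatrix}$ with respect to the splitting of the coordinates of $\mathbb{R}^{2m}$ as $(x_1,\dots,x_m,y_1,\dots,y_m)$. $\mathrm{dist}_{g|_x}(x,\partial U)$ denotes the distance from $x$ to $\partial U\subset\mathbb{R}^{2m}$ measured with the constant inner product $g|_x=\mathrm{Hess}(u)|_x$ on $\mathbb{R}^{2m}$, i.e. $\inf_{p\in\partial U}\sqrt{(p-x)^\top \mathrm{Hess}(u)|_x\,(p-x)}$, with the convention that it is $+\infty$ (and the right-hand side of the estimate is $0$) if $\partial U=\emptyset$. The scalar curvature is the trace of the Ricci tensor (for surfaces, twice the Gaussian curvature). ''Quadratic polynomial'' means polynomial of degree at most two. *)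

(* Defs.v *)
From HB Require Import structures.
From mathcomp Require Import all_boot all_order all_algebra.
From mathcomp Require Import all_classical all_reals all_analysis.
Set Implicit Arguments.
Unset Strict Implicit.
Unset Printing Implicit Defensive.
Import Order.TTheory GRing.Theory Num.Theory.
Import numFieldNormedType.Exports.
Local Open Scope classical_set_scope.
Local Open Scope ring_scope.

(* Points of R^n are row vectors.  A function on an open set U is represented
   by a total function; its partial derivatives at a point of U depend only on
   its values on U. *)

Definition partial (R : realType) (n : nat) (i : 'I_n) (f : 'rV[R]_n -> R) :
  'rV[R]_n -> R := 'D_(delta_mx 0 i) f.

Definition partials (R : realType) (n : nat) (s : seq 'I_n)
  (f : 'rV[R]_n -> R) : 'rV[R]_n -> R := foldr (@partial R n) f s.

Definition smooth_on (R : realType) (n : nat) (U : set 'rV[R]_n)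
  (f : 'rV[R]_n -> R) : Prop :=
  forall (s : seq 'I_n) (x : 'rV[R]_n), U x ->
    {for x, continuous (partials s f)} /\
    forall i : 'I_n, derivable (partials s f) x (delta_mx 0 i).

Definition hess (R : realType) (n : nat) (f : 'rV[R]_n -> R) (x : 'rV[R]_n) :
  'M[R]_n := \matrix_(i, j) partial i (partial j f) x.

(* Symmetry is not required here: it is automatic for the Hessian of a smooth
   function. *)
Definition posdef (R : realType) (n : nat) (A : 'M[R]_n) : Prop :=
  forall v : 'rV[R]_n, v != 0 -> 0 < (v *m A *m v^T) 0 0.

Definition Jmx (R : realType) (m : nat) : 'M[R]_(m + m) :=
  block_mx 0 (- 1%:M) 1%:M 0.

Definition in_Sp (R : realType) (m : nat) (A : 'M[R]_(m + m)) : Prop :=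
  A^T *m Jmx R m *m A = Jmx R m.

Section Curvature.
Variables (R : realType) (n : nat) (g : 'rV[R]_n -> 'M[R]_n).

Definition dmetric (l i j : 'I_n) : 'rV[R]_n -> R :=
  partial l (fun y => g y i j).

(* christoffel k i j is Gamma^k_{ij} of the Levi-Civita connection. *)
Definition christoffel (k i j : 'I_n) (x : 'rV[R]_n) : R :=
  2^-1 * \sum_l invmx (g x) k l *
           (dmetric i j l x + dmetric j i l x - dmetric l i j x).

(* riemann l k i j is the coefficient R^l_{kij} in
   R(e_i, e_j) e_k = \sum_l R^l_{kij} e_l, for the convention
   R(X, Y) Z = D_X D_Y Z - D_Y D_X Z - D_[X, Y] Z. *)
Definition riemann (l k i j : 'I_n) (x : 'rV[R]_n) : R :=
  partial i (christoffel l j k) x - partial j (christoffel l i k) x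
  + \sum_p (christoffel l i p x * christoffel p j k x
            - christoffel l j p x * christoffel p i k x).

(* Ric(e_j, e_k) is the trace of X |-> R(X, e_j) e_k; round spheres have
   positive Ricci curvature. *)
Definition ricci (j k : 'I_n) (x : 'rV[R]_n) : R := \sum_i riemann i k i j x.

Definition scalar_curvature (x : 'rV[R]_n) : R :=
  \sum_j \sum_k invmx (g x) j k * ricci j k x.

End Curvature.

Definition boundary (T : topologicalType) (U : set T) : set T :=
  closure U `\` interior U.

(* The infimum is +oo when the boundary of U is empty. *)
Definition dist_boundary (R : realType) (n : nat) (H : 'M[R]_n)
  (x : 'rV[R]_n) (U : set 'rV[R]_n) : \bar R :=
  ereal_inf [set (Num.sqrt (((p - x) *m H *m (p - x)^T) 0 0))%:E
            | p in boundary U].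

Definition quadratic_polynomial (R : realType) (n : nat)
  (f : 'rV[R]_n -> R) : Prop :=
  exists (a : 'I_n -> 'I_n -> R) (b : 'I_n -> R) (c : R),
    forall x : 'rV[R]_n,
      f x = \sum_i \sum_j a i j * (x 0 i * x 0 j) + \sum_i b i * x 0 i + c.

(* Main.v *)
Require Import Defs.
From HB Require Import structures.
From mathcomp Require Import all_boot all_order all_algebra.
From mathcomp Require Import all_classical all_reals all_analysis.
From mathcomp Require Import ring lra.
Set Implicit Arguments.
Unset Strict Implicit.
Unset Printing Implicit Defensive.
Import Order.TTheory GRing.Theory Num.Theory.
Import numFieldNormedType.Exports.
Local Open Scope classical_set_scope.
Local Open Scope ring_scope.

(** Write H for the Hessian of u, T for its third derivatives, g = H for the
    metric, and take H positive definite with H J H = J. Vectors are rows, so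
    matrices act from the right.

    Curvature. T is totally symmetric, and differentiating H J H = J gives
    tr (H^-1 T(v)) = 0 (hess_trace0). Hence the scalar curvature R is a
    quarter of the sum of the squares of T in a g-orthonormal basis
    (scalar_curvature_hess): R is nonnegative, it vanishes only where T does,
    and a function on the whole space with T = 0 is a quadratic polynomial
    (third0_quadratic). It remains to bound T.

    A complex analytic structure. Fix x, put G = H(x), and use the Lewy
    coordinates w = p G + grad u(p) for points p near x. Lewy's map p |-> w is
    expanding because u is convex. Its Jacobian is H + G, with inverse N, so
    dp/dw = N. In these coordinates consider the Cayley transform
    S = N (H - G). It vanishes at x and is a contraction for the norm of G^-1
    (energy_le). It anticommutes with the complex structure I = J G, and its
    derivative D_v (a S) is symmetric in a and v because T is. Together,
    D_(v I) (a S) = - D_v (a S) I: the function w |-> a S is antiholomorphic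
    on every complex line (covd_cayley_cplx), and ln |a S|^2 is subharmonic
    there (energy_logsub).

    Schwarz lemma. If the p-ball of radius d around x is in U and the
    corresponding w-ball of radius r is covered by its image, then
    |a S| <= |a| |w - w(x)| / r on that w-ball (energy_schwarz). This is
    proved by the maximum principle for ln A + (e - 1) ln |z|^2 + e |z|^2 on
    an annulus, where A = |a S|^2 (schwarz_disc). At the centre the derivative
    of S is a quarter of T, so that |T(a, v)| <= 4 / r for unit vectors a and
    v. Summing over the (2 m)^2 pairs of basis vectors gives
    sqrt R <= 4 m / r.

    The radius. Lewy's map covers the w-ball of radius d, by minimising a
    convex function (lewy_cover); this alone would give 4 m / d. The Schwarz
    lemma improves the radius: since dp/dw = (1 - S) G^-1 / 2, the preimage of
    the w-ball of radius r lies in the p-ball of radius 3 r / 4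
    (displacement), and covering the remaining shell of thickness d - 3 r / 4
    enlarges r to r / 4 + d (covers_step). Iteration reaches every
    r < 4 d / 3, and the estimate becomes 3 m / d. A ball of g|_x-radius less
    than the distance to the boundary lies in U (gball_in_domain).

    Sharpness. For the sum of x_k^2 / (2 y_k) + y_k^3 / 6 on the set where all
    y_k are positive, at the point x = 0, y = 1, the curvature is m and the
    distance to the boundary is at least 1. *)

(** * Derivation rules and smooth functions *)

Section DeriveFun.
Variables (R : realType) (V : normedModType R).
Implicit Types (f g : V -> R) (x v : V).

Lemma is_derive_add f g x v a b : is_derive x v f a -> is_derive x v g b ->
  is_derive x v (fun y => f y + g y) (a + b).
Proof. exact: is_deriveD. Qed.

Lemma is_derive_mul f g x v a b : is_derive x v f a -> is_derive x v g b ->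
  is_derive x v (fun y => f y * g y) (a * g x + f x * b).
Proof.
move=> df dg; apply: (is_derive_eq (is_deriveM df dg)).
by rewrite addrC mulrC.
Qed.

Lemma is_derive_inv f x v a : f x != 0 -> is_derive x v f a ->
  is_derive x v (fun y => (f y)^-1) (- a * ((f x)^-1 * (f x)^-1)).
Proof.
move=> fx0 [df <-]; apply: DeriveDef; first exact: derivableV.
by rewrite deriveV// mulNr /GRing.scale/= mulNr mulrC expr2 invfM.
Qed.

Lemma is_derive_line f x v t l : is_derive (x + t *: v) v f l <->
  is_derive t (1 : R) (fun s => f (x + s *: v)) l.
Proof.
suff E : (fun h : R => h^-1 *: ((f \o shift (x + t *: v)) (h *: v)
    - f (x + t *: v))) = (fun h : R => h^-1 *:
    (((fun s => f (x + s *: v)) \o shift t) (h *: (1 : R)) - f (x + t *: v))).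
  have Ed : derivable f (x + t *: v) v = derivable (fun s : R => f (x + s *: v)) t 1.
    exact: (congr1 (fun F : R -> R => cvg (F @ 0^')) E).
  have EE : 'D_v f (x + t *: v) = 'D_1 (fun s : R => f (x + s *: v)) t.
    exact: (congr1 (fun F : R -> R => lim (F @ 0^')) E).
  split=> -[df dfE].
    exact: (DeriveDef (eq_ind _ (fun P : Prop => P) df _ Ed) (etrans (esym EE) dfE)).
  exact: (DeriveDef (eq_ind _ (fun P : Prop => P) df _ (esym Ed)) (etrans EE dfE)).
apply/funext => h /=; congr (_ *: (f _ - _)).
by rewrite [h *: 1]mulr1 scalerDl addrCA.
Qed.

End DeriveFun.

Section SmoothClass.
Variables (R : realType) (n : nat) (U : set 'rV[R]_n).
Hypothesis oU : open U.
Implicit Types (f g : 'rV[R]_n -> R) (x y v : 'rV[R]_n).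

Lemma near_open (P : 'rV[R]_n -> Prop) x : U x -> (forall y, U y -> P y) ->
  \forall y \near x, P y.
Proof. by move=> Ux PU; apply: filterS (open_nbhs_nbhs (conj oU Ux)). Qed.

Lemma partial_eq_on f g i x : (forall y, U y -> f y = g y) -> U x ->
  partial i f x = partial i g x.
Proof. by move=> fg Ux; apply: near_eq_derive; exact: near_open. Qed.

Lemma smooth_partial f i : smooth_on U f -> smooth_on U (partial i f).
Proof.
move=> sf s x Ux; have := sf (s ++ [:: i]) x Ux.
by rewrite /partials foldr_cat.
Qed.

Lemma smooth_continuous f x : smooth_on U f -> U x -> {for x, continuous f}.
Proof. by move=> sf Ux; have [] := sf [::] x Ux. Qed.

Lemma smooth_is_derive f x i : smooth_on U f -> U x ->
  is_derive x (delta_mx 0 i) f (partial i f x).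
Proof. by move=> sf Ux; have [_ /(_ i) /derivableP] := sf [::] x Ux. Qed.

(** Smoothness speaks of all iterated partial derivatives at once. A class of
    continuous functions that contains, on U, the partial derivatives of its
    members is therefore a class of smooth functions; this replaces an
    explicit formula for the iterated derivatives of a product or a
    quotient. *)
Lemma smooth_coind (P : ('rV[R]_n -> R) -> Prop) :
  (forall f x, P f -> U x -> {for x, continuous f}) ->
  (forall f i, P f -> exists2 g, P g &
     forall x, U x -> is_derive x (delta_mx 0 i) f (g x)) ->
  forall f, P f -> smooth_on U f.
Proof.
move=> Pc Pd f Pf s.
have [g Pg fg] : exists2 g, P g & forall x, U x -> partials s f x = g x.
  elim: s => [|i s [g Pg fg]]; first by exists f.
  have [h Ph gh] := Pd _ i Pg; exists h => // x Ux /=.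
  by rewrite (partial_eq_on i fg Ux) /partial (gh x Ux).(derive_val).
move=> x Ux; have e : \forall y \near x, g y = partials s f y.
  by apply: near_open => // y Uy; rewrite fg.
split=> [|i].
  rewrite /prop_for /continuous_at fg//.
  by apply: (cvg_trans (near_eq_cvg e)); exact: Pc.
have [h _ gh] := Pd _ i Pg.
by apply: near_eq_derivable e _; have [] := gh x Ux.
Qed.

(** The derivative of an inverse is a product of sums, products and inverses,
    so these operations are treated together: their closure is stable under
    differentiation. *)
Inductive rational_in_smooth : ('rV[R]_n -> R) -> Prop :=
| rat_smooth f : smooth_on U f -> rational_in_smooth f
| rat_cst c : rational_in_smooth (fun=> c)
| rat_coord k : rational_in_smooth (fun x => x 0 k)
| rat_add f g : rational_in_smooth f -> rational_in_smooth g ->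
    rational_in_smooth (fun x => f x + g x)
| rat_mul f g : rational_in_smooth f -> rational_in_smooth g ->
    rational_in_smooth (fun x => f x * g x)
| rat_inv f : rational_in_smooth f -> (forall x, U x -> f x != 0) ->
    rational_in_smooth (fun x => (f x)^-1).

Lemma is_derive_coord k x v : is_derive x v (fun y => y 0 k) (v 0 k).
Proof.
apply: DeriveDef; first exact/diff_derivable/differentiable_coord.
apply/cvg_lim => //; apply: cvg_near_cst.
near=> h; rewrite /= !mxE addrK /GRing.scale/= mulKf//.
by near: h; exact: nbhs_dnbhs_neq.
Unshelve. all: by end_near. Qed.

Lemma smooth_rational f : rational_in_smooth f -> smooth_on U f.
Proof.
move: f; apply: smooth_coind => [f x rf Ux|f i].
  elim: rf => {f} [f /smooth_continuous sf|c|k|f g _ cf _ cg|f g _ cf _ cg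
    |f _ cf f0].
  - exact: sf.
  - exact: cst_continuous.
  - exact: coord_continuous.
  - exact: (@continuousD _ _ _ f g x cf cg).
  - exact: (@continuousM _ _ f g x cf cg).
  - exact: (@continuousV _ _ f x (f0 x Ux) cf).
elim=> {f} [f sf|c|k|f g rf [f' rf' df] rg [g' rg' dg]
    |f g rf [f' rf' df] rg [g' rg' dg]|f rf [f' rf' df] f0].
- exists (partial i f); last by move=> x; exact: smooth_is_derive.
  exact/rat_smooth/smooth_partial.
- by exists (fun=> 0); [exact: rat_cst|move=> x _; exact: is_derive_cst].
- exists (fun=> (delta_mx 0 i : 'rV[R]_n) 0 k); first exact: rat_cst.
  by move=> x _; exact: is_derive_coord.
- exists (fun x => f' x + g' x); first exact: rat_add.
  by move=> x Ux; apply: is_derive_add; [exact: df|exact: dg].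
- exists (fun x => f' x * g x + f x * g' x).
    by apply: rat_add; exact: rat_mul.
  by move=> x Ux; apply: is_derive_mul; [exact: df|exact: dg].
- exists (fun x => (-1 * f' x) * ((f x)^-1 * (f x)^-1)).
    by do ![apply: rat_mul|exact: rat_inv|exact: rat_cst| done].
  by move=> x Ux; rewrite mulN1r; apply: is_derive_inv; [exact: f0|exact: df].
Qed.

Lemma smooth_cst c : smooth_on U (fun=> c).
Proof. exact/smooth_rational/rat_cst. Qed.

Lemma smooth_coord k : smooth_on U (fun x => x 0 k).
Proof. exact/smooth_rational/rat_coord. Qed.

Lemma smoothD f g : smooth_on U f -> smooth_on U g ->
  smooth_on U (fun x => f x + g x).
Proof. by move=> sf sg; apply/smooth_rational/rat_add; exact: rat_smooth. Qed.

Lemma smoothM f g : smooth_on U f -> smooth_on U g ->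
  smooth_on U (fun x => f x * g x).
Proof. by move=> sf sg; apply/smooth_rational/rat_mul; exact: rat_smooth. Qed.

Lemma smoothV f : smooth_on U f -> (forall x, U x -> f x != 0) ->
  smooth_on U (fun x => (f x)^-1).
Proof.
by move=> sf f0; apply/smooth_rational/rat_inv => //; exact: rat_smooth.
Qed.

Lemma smooth_sum (I : Type) (r : seq I) (P : pred I) (F : I -> 'rV[R]_n -> R) :
  (forall i, smooth_on U (F i)) ->
  smooth_on U (fun x => \sum_(i <- r | P i) F i x).
Proof.
move=> sF; elim: r => [|i r IH].
  by under eq_fun do rewrite big_nil; exact: smooth_cst.
have -> : (fun x => \sum_(j <- i :: r | P j) F j x) = if P i
    then fun x => F i x + \sum_(j <- r | P j) F j x
    else fun x => \sum_(j <- r | P j) F j x.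
  by apply/funext => x; rewrite big_cons; case: (P i).
by case: (P i); [exact: (smoothD (sF i) IH)|exact: IH].
Qed.

Lemma smooth_prod (I : Type) (r : seq I) (P : pred I) (F : I -> 'rV[R]_n -> R) :
  (forall i, smooth_on U (F i)) ->
  smooth_on U (fun x => \prod_(i <- r | P i) F i x).
Proof.
move=> sF; elim: r => [|i r IH].
  by under eq_fun do rewrite big_nil; exact: smooth_cst.
have -> : (fun x => \prod_(j <- i :: r | P j) F j x) = if P i
    then fun x => F i x * \prod_(j <- r | P j) F j x
    else fun x => \prod_(j <- r | P j) F j x.
  by apply/funext => x; rewrite big_cons; case: (P i).
by case: (P i); [exact: (smoothM (sF i) IH)|exact: IH].
Qed.

Lemma partialD f g i x : smooth_on U f -> smooth_on U g -> U x ->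
  partial i (fun y => f y + g y) x = partial i f x + partial i g x.
Proof.
move=> sf sg Ux.
exact: (is_derive_add (smooth_is_derive i sf Ux)
  (smooth_is_derive i sg Ux)).(derive_val).
Qed.

Lemma partialM f g i x : smooth_on U f -> smooth_on U g -> U x ->
  partial i (fun y => f y * g y) x = partial i f x * g x + f x * partial i g x.
Proof.
move=> sf sg Ux.
exact: (is_derive_mul (smooth_is_derive i sf Ux)
  (smooth_is_derive i sg Ux)).(derive_val).
Qed.

Lemma partial_cst c i x : partial i (fun=> c) x = 0.
Proof. exact: derive_cst. Qed.

Lemma partial_sum (I : Type) (r : seq I) (P : pred I) (F : I -> 'rV[R]_n -> R)
  i x : (forall j, smooth_on U (F j)) -> U x ->
  partial i (fun y => \sum_(j <- r | P j) F j y) x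
  = \sum_(j <- r | P j) partial i (F j) x.
Proof.
move=> sF Ux; elim: r => [|j r IH].
  under eq_fun do rewrite big_nil.
  by rewrite big_nil partial_cst.
under eq_fun do rewrite big_cons.
rewrite big_cons; case: (P j) => //.
by rewrite partialD ?IH//; exact: smooth_sum.
Qed.

End SmoothClass.

(** * Differentials and the chain rule along curves *)

Lemma is_derive_continuous (R : realType) (f : R -> R) (s l : R) :
  is_derive s (1 : R) f l -> {for s, continuous f}.
Proof. by case=> /derivable1_diffP /differentiable_continuous. Qed.

(** The sign of a is arbitrary, so that a displacement along a coordinate axis
    needs no case distinction. *)
Lemma mean_value0 (R : realType) (f df : R -> R) (a : R) :
  (forall s, `|s| <= `|a| -> is_derive s (1 : R) f (df s)) ->
  exists2 c, `|c| <= `|a| & f a - f 0 = df c * a.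
Proof.
move=> fd.
have cont b c : (forall s, b <= s <= c -> `|s| <= `|a|) ->
    {within `[b, c], continuous f}.
  move=> bc; apply: continuous_in_subspaceT => s; rewrite inE/= in_itv/= => h.
  by apply: (@is_derive_continuous _ _ _ (df s)); exact/fd/bc.
have [a0|a0] := leP 0 a.
  have sa s : 0 <= s <= a -> `|s| <= `|a|.
    by move=> /andP[s0 sa]; rewrite !ger0_norm.
  have [||c] := @MVT_segment R f df 0 a a0; last first.
  - by rewrite in_itv/= => /sa ca ->; exists c => //; rewrite subr0.
  - exact: cont.
  - move=> s; rewrite in_itv/= => /andP[s0 s1]; apply: fd.
    by apply: sa; rewrite !ltW.
have sa s : a <= s <= 0 -> `|s| <= `|a|.
  by move=> /andP[s0 sa]; rewrite !ler0_norm ?lerN2// ltW.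
have [||c] := @MVT_segment R f df a 0 (ltW a0); last first.
- rewrite in_itv/= => /sa ca e; exists c => //.
  by rewrite -opprB e sub0r mulrN opprK.
- exact: cont.
- move=> s; rewrite in_itv/= => /andP[s0 s1]; apply: fd.
  by apply: sa; rewrite !ltW.
Qed.

Lemma rV_norm_le (R : realType) n (v : 'rV[R]_n) (c : R) : 0 <= c ->
  (forall i, `|v 0 i| <= c) -> `|v| <= c.
Proof.
move=> c0 vc; rewrite /Num.norm/= mx_normrE; apply: bigmax_le => // -[i j] _.
by rewrite /= (ord1 i).
Qed.

Lemma rV_coord_le (R : realType) n (v : 'rV[R]_n) i : `|v 0 i| <= `|v|.
Proof.
rewrite [leRHS]/Num.norm/= mx_normrE.
exact: (le_bigmax _ (fun ij => `|v ij.1 ij.2|) (0, i)).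
Qed.

Section SmoothChain.
Variables (R : realType) (n : nat) (U : set 'rV[R]_n).
Hypothesis oU : open U.
Implicit Types (f g : 'rV[R]_n -> R) (x y v : 'rV[R]_n).

(** The differential of f at x applied to v when f is smooth. *)
Definition tangent f x v : R := \sum_k v 0 k * partial k f x.

Lemma smooth_ball f x e : 0 < e -> smooth_on U f -> U x ->
  exists2 d, 0 < d & forall y, `|y - x| < d ->
    U y /\ `|f y - f x| <= e.
Proof.
move=> e0 sf Ux; have /cvgrPdist_le/(_ _ e0) := smooth_continuous sf Ux.
move=> /(filterI (open_nbhs_nbhs (conj oU Ux)))/nbhs_ballP[d d0 dP].
exists d => // y yd; have [|Uy yf] := dP y.
  by rewrite -ball_normE/= distrC.
by rewrite distrC.
Qed.

(** Continuous partial derivatives give a differential: go from x to y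
    parallel to the axes, apply the mean value theorem on each of the n legs,
    and use that the partial derivatives on the legs are close to those at
    x. *)
Lemma smooth_linear_approx f x e : smooth_on U f -> U x -> 0 < e ->
  exists2 d, 0 < d & forall y, `|y - x| < d ->
    U y /\ `|f y - f x - tangent f x (y - x)| <= e * `|y - x|.
Proof.
move=> sf Ux e0; pose e' := e / n.+1%:R.
have e'0 : 0 < e' by rewrite divr_gt0.
have [d d0 dP] : exists2 d, 0 < d & forall y, `|y - x| < d ->
    U y /\ forall k, `|partial k f y - partial k f x| <= e'.
  have near_k : \forall y \near x,
      forall k, `|partial k f y - partial k f x| <= e'.
    apply: (@filter_forall _ 'I_n
      (fun k y => `|partial k f y - partial k f x| <= e') _ (nbhs_filter x)) => k.
    have := smooth_continuous (smooth_partial k sf) Ux.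
    by move=> /cvgrPdist_le/(_ _ e'0); apply: filterS => y; rewrite distrC.
  have /nbhs_ballP[d d0 dP] : nbhs x (fun y => U y /\
      forall k, `|partial k f y - partial k f x| <= e').
    exact: (filterI (open_nbhs_nbhs (conj oU Ux)) near_k).
  exists d => // y yd; apply: dP.
  by rewrite -ball_normE/= distrC.
exists d => // y yd; split; first by have [] := dP y yd.
move: yd; have [h hE] : {h | h = y - x} by exists (y - x).
rewrite -hE => yd.
(* z k is the corner reached after the first k coordinates have been moved
   from x to y. *)
pose z k := x + \row_i (if (i < k)%N then h 0 i else 0).
have zS (k : 'I_n) : z k.+1 = z k + h 0 k *: delta_mx 0 k.
  apply/rowP => i; rewrite !mxE eqxx/= ltnS leq_eqVlt -addrA; congr (_ + _).
  case: (altP (i =P k)) => [->|ik]; first by rewrite eqxx ltnn mulr1 add0r.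
  by rewrite (inj_eq val_inj) (negbTE ik)/= mulr0 addr0.
have z0 : z 0%N = x by apply/rowP => i; rewrite !mxE addr0.
have zn : z n = y by apply/rowP => i; rewrite !mxE ltn_ord hE !mxE addrC subrK.
have step (k : 'I_n) :
    `|f (z k.+1) - f (z k) - h 0 k * partial k f x| <= e' * `|h|.
  have inb s : `|s| <= `|h 0 k| -> `|z k + s *: delta_mx 0 k - x| < d.
    move=> sh; apply: le_lt_trans yd; rewrite /z addrAC (addrC x) addrK.
    apply: rV_norm_le => // i; rewrite !mxE eqxx/=.
    have [->|ik] := eqVneq i k.
      by rewrite ltnn add0r mulr1 (le_trans sh)// rV_coord_le.
    rewrite mulr0 addr0; case: ifP => _; last by rewrite normr0.
    exact: (rV_coord_le h).
  have [|c ch] := @mean_value0 R (fun s => f (z k + s *: delta_mx 0 k))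
    (fun s => partial k f (z k + s *: delta_mx 0 k)) (h 0 k).
    move=> s sh; have [Uz _] := dP _ (inb _ sh).
    exact: (is_derive_line _ _ _ _ _).1 (smooth_is_derive k sf Uz).
  rewrite scale0r addr0 -zS => ->.
  rewrite mulrC -mulrBr normrM mulrC ler_pM//; last exact: rV_coord_le.
  by have [_] := dP _ (inb _ ch); exact.
have -> : f y - f x - tangent f x h
    = \sum_(k < n) (f (z k.+1) - f (z k) - h 0 k * partial k f x).
  rewrite sumrB; congr (_ - _).
  rewrite -(big_mkord xpredT (fun k => f (z k.+1) - f (z k))).
  by rewrite telescope_sumr// zn z0.
apply: (le_trans (ler_norm_sum _ _ _)).
apply: (@le_trans _ _ (\sum_(k < n) e' * `|h|)); first exact: ler_sum.
rewrite sumr_const card_ord -mulr_natl mulrA ler_wpM2r// /e' mulrC -mulrA.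
by rewrite ler_piMr ?(ltW e0)// mulrC ler_pdivrMr// mul1r ler_nat.
Qed.

(** The difference quotient of f along c differs from the partial derivatives
    of f paired with the difference quotient q of c by a term that the linear
    approximation makes small compared with q, and q stays bounded. *)
Lemma smooth_comp_curve f (c : R -> 'rV[R]_n) s c' :
  smooth_on U f -> U (c s) -> is_derive s (1 : R) c c' ->
  is_derive s (1 : R) (fun t => f (c t)) (tangent f (c s) c').
Proof.
move=> sf Uc dc.
have dk k : is_derive s (1 : R) (fun t => c t 0 k) (c' 0 k).
  have [cs dcs] := dc; apply: DeriveDef; first by have /derivable_mxP := cs; exact.
  by move: dcs; rewrite derive_mx// => <-; rewrite mxE.
pose q (h : R) : 'rV[R]_n := h^-1 *: (c (h *: (1 : R) + s) - c s).
have qk k : q h 0 k @[h --> 0^'] --> c' 0 k.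
  have [/cvg_ex[l cl] dl] := dk k.
  have el : l = c' 0 k by rewrite -dl; apply/esym/cvg_lim.
  rewrite -el; apply: cvg_trans cl; apply: near_eq_cvg; apply: nearW => h.
  by rewrite /q !mxE.
have qc : q h @[h --> 0^'] --> c'.
  have [/cvg_ex[l cl] dl] := dc.
  by have <- : l = c' by rewrite -dl; apply/esym/cvg_lim.
pose F h := h^-1 *: ((fun t => f (c t)) (h *: (1 : R) + s) - f (c s)).
have cc : {for s, continuous c}.
  by apply: differentiable_continuous; apply/derivable1_diffP; have [] := dc.
have lim0 : F h - \sum_k q h 0 k * partial k f (c s) @[h --> 0^'] --> (0 : R).
  apply/cvgr0Pnorm_le => e e0.
  have M0 : 0 < `|c'| + 1 by rewrite ltr_wpDl.
  have [d d0 dP] := smooth_linear_approx sf Uc (divr_gt0 e0 M0).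
  have qM : \forall h \near 0^', `|q h| <= `|c'| + 1.
    move/cvgrPdist_le : qc => /(_ _ (@ltr01 R)); apply: filterS => h h1.
    rewrite -[q h](subKr c') (le_trans (ler_normB _ _))// lerD2l.
    exact: h1.
  have cd : \forall h \near 0^', `|c (h *: (1 : R) + s) - c s| < d.
    apply: nbhs_dnbhs.
    have sc : c (h *: (1 : R) + s) @[h --> 0] --> c s.
      have {2}-> : s = 0 *: (1 : R) + s by rewrite scale0r add0r.
      apply: (@continuous_comp _ _ _ (fun h : R => h *: (1 : R) + s) c).
        by apply: cvgD; [apply: cvgZl; exact: cvg_id|exact: cvg_cst].
      by rewrite scale0r add0r.
    by move/cvgrPdist_lt : sc => /(_ _ d0); apply: filterS => h; rewrite distrC.
  near=> h.
  have h0 : h != 0 by near: h; exact: nbhs_dnbhs_neq.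
  have -> : F h - \sum_k q h 0 k * partial k f (c s) = h^-1 *
      (f (c (h *: (1 : R) + s)) - f (c s)
       - tangent f (c s) (c (h *: (1 : R) + s) - c s)).
    rewrite /F mulrBr; congr (_ - _); rewrite mulr_sumr; apply: eq_bigr => k _.
    by rewrite /q mxE mulrA.
  have [|_ +] := dP (c (h *: (1 : R) + s)); first by near: h; exact: cd.
  rewrite normrM => /(ler_wpM2l (normr_ge0 h^-1)) /le_trans; apply.
  have qh : `|q h| <= `|c'| + 1 by near: h; exact: qM.
  rewrite mulrCA -normrZ -/(q h) mulrAC ler_pdivrMr//.
  by rewrite ler_wpM2l ?(ltW e0).
have cF : F h @[h --> 0^'] --> tangent f (c s) c'.
  rewrite -[tangent _ _ _]add0r.
  have -> : F = (fun h => (F h - \sum_k q h 0 k * partial k f (c s))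
    + \sum_k q h 0 k * partial k f (c s)).
    by apply/funext => h; rewrite subrK.
  apply: cvgD; first exact: lim0.
  apply: cvg_big => [|k _]; first exact: add_continuous.
  by apply: cvgM; [exact: qk|exact: cvg_cst].
by apply: DeriveDef; [apply/cvg_ex; exists (tangent f (c s) c')|apply/cvg_lim].
Unshelve. all: by end_near. Qed.

End SmoothChain.

(** * Symmetry of second derivatives, and calculus with matrix entries *)

Section Tangent.
Variables (R : realType) (n : nat) (U : set 'rV[R]_n).
Hypothesis oU : open U.
Implicit Types (f g : 'rV[R]_n -> R) (x y v : 'rV[R]_n).

(** Apply the mean value theorem in direction i to the difference of f in
    direction j, and then in direction j to the i-th partial derivative. Apart
    from the mixed derivative, the expression is symmetric in i and j. *)
Lemma second_difference f x i j e : smooth_on U f -> U x -> 0 < e ->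
  exists2 d, 0 < d & forall h, 0 < h < d ->
    `|f (x + h *: delta_mx 0 j + h *: delta_mx 0 i)
      - f (x + h *: delta_mx 0 i) - (f (x + h *: delta_mx 0 j) - f x)
      - h * h * partial j (partial i f) x| <= e * (h * h).
Proof.
move=> sf Ux e0.
have s1 := smooth_partial i sf; have s2 := smooth_partial j s1.
have [d d0 dP] := smooth_ball oU e0 s2 Ux.
exists (d / 2); first by rewrite divr_gt0.
move=> h /andP[h0 hd].
have inb s t : `|s| <= `|h| -> `|t| <= `|h| ->
    `|x + s *: delta_mx 0 j + t *: delta_mx 0 i - x| < d.
  move=> sh th; rewrite -(addrA x) [_ - x]addrC addKr.
  have del k : `|delta_mx 0 k : 'rV[R]_n| <= 1.
    apply: rV_norm_le => // l; rewrite mxE.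
    by case: eqP; case: eqP; rewrite /= ?normr1 ?normr0.
  rewrite (le_lt_trans (ler_normD _ _))// !normrZ [ltRHS]splitr.
  apply: ltr_leD.
    rewrite (le_lt_trans _ hd)// -[leRHS](ger0_norm (ltW h0)).
    by rewrite -[leRHS]mulr1 ler_pM.
  rewrite (le_trans _ (ltW hd))// -[leRHS](ger0_norm (ltW h0)).
  by rewrite -[leRHS]mulr1 ler_pM.
have hh : `|h| <= `|h| by [].
have hz : `|0 : R| <= `|h| by rewrite normr0.
have [|c ch] := @mean_value0 R
  (fun t => f (x + h *: delta_mx 0 j + t *: delta_mx 0 i)
            - f (x + t *: delta_mx 0 i))
  (fun t => partial i f (x + h *: delta_mx 0 j + t *: delta_mx 0 i)
            - partial i f (x + t *: delta_mx 0 i)) h.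
  move=> t th; apply: is_deriveB.
    have [Uz _] := dP _ (inb _ _ hh th).
    exact: (is_derive_line _ _ _ _ _).1 (smooth_is_derive i sf Uz).
  have [Uz _] := dP _ (inb _ _ hz th); rewrite scale0r addr0 in Uz.
  exact: (is_derive_line _ _ _ _ _).1 (smooth_is_derive i sf Uz).
rewrite !scale0r !addr0 => ->.
have [|c' ch'] := @mean_value0 R
  (fun t => partial i f (x + c *: delta_mx 0 i + t *: delta_mx 0 j))
  (fun t => partial j (partial i f) (x + c *: delta_mx 0 i + t *: delta_mx 0 j))
  h.
  move=> t th; have [Uz _] := dP _ (inb _ _ th ch).
  rewrite addrAC in Uz.
  exact: (is_derive_line _ _ _ _ _).1 (smooth_is_derive j s1 Uz).
rewrite scale0r addr0 [x + h *: _ + _]addrAC => ->.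
rewrite addrAC; have [_] := dP _ (inb _ _ ch' ch).
have factor (p q : R) : p * h * h - h * h * q = (p - q) * (h * h) by ring.
have hh0 : 0 <= h * h by rewrite mulr_ge0 ?(ltW h0).
by rewrite factor normrM (ger0_norm hh0) => /(ler_wpM2r hh0).
Qed.

(** Clairaut: the two mixed derivatives are limits of the same second
    difference. *)
Lemma partialC f x i j : smooth_on U f -> U x ->
  partial i (partial j f) x = partial j (partial i f) x.
Proof.
move=> sf Ux; apply/eqP; rewrite -subr_eq0 -normr_le0.
apply/ler_addgt0Pr => e e0; rewrite add0r.
have e2 : 0 < e / 2 by rewrite divr_gt0.
have [d1 d10 P1] := second_difference i j sf Ux e2.
have [d2 d20 P2] := second_difference j i sf Ux e2.
pose h := Num.min d1 d2 / 2.
have h0 : 0 < h by rewrite divr_gt0// lt_min d10.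
have h1 : 0 < h < d1.
  by rewrite h0 ltr_pdivrMr// gt_min ltr_pMr// ltr1n.
have h2 : 0 < h < d2.
  by rewrite h0 ltr_pdivrMr// gt_min [d2 < _]ltr_pMr// ltr1n orbT.
have hh : 0 < h * h by rewrite mulr_gt0.
have := P1 h h1; have := P2 h h2.
rewrite (addrAC x) => b1 b2.
rewrite -(ler_pM2r hh) -[X in _ * X](ger0_norm (ltW hh)) -normrM.
set a := f _ in b1 b2; set b := f _ in b1 b2; set c := f _ in b1 b2.
set p := partial i _ x in b1 b2 *; set q := partial j _ x in b1 b2 *.
have -> : (p - q) * (h * h) = (a - c - (b - f x) - h * h * q)
   - (a - b - (c - f x) - h * h * p) by ring.
rewrite (le_trans (ler_normB _ _))// (le_trans (lerD b2 b1))//.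
by rewrite -mulrDl -splitr.
Qed.

Lemma smooth_eq_on f g : (forall x, U x -> f x = g x) ->
  smooth_on U f -> smooth_on U g.
Proof.
move=> fg sf.
apply: (@smooth_coind R n U oU
  (fun h => exists2 k, smooth_on U k & forall x, U x -> k x = h x)).
- move=> h x [k sk kh] Ux; rewrite /prop_for /continuous_at -kh//.
  apply: (cvg_trans (near_eq_cvg (near_open oU Ux kh))).
  exact: (smooth_continuous sk Ux).
- move=> h i [k sk kh]; exists (partial i k).
    exists (partial i k); last by [].
    exact: (smooth_partial i sk).
  move=> x Ux; apply: near_eq_is_derive (smooth_is_derive i sk Ux).
  exact: (near_open oU Ux kh).
- by exists f.
Qed.

Lemma is_derive_affine x v (s : R) :
  is_derive s (1 : R) (fun t : R => x + t *: v) v.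
Proof.
have lim_v : (h^-1 *: (x + (h *: (1 : R) + s) *: v - (x + s *: v)))
    @[h --> 0^'] --> v.
  apply: cvg_near_cst; near=> h.
  rewrite scalerDl opprD addrACA subrr add0r addrK [h *: _]mulr1 scalerA mulVf.
    by rewrite scale1r.
  by near: h; exact: nbhs_dnbhs_neq.
by apply: DeriveDef; [apply/cvg_ex; exists v|apply/cvg_lim].
Unshelve. all: by end_near. Qed.

Lemma smooth_derive_line f x v (s : R) : smooth_on U f -> U (x + s *: v) ->
  is_derive s (1 : R) (fun t => f (x + t *: v)) (tangent f (x + s *: v) v).
Proof.
by move=> sf Ux; apply: (smooth_comp_curve oU sf Ux); exact: is_derive_affine.
Qed.

Lemma tangentD f g x v : smooth_on U f -> smooth_on U g -> U x ->
  tangent (fun y => f y + g y) x v = tangent f x v + tangent g x v.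
Proof.
move=> sf sg Ux; rewrite -big_split; apply: eq_bigr => k _.
by rewrite (partialD _ sf sg Ux) mulrDr.
Qed.

Lemma tangentM f g x v : smooth_on U f -> smooth_on U g -> U x ->
  tangent (fun y => f y * g y) x v = tangent f x v * g x + f x * tangent g x v.
Proof.
move=> sf sg Ux; rewrite mulr_suml mulr_sumr -big_split; apply: eq_bigr => k _.
by rewrite (partialM _ sf sg Ux) mulrDr mulrA mulrCA.
Qed.

Lemma tangent_sum (I : Type) (r : seq I) (P : pred I) (F : I -> 'rV[R]_n -> R)
  x v : (forall j, smooth_on U (F j)) -> U x ->
  tangent (fun y => \sum_(j <- r | P j) F j y) x v
  = \sum_(j <- r | P j) tangent (F j) x v.
Proof.
move=> sF Ux; rewrite exchange_big; apply: eq_bigr => k _.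
by rewrite (partial_sum oU) // mulr_sumr.
Qed.

Lemma tangent_cst c x v : tangent (fun=> c) x v = 0.
Proof. by rewrite /tangent big1// => k _; rewrite partial_cst mulr0. Qed.

Lemma tangent_eq_on f g x v : (forall y, U y -> f y = g y) -> U x ->
  tangent f x v = tangent g x v.
Proof.
by move=> fg Ux; apply: eq_bigr => k _; rewrite (partial_eq_on oU k fg Ux).
Qed.

Lemma tangent_delta f x k : tangent f x (delta_mx 0 k) = partial k f x.
Proof.
rewrite /tangent (bigD1 k)//= big1 ?mxE ?eqxx ?mul1r ?addr0// => j jk.
by rewrite mxE (negbTE jk) andbF mul0r.
Qed.

Lemma smooth_tangent f (v : 'rV[R]_n -> 'rV[R]_n) : smooth_on U f ->
  (forall k, smooth_on U (fun x => v x 0 k)) ->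
  smooth_on U (fun x => tangent f x (v x)).
Proof.
move=> sf sv; apply: (smooth_sum oU) => k.
exact: (smoothM oU (sv k) (smooth_partial k sf)).
Qed.

Definition smooth_mx p q (M : 'rV[R]_n -> 'M[R]_(p, q)) :=
  forall i j, smooth_on U (fun x => M x i j).

Definition tangent_mx p q (M : 'rV[R]_n -> 'M[R]_(p, q)) x v : 'M[R]_(p, q) :=
  \matrix_(i, j) tangent (fun y => M y i j) x v.

Lemma tangent_mxE p q (M : 'rV[R]_n -> 'M[R]_(p, q)) x v i j :
  tangent_mx M x v i j = tangent (fun y => M y i j) x v.
Proof. by rewrite mxE. Qed.

Lemma smooth_mxM p q r (M : 'rV[R]_n -> 'M[R]_(p, q))
  (N : 'rV[R]_n -> 'M[R]_(q, r)) : smooth_mx M -> smooth_mx N ->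
  smooth_mx (fun x => M x *m N x).
Proof.
move=> sM sN i j; under eq_fun do rewrite mxE.
by apply: smooth_sum => // k; exact: smoothM.
Qed.

Lemma smooth_mxD p q (M N : 'rV[R]_n -> 'M[R]_(p, q)) :
  smooth_mx M -> smooth_mx N -> smooth_mx (fun x => M x + N x).
Proof.
by move=> sM sN i j; under eq_fun do rewrite mxE; exact: smoothD.
Qed.

Lemma smooth_mx_cst p q (A : 'M[R]_(p, q)) : smooth_mx (fun=> A).
Proof. by move=> i j; exact: smooth_cst. Qed.

Lemma smooth_mx_tr p q (M : 'rV[R]_n -> 'M[R]_(p, q)) :
  smooth_mx M -> smooth_mx (fun x => (M x)^T).
Proof. by move=> sM i j; under eq_fun do rewrite mxE; exact: sM. Qed.

Lemma smooth_det p (M : 'rV[R]_n -> 'M[R]_p) : smooth_mx M ->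
  smooth_on U (fun x => \det (M x)).
Proof.
move=> sM; apply: smooth_sum => // s.
by apply: smoothM => //; [exact: smooth_cst|exact: smooth_prod].
Qed.

(** By the adjugate formula the entries are rational in those of M. *)
Lemma smooth_mx_inv p (M : 'rV[R]_n -> 'M[R]_p) : smooth_mx M ->
  (forall x, U x -> M x \in unitmx) -> smooth_mx (fun x => invmx (M x)).
Proof.
move=> sM uM i j.
apply: (@smooth_eq_on (fun x => (\det (M x))^-1 * cofactor (M x) j i)).
  by move=> x Ux; rewrite /invmx uM// !mxE.
apply: smoothM => //.
  apply: smoothV => //; first exact: smooth_det.
  by move=> x /uM; rewrite unitmxE unitfE.
apply: smoothM => //; first exact: smooth_cst.
apply: smooth_det => k l.
by under eq_fun do rewrite !mxE; exact: sM.
Qed.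

Lemma smooth_tangent_mx p q (M : 'rV[R]_n -> 'M[R]_(p, q))
  (v : 'rV[R]_n -> 'rV[R]_n) : smooth_mx M -> smooth_mx v ->
  smooth_mx (fun x => tangent_mx M x (v x)).
Proof.
move=> sM sv i j; under eq_fun do rewrite mxE.
by apply: smooth_tangent.
Qed.

Lemma tangent_mxM p q r (M : 'rV[R]_n -> 'M[R]_(p, q))
  (N : 'rV[R]_n -> 'M[R]_(q, r)) x v : smooth_mx M -> smooth_mx N -> U x ->
  tangent_mx (fun y => M y *m N y) x v
  = tangent_mx M x v *m N x + M x *m tangent_mx N x v.
Proof.
move=> sM sN Ux; apply/matrixP => i j; rewrite !mxE -big_split.
have -> : (fun y => (M y *m N y) i j) = (fun y => \sum_k M y i k * N y k j).
  by apply/funext => y; rewrite mxE.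
rewrite tangent_sum//; last by move=> k; exact: smoothM.
by apply: eq_bigr => k _; rewrite tangentM// !mxE.
Qed.

Lemma tangent_mxD p q (M N : 'rV[R]_n -> 'M[R]_(p, q)) x v :
  smooth_mx M -> smooth_mx N -> U x ->
  tangent_mx (fun y => M y + N y) x v = tangent_mx M x v + tangent_mx N x v.
Proof.
move=> sM sN Ux; apply/matrixP => i j.
rewrite [RHS]mxE ![tangent_mx _ _ _ i j]mxE -(tangentD _ (sM i j) (sN i j) Ux).
by have -> : (fun y => (M y + N y) i j) = (fun y => M y i j + N y i j)
  by apply/funext => y; rewrite mxE.
Qed.

Lemma tangent_mx_cst p q (A : 'M[R]_(p, q)) x v : tangent_mx (fun=> A) x v = 0.
Proof. by apply/matrixP => i j; rewrite !mxE tangent_cst. Qed.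

Lemma tangent_mx_eq_on p q (M N : 'rV[R]_n -> 'M[R]_(p, q)) x v :
  (forall y, U y -> M y = N y) -> U x -> tangent_mx M x v = tangent_mx N x v.
Proof.
move=> MN Ux; apply/matrixP => i j; rewrite !mxE.
by apply: tangent_eq_on => // y Uy; rewrite MN.
Qed.

Lemma tangent_mx_tr p q (M : 'rV[R]_n -> 'M[R]_(p, q)) x v :
  tangent_mx (fun y => (M y)^T) x v = (tangent_mx M x v)^T.
Proof.
apply/matrixP => i j; rewrite [RHS]mxE ![tangent_mx _ _ _ _ _]mxE.
by have -> : (fun y => (M y)^T i j) = (fun y => M y j i)
  by apply/funext => y; rewrite mxE.
Qed.

Lemma tangent_mx_inv p (M : 'rV[R]_n -> 'M[R]_p) x v : smooth_mx M ->
  (forall y, U y -> M y \in unitmx) -> U x ->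
  tangent_mx (fun y => invmx (M y)) x v
  = - (invmx (M x) *m tangent_mx M x v *m invmx (M x)).
Proof.
move=> sM uM Ux; have sI := smooth_mx_inv sM uM.
have := tangent_mxM v sI sM Ux.
rewrite (@tangent_mx_eq_on _ _ _ (fun=> 1%:M)) ?tangent_mx_cst//; last first.
  by move=> y Uy; rewrite mulVmx// uM.
move/(congr1 (mulmx^~ (invmx (M x)))); rewrite mul0mx mulmxDl mulmxK ?uM//.
by move/esym/eqP; rewrite addr_eq0 => /eqP.
Qed.

End Tangent.

(** * Second derivative tests *)

Lemma derive_gt0_right (R : realType) (f : R -> R) (s l : R) :
  is_derive s (1 : R) f l -> 0 < l ->
  exists2 d, 0 < d & forall h, 0 < h < d -> f s < f (s + h).
Proof.
move=> [/cvg_ex[l' fl'] dl] l0.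
have {dl}dl : l' = l by rewrite -dl; apply/esym/cvg_lim.
rewrite dl in fl'; move/cvgrPdist_lt : fl' => /(_ _ l0) [d /= d0 dP].
exists d => // h /andP[h0 hd].
have := dP h; rewrite /= sub0r normrN gtr0_norm// => /(_ hd).
rewrite gt_eqF// => /(_ isT); rewrite [h *: 1]mulr1 => hl.
have := le_lt_trans (ler_norm _) hl; rewrite gtrBl.
by rewrite pmulr_rgt0 ?invr_gt0// subr_gt0 addrC.
Qed.

(** A maximum gives f' 0 = 0; if the second derivative l were positive, f'
    would be positive just to the right of 0 and f would increase there. *)
Lemma local_max_derive2 (R : realType) (f f' : R -> R) (e l : R) : 0 < e ->
  (forall s : R, `|s| < e -> is_derive s (1 : R) f (f' s)) ->
  is_derive 0 (1 : R) f' l -> (forall s : R, `|s| < e -> f s <= f 0) -> l <= 0.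
Proof.
move=> e0 df df' fmax; rewrite leNgt; apply/negP => l0.
have inI t : t \in `](- e), e[ -> `|t| < e.
  by rewrite in_itv/= -ltr_norml.
have f'0 : f' 0 = 0.
  have d0 : is_derive (0 : R) (1 : R) f 0.
    apply: (@derive1_at_max _ _ (- e) e).
    - by rewrite ge0_cp// ltW.
    - by move=> t /inI te; have [] := df t te.
    - by rewrite in_itv/= oppr_lt0 e0.
    - by move=> t /inI; exact: fmax.
  have d1 : is_derive (0 : R) (1 : R) f (f' 0) by apply: df; rewrite normr0.
  by rewrite -(@derive_val _ _ _ _ _ _ _ d1) (@derive_val _ _ _ _ _ _ _ d0).
have [d d0 dP] := derive_gt0_right df' l0.
pose h := Num.min d e / 2.
have h0 : 0 < h by rewrite divr_gt0// lt_min d0.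
have hd : h < d by rewrite ltr_pdivrMr// gt_min ltr_pMr// ltr1n.
have he : h < e by rewrite ltr_pdivrMr// gt_min [e < _]ltr_pMr// ltr1n orbT.
have [||c] := @MVT R f f' 0 h h0.
- move=> t; rewrite in_itv/= => /andP[t0 th]; apply: df.
  by rewrite gtr0_norm// (lt_trans th).
- apply: continuous_in_subspaceT => t; rewrite inE/= in_itv/= => /andP[t0 th].
  apply: (@is_derive_continuous _ _ _ (f' t)); apply: df.
  by rewrite ger0_norm// (le_lt_trans th).
rewrite in_itv/= => /andP[c0 ch]; rewrite subr0 => E.
have := fmax h; rewrite gtr0_norm// => /(_ he); rewrite -subr_le0 E.
have : f' 0 < f' (0 + c) by apply: dP; rewrite c0 (lt_trans ch).
by rewrite f'0 add0r leNgt pmulr_lgt0// => ->.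
Qed.

(** The second derivative at 0 of ln a + c ln Z + eps Z, where
    Z t = b + 2 z t + t t is the squared distance to the origin along a
    coordinate line through a point at squared distance b with coordinate z.
    The hypothesis is stated for the exponential of this function, and only
    where Z is positive, to avoid logarithms of quantities of unknown sign. *)
Lemma log_max_test (R : realType) (a a' : R -> R) (a2 c eps z b e : R) :
  0 < e -> 0 < b -> 0 < a 0 ->
  (forall t : R, `|t| < e -> is_derive t (1 : R) a (a' t)) ->
  is_derive 0 (1 : R) a' a2 ->
  (forall t : R, `|t| < e -> 0 < b + 2 * z * t + t * t ->
    a t * expR (c * ln (b + 2 * z * t + t * t) + eps * (b + 2 * z * t + t * t))
    <= a 0 * expR (c * ln b + eps * b)) ->
  (a2 * a 0 - a' 0 * a' 0) / (a 0 * a 0)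
    + c * (2 * b - 4 * (z * z)) / (b * b) + 2 * eps <= 0.
Proof.
move=> e0 b0 a0 da da' amax.
pose Z t := b + 2 * z * t + t * t.
have dZ t : is_derive t (1 : R) Z (2 * z + 2 * t).
  have did : is_derive t (1 : R) (fun s : R => s) 1 by exact: is_derive_id.
  have dcst (k : R) : is_derive t (1 : R) (fun _ : R => k) 0.
    exact: is_derive_cst.
  have H := is_derive_add (is_derive_add (dcst b)
    (is_derive_mul (dcst (2 * z)) did)) (is_derive_mul did did).
  by apply: (is_derive_eq H); ring.
have Z0 : Z 0 = b by rewrite /Z; ring.
have [d d0 dP] : exists2 d, 0 < d & forall t, `|t| < d ->
    [/\ `|t| < e, 0 < a t & 0 < Z t].
  have ca : {for 0, continuous a}.
    by apply: (@is_derive_continuous _ _ _ (a' 0)); apply: da; rewrite normr0.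
  have cZ := is_derive_continuous (dZ 0).
  have ZZ0 : 0 < Z 0 by rewrite Z0.
  have [d /= d0 dP] := filterI (cvgr_gt _ ca _ a0) (cvgr_gt _ cZ _ ZZ0).
  exists (Num.min d e); first by rewrite lt_min d0.
  move=> t; rewrite lt_min => /andP[td te].
  by have [|] := dP t; [rewrite /= sub0r normrN|split].
pose f t := ln (a t) + (c * ln (Z t) + eps * Z t).
pose f' t := (a t)^-1 * a' t
  + (c * ((Z t)^-1 * (2 * z + 2 * t)) + eps * (2 * z + 2 * t)).
have dcst (k t : R) : is_derive t (1 : R) (fun _ : R => k) 0.
  exact: is_derive_cst.
have dln (g : R -> R) (t l : R) : 0 < g t -> is_derive t (1 : R) g l ->
    is_derive t (1 : R) (fun s => ln (g s)) ((g t)^-1 * l).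
  move=> g0 dg; exact: (is_derive1_comp (f := @ln R) (is_derive1_ln g0) dg).
have df t : `|t| < d -> is_derive t (1 : R) f (f' t).
  move=> /dP[te at0 Zt0].
  have H := is_derive_add (dln _ _ _ at0 (da t te))
     (is_derive_add (is_derive_mul (dcst c t) (dln _ _ _ Zt0 (dZ t)))
       (is_derive_mul (dcst eps t) (dZ t))).
  by apply: (is_derive_eq H); rewrite /f' !mul0r !add0r.
have an0 : a 0 != 0 by rewrite gt_eqF.
have bn0 : b != 0 by rewrite gt_eqF.
have dl : is_derive (0 : R) (1 : R) (fun t : R => 2 * z + 2 * t) 2.
  have did : is_derive (0 : R) (1 : R) (fun s : R => s) 1 by exact: is_derive_id.
  have H := is_derive_add (dcst (2 * z) 0) (is_derive_mul (dcst 2 0) did).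
  by apply: (is_derive_eq H); ring.
have df' : is_derive 0 (1 : R) f'
  ((a2 * a 0 - a' 0 * a' 0) / (a 0 * a 0)
    + c * (2 * b - 4 * (z * z)) / (b * b) + 2 * eps).
  have da0 : is_derive 0 (1 : R) a (a' 0) by apply: da; rewrite normr0.
  have Zn0 : Z 0 != 0 by rewrite Z0.
  have H := is_derive_add (is_derive_mul (is_derive_inv an0 da0) da')
    (is_derive_add (is_derive_mul (dcst c 0) (is_derive_mul (is_derive_inv Zn0
     (dZ 0)) dl)) (is_derive_mul (dcst eps 0) dl)).
  by apply: (is_derive_eq H); rewrite Z0; field; rewrite an0 bn0.
apply: (local_max_derive2 d0 df df') => t /dP[te at0 Zt0].
rewrite -ler_expR !expRD !lnK ?posrE//.
by rewrite -!expRD Z0; exact: amax.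
Qed.

Lemma quadratic_near (R : realType) (Q P b z : R) : Q < b < P ->
  exists2 e, 0 < e & forall t : R, `|t| < e -> Q < b + 2 * z * t + t * t < P.
Proof.
move=> /andP[Qb bP].
pose m := Num.min (b - Q) (P - b).
have m0 : 0 < m by rewrite lt_min !subr_gt0 Qb.
have z0 : 0 < 2 * `|z| + 1 by rewrite ltr_wpDl// mulr_ge0.
exists (Num.min 1 (m / (2 * `|z| + 1))).
  by rewrite lt_min ltr01 divr_gt0.
move=> t; rewrite lt_min ltr_pdivlMr// => /andP[t1 tm].
have : `|2 * z * t + t * t| < m.
  apply: le_lt_trans tm; rewrite -mulrDl normrM mulrC ler_wpM2l//.
  rewrite (le_trans (ler_normD _ _))// normrM ger0_norm// lerD2l.
  exact: ltW.
rewrite lt_min !ltr_norml => /andP[/andP[h1 _] /andP[_ h2]].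
by rewrite -addrA; apply/andP; split; lra.
Qed.

(** * A Schwarz lemma for logsubharmonic functions on the disc *)

Section Schwarz.
Variable R : realType.
Implicit Types (z : 'rV[R]_2) (A : 'rV[R]_2 -> R).

Lemma ord2P (i : 'I_2) : i = 0 \/ i = 1.
Proof. by case: i => -[|[|//]] h; [left|right]; exact/val_inj. Qed.

Lemma sum_ord2 (F : 'I_2 -> R) : \sum_i F i = F 0 + F 1.
Proof.
rewrite big_ord_recl big_ord1; congr (F _ + F _); exact: val_inj.
Qed.

Definition normsq z : R := z 0 0 * z 0 0 + z 0 1 * z 0 1.

Lemma normsq_line z (i : 'I_2) (t : R) :
  normsq (z + t *: delta_mx 0 i) = normsq z + 2 * z 0 i * t + t * t.
Proof.
by case: (ord2P i) => ->; rewrite /normsq !mxE /=; ring.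
Qed.

Lemma normsq_ge0 z : 0 <= normsq z.
Proof. by rewrite addr_ge0 // -expr2 sqr_ge0. Qed.

Lemma normsq_continuous : continuous normsq.
Proof.
move=> z; have c i : {for z, continuous (fun y : 'rV[R]_2 => y 0 i)}.
  exact: coord_continuous.
apply: (@continuousD _ _ _ (fun y : 'rV[R]_2 => y 0 0 * y 0 0)
   (fun y : 'rV[R]_2 => y 0 1 * y 0 1)).
  exact: (continuousM (c 0) (c 0)).
exact: (continuousM (c 1) (c 1)).
Qed.

Lemma annulus_compact (Q P : R) : compact [set z | Q <= normsq z <= P].
Proof.
apply: bounded_closed_compact.
  exists (P + 1); split; first by rewrite num_real.
  move=> x Px z /= /andP[_ zP]; apply: rV_norm_le.
    have P0 := le_trans (normsq_ge0 z) zP.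
    by rewrite (le_trans _ (ltW Px))// addr_ge0.
  move=> i; rewrite (le_trans _ (ltW Px))//.
  have zi : z 0 i * z 0 i <= P.
    apply: le_trans zP; rewrite /normsq.
    by case: (ord2P i) => ->; rewrite ?lerDl ?lerDr -expr2 sqr_ge0.
  have n0 : `|z 0 i| * `|z 0 i| <= P by rewrite -normrM ger0_norm// -expr2 sqr_ge0.
  by have := sqr_ge0 (`|z 0 i| - 1); rewrite expr2; nra.
have -> : [set z | Q <= normsq z <= P]
    = normsq @^-1` [set x | Q <= x] `&` normsq @^-1` [set x | x <= P].
  by apply/seteqP; split => z /=; [move/andP|move=> [-> ->]].
apply: closedI; (apply: preimage_closed => [z _|]; first exact: normsq_continuous).
  exact: closed_ge.
exact: closed_le.
Qed.

Definition disc (r : R) : set 'rV[R]_2 := [set z | normsq z < r * r].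

Variables (r M : R) (A : 'rV[R]_2 -> R).
Hypotheses (sA : smooth_on (disc r) A).
Hypothesis A0M : forall z, disc r z -> 0 <= A z <= M.
Hypothesis logsub : forall z, disc r z ->
  \sum_i partial i A z * partial i A z
  <= A z * \sum_i partial i (partial i A) z.

Let weight (e : R) z : R := expR ((e - 1) * ln (normsq z) + e * normsq z).

(** If a logsubharmonic A had a maximum of A |z|^(2(e-1)) exp(e |z|^2) inside
    the annulus, the sum of the two second derivatives of its logarithm would
    be at most 0. But ln A contributes at least 0, ln |z|^2 is harmonic, and
    e |z|^2 contributes 4 e > 0. *)
Lemma no_interior_max e z Q P : 0 < e -> 0 < Q -> P < r * r ->
  Q < normsq z < P -> 0 < A z ->
  ~ (forall y, Q <= normsq y <= P -> A y * weight e y <= A z * weight e z).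
Proof.
move=> e0 Q0 Pr zQP Az0 zmax.
have zr : disc r z by case/andP: zQP => _ /lt_trans; apply.
have b0 : 0 < normsq z by case/andP: zQP => /(lt_trans Q0).
have test i : (partial i (partial i A) z * A z
    - partial i A z * partial i A z) / (A z * A z)
    + (e - 1) * (2 * normsq z - 4 * (z 0 i * z 0 i)) / (normsq z * normsq z)
    + 2 * e <= 0.
  have [d d0 dP] := quadratic_near (z 0 i) zQP.
  have inD t : `|t| < d -> disc r (z + t *: delta_mx 0 i).
    by move=> /dP/andP[_ h]; rewrite /disc/= normsq_line (lt_trans h).
  have z0 : z + 0 *: delta_mx 0 i = z by rewrite scale0r addr0.
  have := @log_max_test R (fun t => A (z + t *: delta_mx 0 i))
    (fun t => partial i A (z + t *: delta_mx 0 i))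
    (partial i (partial i A) z) (e - 1) e (z 0 i) (normsq z) d d0 b0.
  rewrite z0; apply.
  - exact: Az0.
  - move=> t /inD Uz.
    exact: (is_derive_line _ _ _ _ _).1 (smooth_is_derive i sA Uz).
  - have := (is_derive_line (partial i A) z (delta_mx 0 i) 0
      (partial i (partial i A) z)).1.
    by rewrite z0; apply; apply: smooth_is_derive zr; exact: smooth_partial.
  - move=> t td _; have /andP[h1 h2] := dP t td.
    rewrite -normsq_line; apply: zmax.
    by rewrite normsq_line !ltW.
have := logsub zr; rewrite !sum_ord2.
have := lerD (test 0) (test 1); rewrite addr0.
have nE : normsq z = z 0 0 * z 0 0 + z 0 1 * z 0 1 by [].
move: (partial 0 (partial 0 A) z) (partial 1 (partial 1 A) z) => q0 q1.
move: (partial 0 A z) (partial 1 A z) => p0 p1.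
move: (A z) Az0 (normsq z) nE b0 => a a0 b bE b0 + ls.
have -> : (q0 * a - p0 * p0) / (a * a)
   + (e - 1) * (2 * b - 4 * (z 0 0 * z 0 0)) / (b * b) + 2 * e
   + ((q1 * a - p1 * p1) / (a * a)
   + (e - 1) * (2 * b - 4 * (z 0 1 * z 0 1)) / (b * b) + 2 * e)
   = (a * (q0 + q1) - (p0 * p0 + p1 * p1)) / (a * a) + 4 * e
     + (e - 1) * 4 * (b - (z 0 0 * z 0 0 + z 0 1 * z 0 1)) / (b * b).
  by field; rewrite !gt_eqF.
have -> : b - (z 0 0 * z 0 0 + z 0 1 * z 0 1) = 0 by rewrite bE subrr.
rewrite mulr0 mul0r addr0.
have : 0 <= (a * (q0 + q1) - (p0 * p0 + p1 * p1)) / (a * a).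
  by rewrite divr_ge0 ?subr_ge0// mulr_ge0 ?(ltW a0).
move=> g0 h; have : 0 < 4 * e by rewrite mulr_gt0.
by lra.
Qed.

Hypotheses (r0 : 0 < r) (M0 : 0 < M).

(** On the annulus Q <= |z|^2 <= P the maximum of A times the weight lies on
    the boundary. On the inner circle A times the weight is at most a constant
    times Q^e, which is less than its value at z when Q is small, so the
    maximum is on the outer circle. *)
Lemma schwarz_perturbed e z : 0 < e -> disc r z -> 0 < A z -> 0 < normsq z ->
  (exists2 L, 0 < L & exists2 d, 0 < d &
    forall y, normsq y < d -> A y <= L * normsq y) ->
  forall P, normsq z < P -> P < r * r ->
  A z * weight e z <= M * expR ((e - 1) * ln P + e * P).
Proof.
move=> e0 zr Az0 b0 [L L0 [d d0 dP]] P zP Pr.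
have P0 : 0 < P by rewrite (lt_trans b0).
pose kap := A z * weight e z.
have kap0 : 0 < kap by rewrite mulr_gt0// expR_gt0.
(* q is chosen so that Q < q makes L Q^e exp(e Q) smaller than kap, the value
   at z. *)
pose q := expR ((ln (kap / L) - e * normsq z) / e - 1).
have q0 : 0 < q by exact: expR_gt0.
pose Q := Num.min (Num.min d (normsq z)) q / 2.
have Q0 : 0 < Q by rewrite divr_gt0// !lt_min d0 b0.
have Qm : Q < Num.min (Num.min d (normsq z)) q.
  by rewrite ltr_pdivrMr// ltr_pMr ?ltr1n// !lt_min d0 b0.
have [Qd Qz Qq] : [/\ Q < d, Q < normsq z & Q < q].
  by move: Qm; rewrite !lt_min => /andP[/andP[]].
have inner y : normsq y = Q -> A y * weight e y < kap.
  move=> yQ; have := dP y; rewrite yQ => /(_ Qd) Ay.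
  apply: (@le_lt_trans _ _ (L * Q * weight e y)).
    by rewrite ler_wpM2r// expR_ge0.
  rewrite /weight yQ mulrBl mul1r expRD expRD expRN lnK ?posrE//.
  have -> : L * Q * (expR (e * ln Q) / Q * expR (e * Q))
      = L * (expR (e * ln Q) * expR (e * Q)).
    by field; rewrite gt_eqF.
  rewrite -expRD mulrC -ltr_pdivlMr// -[ltRHS]lnK ?posrE ?divr_gt0//.
  rewrite ltr_expR.
  have lQ : ln Q < (ln (kap / L) - e * normsq z) / e - 1.
    by rewrite -ltr_expR lnK ?posrE.
  have : e * ln Q < e * ((ln (kap / L) - e * normsq z) / e - 1).
    by rewrite ltr_pM2l.
  have -> : e * ((ln (kap / L) - e * normsq z) / e - 1)
     = ln (kap / L) - e * normsq z - e by field; rewrite gt_eqF.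
  have : e * Q < e * normsq z by rewrite ltr_pM2l.
  by lra.
have zK : [set y | Q <= normsq y <= P] z by rewrite /= !ltW.
have cont : {within [set y | Q <= normsq y <= P],
    continuous (fun y => A y * weight e y)}.
  apply: continuous_in_subspaceT => y; rewrite inE/= => /andP[Qy yP].
  have y0 : 0 < normsq y by rewrite (lt_le_trans Q0).
  have yr : disc r y by rewrite /disc/= (le_lt_trans yP).
  apply: (@continuousM _ _ A (weight e)); first exact: (smooth_continuous sA yr).
  have cN := normsq_continuous (x := y).
  apply: (@continuous_comp _ _ _
    (fun x => (e - 1) * ln (normsq x) + e * normsq x) expR); last first.
    exact: continuous_expR.
  have cst (k : R) : {for y, continuous (fun _ : 'rV[R]_2 => k)}.
    exact: cst_continuous.
  apply: (@continuousD _ _ _ (fun x : 'rV[R]_2 => (e - 1) * ln (normsq x))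
    (fun x => e * normsq x)); last exact: (continuousM (cst e) cN).
  apply: (@continuousM _ _ (fun _ : 'rV[R]_2 => e - 1)
    (fun x => ln (normsq x))); first exact: cst.
  by apply: continuous_comp => //; exact: continuous_ln.
have [c] := EVT_max_rV (ex_intro _ z zK) (@annulus_compact Q P) cont.
rewrite inE/= => cK cmax.
have {}cmax y : Q <= normsq y <= P -> A y * weight e y <= A c * weight e c.
  by move=> yK; apply: cmax; rewrite inE.
have zc : kap <= A c * weight e c by exact: cmax.
have /andP[Qc cP] := cK.
have [cP'|Pc] := ltP (normsq c) P; last first.
  have cE : normsq c = P by apply/eqP; rewrite eq_le cP.
  apply: (le_trans zc); rewrite /weight cE ler_wpM2r ?expR_ge0//.
  have cr : disc r c by rewrite /disc/= cE.
  by case/andP: (A0M cr).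
have [Qc'|cQ] := ltP Q (normsq c); last first.
  have /inner : normsq c = Q by apply/eqP; rewrite eq_le cQ.
  by rewrite ltNge zc.
have Ac0 : 0 < A c.
  by rewrite -(pmulr_lgt0 _ (expR_gt0 ((e - 1) * ln (normsq c) + e * normsq c)))
    (lt_le_trans kap0).
have := @no_interior_max e c Q P e0 Q0 Pr; rewrite Qc' cP' => /(_ isT Ac0).
by case.
Qed.

(** The perturbed estimate with e -> 0 gives A z P <= M |z|^2 for every
    P < r^2, and then P -> r^2. *)
Lemma schwarz_disc :
  (exists2 L, 0 < L & exists2 d, 0 < d &
    forall y, normsq y < d -> A y <= L * normsq y) ->
  forall z, disc r z -> A z * (r * r) <= M * normsq z.
Proof.
move=> near0 z zr.
have /andP[A0 AM] := A0M zr.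
have [Az0|] := ltP 0 (A z); last first.
  move=> A0'; have -> : A z = 0 by apply/eqP; rewrite eq_le A0'.
  by rewrite mul0r mulr_ge0 ?(ltW M0) ?normsq_ge0.
have b0 : 0 < normsq z.
  rewrite lt_neqAle normsq_ge0 andbT; apply/eqP => b0.
  have [L L0 [d d0 dP]] := near0; have := dP z; rewrite -b0 => /(_ d0).
  by rewrite mulr0 leNgt Az0.
have outer P : normsq z < P -> P < r * r -> A z * P <= M * normsq z.
  move=> zP Pr; have P0 := lt_trans b0 zP.
  suff : ln (A z) + ln P <= ln M + ln (normsq z).
    by rewrite -!lnM ?posrE// ler_ln// posrE mulr_gt0.
  apply/ler_addgt0Pr => eta eta0.
  pose k := `|ln P + P - ln (normsq z) - normsq z| + 1.
  have k0 : 0 < k by rewrite ltr_wpDl.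
  pose e := eta / k; have e0 : 0 < e by rewrite divr_gt0.
  have := schwarz_perturbed e0 zr Az0 b0 near0 zP Pr.
  rewrite -ler_ln ?posrE ?mulr_gt0 ?expR_gt0//.
  rewrite !lnM ?posrE ?expR_gt0// !expRK.
  have : e * (ln P + P - ln (normsq z) - normsq z) <= eta.
    have -> : eta = e * k by rewrite /e divfK// gt_eqF.
    rewrite ler_pM2l// (le_trans (ler_norm _))//.
    by rewrite lerDl.
  by lra.
apply/ler_addgt0Pr => eta eta0.
pose P := Num.max ((normsq z + r * r) / 2) (r * r - eta / (A z)).
have zlt : normsq z < r * r by [].
have zP : normsq z < P by rewrite lt_max; apply/orP; left; lra.
have Pr : P < r * r.
  rewrite gt_max; apply/andP; split; first by lra.
  by rewrite ltrBlDr ltrDl divr_gt0.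
have := outer P zP Pr.
have : A z * (r * r - eta / A z) <= A z * P.
  by rewrite ler_pM2l// le_max lexx orbT.
rewrite mulrBr mulrC [A z * (_ / _)]mulrC divfK ?gt_eqF//.
by lra.
Qed.

End Schwarz.

(** * Inner products and orthonormal bases *)

Section InnerProduct.
Variables (R : realType) (n : nat).
Implicit Types (M : 'M[R]_n) (v w x y : 'rV[R]_n).

Definition ip M v w : R := (v *m M *m w^T) 0 0.

Lemma ipDl M v w x : ip M (v + w) x = ip M v x + ip M w x.
Proof. by rewrite /ip !mulmxDl mxE. Qed.

Lemma ipDr M v w x : ip M x (v + w) = ip M x v + ip M x w.
Proof. by rewrite /ip linearD mulmxDr mxE. Qed.

Lemma ipZl M a v x : ip M (a *: v) x = a * ip M v x.
Proof. by rewrite /ip -!scalemxAl mxE. Qed.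

Lemma ipZr M a v x : ip M x (a *: v) = a * ip M x v.
Proof. by rewrite /ip linearZ -scalemxAr mxE. Qed.

Lemma ipNl M v x : ip M (- v) x = - ip M v x.
Proof. by rewrite -scaleN1r ipZl mulN1r. Qed.

Lemma ipNr M v x : ip M x (- v) = - ip M x v.
Proof. by rewrite -scaleN1r ipZr mulN1r. Qed.

Lemma ip0l M v : ip M 0 v = 0.
Proof. by rewrite /ip !mul0mx mxE. Qed.

Lemma ip0r M v : ip M v 0 = 0.
Proof. by rewrite /ip trmx0 mulmx0 mxE. Qed.

Lemma ipDmx M N v w : ip (M + N) v w = ip M v w + ip N v w.
Proof. by rewrite /ip mulmxDr mulmxDl mxE. Qed.

Lemma ipC M v w : M^T = M -> ip M v w = ip M w v.
Proof.
move=> Ms; rewrite /ip; have -> : (v *m M *m w^T) 0 0 = (v *m M *m w^T)^T 0 0.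
  by rewrite [RHS]mxE.
by rewrite !trmx_mul trmxK Ms mulmxA.
Qed.

Lemma ip_mulmx m (L : 'M[R]_(m, n)) M (v w : 'rV[R]_m) :
  ip M (v *m L) (w *m L) = (v *m (L *m M *m L^T) *m w^T) 0 0.
Proof. by rewrite /ip trmx_mul !mulmxA. Qed.

Lemma posdef_ge0 M v : posdef M -> 0 <= ip M v v.
Proof.
by move=> Mp; have [->|/Mp/ltW//] := eqVneq v 0; rewrite ip0l.
Qed.

Lemma posdef_eq0 M v : posdef M -> ip M v v <= 0 -> v = 0.
Proof.
by move=> Mp; have [//|/Mp v0] := eqVneq v 0; rewrite leNgt v0.
Qed.

Lemma posdef_unit M : posdef M -> M \in unitmx.
Proof.
move=> Mp; rewrite -row_free_unit -kermx_eq0; apply/eqP/row_matrixP => i.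
rewrite row0; apply: (posdef_eq0 Mp).
have /sub_kermxP k0 : (row i (kermx M) <= kermx M)%MS by exact: row_sub.
by rewrite /ip k0 mul0mx mxE.
Qed.

Lemma posdefD M N : posdef M -> posdef N -> posdef (M + N).
Proof.
move=> Mp Np v v0; have := ipDmx M N v v; rewrite /ip => ->.
by rewrite addr_gt0//; [exact: Mp|exact: Np].
Qed.

Lemma invmx_sym M : M^T = M -> (invmx M)^T = invmx M.
Proof. by move=> Ms; rewrite trmx_inv Ms. Qed.

Lemma ip_inv_mulmx M v w : M^T = M -> M \in unitmx ->
  ip (invmx M) (v *m M) (w *m M) = ip M v w.
Proof.
by move=> Ms Mu; rewrite ip_mulmx /ip mulmxV// mul1mx Ms.
Qed.

Lemma posdef_inv M : M^T = M -> posdef M -> posdef (invmx M).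
Proof.
move=> Ms Mp v v0; have Mu := posdef_unit Mp.
have vE : v = (v *m invmx M) *m M by rewrite mulmxKV.
rewrite vE -/(ip _ _ _) ip_inv_mulmx//; apply: Mp.
by apply: contra_neq v0 => v0; rewrite vE v0 mul0mx.
Qed.

Lemma cauchy_schwarz M v w : M^T = M -> posdef M ->
  ip M v w * ip M v w <= ip M v v * ip M w w.
Proof.
move=> Ms Mp; have [->|w0] := eqVneq w 0; first by rewrite !ip0r !mulr0.
have w1 : 0 < ip M w w by exact: Mp.
have := posdef_ge0 (ip M w w *: v - ip M v w *: w) Mp.
rewrite !(ipDl, ipDr, ipZl, ipZr, ipNl, ipNr) (ipC w v Ms).
rewrite (_ : _ + _ = ip M w w * (ip M v v * ip M w w - ip M v w * ip M v w));
  last by ring.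
by rewrite pmulr_rge0// subr_ge0.
Qed.

(** Bessel's inequality for two orthogonal vectors of the same length, not
    normalised: the residual of the projection of x to their span has
    nonnegative square. *)
Lemma bessel2 M x v w : M^T = M -> posdef M -> ip M v w = 0 ->
  ip M w w = ip M v v ->
  ip M x v * ip M x v + ip M x w * ip M x w <= ip M x x * ip M v v.
Proof.
move=> Ms Mp vw0 ww; have [v0|v0] := eqVneq v 0.
  have w0 : w = 0 by apply: (posdef_eq0 Mp); rewrite ww v0 ip0l.
  by rewrite v0 w0 !ip0r !mulr0 addr0.
have v1 : 0 < ip M v v by exact: Mp.
have := posdef_ge0 (ip M v v *: x - (ip M x v *: v + ip M x w *: w)) Mp.
rewrite opprD !(ipDl, ipDr, ipZl, ipZr, ipNl, ipNr).
rewrite (ipC w v Ms) vw0 (ipC v x Ms) (ipC w x Ms) ww.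
move: (ip M v v) v1 (ip M x x) (ip M x v) (ip M x w) => e e0 X s t h.
rewrite -(ler_pM2l e0) -subr_ge0; apply: (le_trans h).
by rewrite le_eqVlt; apply/orP; left; apply/eqP; ring.
Qed.

(** Cauchy-Schwarz for the pairing of a covector with a vector: the dual norm
    is that of the inverse matrix. *)
Lemma dual_cauchy_schwarz M v w : M^T = M -> posdef M ->
  (v *m w^T) 0 0 * (v *m w^T) 0 0 <= ip (invmx M) v v * ip M w w.
Proof.
move=> Ms Mp; have Mu := posdef_unit Mp.
rewrite -(ip_inv_mulmx w w Ms Mu).
suff -> : (v *m w^T) 0 0 = ip (invmx M) v (w *m M).
  by apply: cauchy_schwarz; [exact: invmx_sym|exact: posdef_inv].
by rewrite /ip trmx_mul Ms -!mulmxA mulKmx.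
Qed.

Lemma coord_le_ip M : M^T = M -> posdef M ->
  exists2 K, 0 < K & forall v, `|v| <= K * Num.sqrt (ip M v v).
Proof.
move=> Ms Mp; pose k i := ip (invmx M) (delta_mx 0 i) (delta_mx 0 i).
have k0 i : 0 <= k i by apply/posdef_ge0/posdef_inv.
pose K := 1 + \sum_i Num.sqrt (k i).
have K0 : 0 < K by rewrite ltr_pwDl// sumr_ge0// => i _; rewrite sqrtr_ge0.
exists K => // v; apply: rV_norm_le => [|i].
  by rewrite mulr_ge0 ?(ltW K0) ?sqrtr_ge0.
have := dual_cauchy_schwarz (delta_mx 0 i) v Ms Mp.
have -> : ((delta_mx 0 i : 'rV[R]_n) *m v^T) 0 0 = v 0 i.
  by rewrite -rowE !mxE.
move=> h; apply: (@le_trans _ _ (Num.sqrt (k i) * Num.sqrt (ip M v v))).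
  by rewrite -sqrtrM// -sqrtr_sqr ler_wsqrtr// expr2.
rewrite ler_wpM2r ?sqrtr_ge0// /K (bigD1 i)//= addrCA lerDl.
by rewrite addr_ge0// sumr_ge0// => j _; rewrite sqrtr_ge0.
Qed.

End InnerProduct.

(** The basis is built one vector at a time: the first basis vector splits off
    its orthogonal complement, on which M acts by the Schur complement s. *)
Lemma orthonormal_basis (R : realType) n (M : 'M[R]_n) : M^T = M -> posdef M ->
  exists P : 'M[R]_n, P *m M *m P^T = 1%:M.
Proof.
elim: n M => [|n IH] M Ms Mp; first by exists 0; apply/matrixP => -[].
rewrite -[n.+1]/(1 + n)%N in M Ms Mp *.
pose a := ulsubmx M; pose b := ursubmx M; pose c := drsubmx M.
have ME : M = block_mx a b b^T c.
  rewrite -[LHS]submxK; congr (block_mx _ _ _ _).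
  by rewrite /b trmx_ursub Ms.
have cs : c^T = c by rewrite /c trmx_drsub Ms.
have aE : a = (a 0 0)%:M by rewrite -mx11_scalar.
have a0 : 0 < a 0 0.
  have := Mp (row_mx 1%:M 0); rewrite ME.
  rewrite mul_row_block tr_row_mx mul_row_col !mul0mx !addr0 trmx0 mulmx0 addr0.
  rewrite mul1mx trmx1 mulmx1; apply.
  apply/eqP => /(congr1 lsubmx); rewrite row_mxKl => /matrixP/(_ 0 0).
  by rewrite !mxE/= => /eqP; rewrite oner_eq0.
pose l := - (a 0 0)^-1 *: b^T.
have la : l *m a = - b^T.
  rewrite aE mul_mx_scalar /l scalerA mulrN mulfV ?gt_eqF//.
  by rewrite scaleN1r.
have al : a *m l^T = - b.
  have := congr1 trmx la; rewrite trmx_mul linearN /= trmxK => <-.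
  by rewrite aE tr_scalar_mx.
pose L : 'M[R]_(1 + n) := block_mx 1%:M 0 l 1%:M.
pose s := l *m b + c.
have LML : L *m M *m L^T = block_mx a 0 0 s.
  rewrite ME /L tr_block_mx !mulmx_block !trmx1 !trmx0.
  rewrite !mul1mx !mul0mx !mulmx0 !mulmx1 !addr0 la addNr -/s.
  by rewrite al addNr !mul0mx add0r.
have sT : s^T = s.
  rewrite /s linearD/= cs; congr (_ + _).
  by rewrite trmx_mul /l linearZ/= trmxK -scalemxAl -scalemxAr.
have sp : posdef s.
  move=> v v0; have /Mp : row_mx 0 v *m L != 0.
    rewrite /L mul_row_block mul0mx add0r mulmx1 mul0mx add0r.
    by apply: contra_neq v0 => /(congr1 rsubmx); rewrite row_mxKr linear0.
  rewrite -/(ip _ _ _) ip_mulmx LML mul_row_block !mul0mx !add0r mulmx0.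
  by rewrite tr_row_mx mul_row_col mul0mx add0r.
have [P PsP] := IH _ sT sp.
exists (block_mx ((Num.sqrt (a 0 0))^-1)%:M 0 0 P *m L).
rewrite trmx_mul -!mulmxA (mulmxA M) (mulmxA L) (mulmxA L) LML.
rewrite tr_block_mx !mulmx_block !trmx0 !mul0mx !mulmx0 !addr0 !add0r.
rewrite !mulmxA PsP tr_scalar_mx !mulmx0.
have -> : ((Num.sqrt (a 0 0))^-1)%:M *m a *m ((Num.sqrt (a 0 0))^-1)%:M
    = (1%:M : 'M[R]_1).
  rewrite [X in _ *m X *m _]aE -!scalar_mxM mulrAC -invfM -expr2.
  by rewrite sqr_sqrtr ?mulVf ?gt_eqF ?(ltW a0).
by rewrite -scalar_mx_block.
Qed.

Lemma orthonormal_inv (R : realType) n (M P : 'M[R]_n) : M \in unitmx ->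
  P *m M *m P^T = 1%:M -> invmx M = P^T *m P.
Proof.
move=> Mu PMP; have [Pu _] := mulmx1_unit (etrans (mulmxA P M P^T) PMP).
have MP : M *m (P^T *m P) = 1%:M.
  have E : P *m (M *m (P^T *m P)) = P by rewrite !mulmxA PMP mul1mx.
  by rewrite -[LHS](mulKmx Pu) E mulVmx.
by rewrite -[RHS](mulKmx Mu) MP mulmx1.
Qed.

(** * The Cayley transform of a symplectic Hessian is antiholomorphic *)

Section Symplectic.
Variables (R : realType) (m : nat).
Local Notation J := (Jmx R m).

Lemma Jmx_sqr : J *m J = - 1%:M.
Proof.
rewrite /Jmx mulmx_block !mul0mx !mulmx0 !mulmx1 !mul1mx !add0r !addr0.
by rewrite [in RHS]scalar_mx_block opp_block_mx !oppr0.
Qed.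

Lemma Jmx_tr : J^T = - J.
Proof.
by rewrite /Jmx tr_block_mx opp_block_mx !linear0 linearN/= !trmx1 opprK.
Qed.

Lemma Jmx_ip0 (v : 'rV[R]_(m + m)) : (v *m J *m v^T) 0 0 = 0.
Proof.
have : (v *m J *m v^T) 0 0 = ((v *m J *m v^T)^T) 0 0 by rewrite [RHS]mxE.
rewrite !trmx_mul trmxK Jmx_tr mulNmx mulmxN mulmxA.
have -> : (- (v *m J *m v^T)) 0 0 = - ((v *m J *m v^T) 0 0) by rewrite mxE.
by move=> /eqP; rewrite -addr_eq0 -mulr2n mulrn_eq0 => /eqP.
Qed.

Lemma Sp_sym (A : 'M[R]_(m + m)) : A^T = A -> in_Sp A -> A *m J *m A = J.
Proof. by rewrite /in_Sp => ->. Qed.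

End Symplectic.

Section HessianSp.
Variables (R : realType) (m : nat).
Local Notation n := (m + m)%N.
Variables (U : set 'rV[R]_n) (u : 'rV[R]_n -> R).
Hypotheses (oU : open U) (su : smooth_on U u).
Hypothesis hu : forall x, U x -> posdef (hess u x) /\ in_Sp (hess u x).
Local Notation J := (Jmx R m).
Local Notation H := (hess u).
Implicit Types (x v w a : 'rV[R]_n).

Lemma hessE i j : (fun x => H x i j) = partial i (partial j u).
Proof. by apply/funext => x; rewrite mxE. Qed.

Lemma smooth_hess : smooth_mx U H.
Proof. by move=> i j; rewrite hessE; do 2 apply: smooth_partial. Qed.

Lemma hess_sym x : U x -> (H x)^T = H x.
Proof. by move=> Ux; apply/matrixP => i j; rewrite !mxE (partialC oU j i su). Qed.

Lemma third_sym k i j x : U x -> partial k (partial i (partial j u)) x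
  = partial i (partial k (partial j u)) x.
Proof. exact: (partialC oU k i (smooth_partial j su)). Qed.

Lemma tangent_hessE x v i j : tangent_mx H x v i j
  = \sum_k v 0 k * partial k (partial i (partial j u)) x.
Proof. by rewrite mxE hessE. Qed.

Lemma tangent_hess_sym x v w : U x ->
  v *m tangent_mx H x w = w *m tangent_mx H x v.
Proof.
move=> Ux; apply/rowP => j; rewrite !mxE.
under eq_bigr do rewrite tangent_hessE mulr_sumr.
rewrite exchange_big/=; apply: eq_bigr => k _.
rewrite tangent_hessE mulr_sumr; apply: eq_bigr => i _.
by rewrite third_sym// mulrCA.
Qed.

Lemma tangent_hess_tr x v : U x -> (tangent_mx H x v)^T = tangent_mx H x v.
Proof.
move=> Ux; rewrite -tangent_mx_tr; apply: (tangent_mx_eq_on oU) => // y Uy.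
exact: hess_sym.
Qed.

Variable G : 'M[R]_n.
Hypotheses (Gs : G^T = G) (Gp : posdef G) (GS : G *m J *m G = J).

(** The Jacobian of the map p |-> p G + grad u p, in which G is the Hessian of
    u at a fixed point. This map, called lewy below, supplies the coordinates
    w in which the problem becomes complex analytic. *)
Definition lewy_jac x := H x + G.
Definition lewy_inv x := invmx (lewy_jac x).
Local Notation N := lewy_inv.
(** The Cayley transform N (H - G) of H relative to G. In this form x enters
    only through N, which keeps the derivative simple. *)
Definition cayley x : 'M[R]_n := 1%:M - 2 *: (N x *m G).
(** The complex structure of the space of the coordinates w, acting on row
    vectors from the right; it is an isometry of the inner product given by
    the inverse of G. *)
Definition cplx : 'M[R]_n := J *m G.
(** The derivative of F in the direction v with respect to the coordinates
    w = lewy x, for which dx/dw = N. *)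
Definition covd q (F : 'rV[R]_n -> 'M[R]_(q, n)) v x := tangent_mx F x (v *m N x).

Lemma lewy_jac_posdef x : U x -> posdef (lewy_jac x).
Proof. by move=> Ux; apply: posdefD => //; have [] := hu Ux. Qed.

Lemma lewy_jac_unit x : U x -> lewy_jac x \in unitmx.
Proof. by move=> Ux; apply: posdef_unit; exact: lewy_jac_posdef. Qed.

Lemma smooth_lewy_jac : smooth_mx U lewy_jac.
Proof. exact: (smooth_mxD oU smooth_hess (smooth_mx_cst oU G)). Qed.

Lemma smooth_lewy_inv : smooth_mx U N.
Proof. exact: (smooth_mx_inv oU smooth_lewy_jac lewy_jac_unit). Qed.

Lemma tangent_lewy_jac x v : U x ->
  tangent_mx lewy_jac x v = tangent_mx H x v.
Proof.
move=> Ux; rewrite (tangent_mxD _ smooth_hess (smooth_mx_cst oU G) Ux).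
by rewrite tangent_mx_cst addr0.
Qed.

Lemma tangent_lewy_inv x v : U x ->
  tangent_mx N x v = - (N x *m tangent_mx H x v *m N x).
Proof.
move=> Ux; rewrite (tangent_mx_inv oU _ smooth_lewy_jac lewy_jac_unit Ux).
by rewrite tangent_lewy_jac.
Qed.

Lemma smooth_cayley : smooth_mx U cayley.
Proof.
have -> : cayley = (fun x => 1%:M + N x *m (- 2 *: G)).
  by apply/funext => y; rewrite /cayley -scalemxAr scaleNr.
apply: (smooth_mxD oU (smooth_mx_cst oU _)).
exact: (smooth_mxM oU smooth_lewy_inv (smooth_mx_cst oU _)).
Qed.

Lemma tangent_cayley x v : U x ->
  tangent_mx cayley x v = 2 *: (N x *m tangent_mx H x v *m N x *m G).
Proof.
move=> Ux.
have -> : cayley = (fun x => 1%:M + N x *m (- 2 *: G)).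
  by apply/funext => y; rewrite /cayley -scalemxAr scaleNr.
have sG := smooth_mx_cst oU (- 2 *: G).
have sN := smooth_lewy_inv.
rewrite (tangent_mxD _ (smooth_mx_cst oU _) (smooth_mxM oU sN sG) Ux).
rewrite (tangent_mxM oU _ sN sG Ux) !tangent_mx_cst mulmx0 addr0 add0r.
by rewrite tangent_lewy_inv// -scalemxAr mulNmx scaleNr scalerN opprK.
Qed.

Lemma cplx_sqr : cplx *m cplx = - 1%:M.
Proof. by rewrite /cplx -!mulmxA (mulmxA G) GS Jmx_sqr. Qed.

Lemma cayleyE x : U x -> cayley x = N x *m (H x - G).
Proof.
move=> Ux; have -> : H x - G = lewy_jac x - 2 *: G.
  by rewrite /lewy_jac scaler_nat mulr2n opprD addrA addrK.
by rewrite mulmxBr mulVmx ?lewy_jac_unit// -scalemxAr.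
Qed.

(** Both G and H satisfy A J A = J, so that (H + G) J G = H J (H + G): right
    multiplication by J G is moved through N at the price of turning J G into
    H J, and (H J) (H - G) = - (H - G) (J G). *)
Lemma cplx_cayley x : U x -> cplx *m cayley x = - (cayley x *m cplx).
Proof.
move=> Ux; have Hs := Sp_sym (hess_sym Ux) (hu Ux).2.
have XI : lewy_jac x *m cplx = H x *m J *m lewy_jac x.
  rewrite /lewy_jac /cplx mulmxDl mulmxDr Hs !mulmxA GS.
  by rewrite addrC.
have IN : cplx *m N x = N x *m (H x *m J).
  have := congr1 (fun A => N x *m A *m N x) XI.
  rewrite mulmxA mulVmx ?lewy_jac_unit// mul1mx => ->.
  by rewrite mulmxA mulmxK ?lewy_jac_unit.
rewrite cayleyE// mulmxA IN -!mulmxA -mulmxN; congr (_ *m _).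
by rewrite mulmxA mulmxBr Hs mulmxBl /cplx !mulmxA GS opprB.
Qed.

Definition energy a x := ip (invmx G) (a *m cayley x) (a *m cayley x).

Lemma smooth_mul_cayley a : smooth_mx U (fun x => a *m cayley x).
Proof. exact: (smooth_mxM oU (smooth_mx_cst oU a) smooth_cayley). Qed.

Lemma smooth_covd q (F : 'rV[R]_n -> 'M[R]_(q, n)) v : smooth_mx U F ->
  smooth_mx U (covd F v).
Proof.
move=> sF; apply: (smooth_tangent_mx oU sF).
exact: (smooth_mxM oU (smooth_mx_cst oU v) smooth_lewy_inv).
Qed.

Lemma covd_eq_on q (F E : 'rV[R]_n -> 'M[R]_(q, n)) v x :
  (forall y, U y -> F y = E y) -> U x -> covd F v x = covd E v x.
Proof. by move=> FE Ux; exact: (tangent_mx_eq_on oU). Qed.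

Lemma covd_mulr q (F : 'rV[R]_n -> 'M[R]_(q, n)) (B : 'M[R]_n) v x :
  smooth_mx U F -> U x -> covd (fun y => F y *m B) v x = covd F v x *m B.
Proof.
move=> sF Ux; rewrite /covd (tangent_mxM oU _ sF (smooth_mx_cst oU B) Ux).
by rewrite tangent_mx_cst mulmx0 addr0.
Qed.

Lemma covd_cayley a v x : U x -> covd (fun y => a *m cayley y) v x
  = 2 *: ((a *m N x) *m tangent_mx H x (v *m N x) *m N x *m G).
Proof.
move=> Ux; rewrite /covd.
rewrite (tangent_mxM oU _ (smooth_mx_cst oU a) smooth_cayley Ux).
rewrite tangent_mx_cst mul0mx add0r tangent_cayley// -scalemxAr.
by rewrite !mulmxA.
Qed.

(** Up to constant factors the derivative of a S in direction v is
    (a N) dH(v N) N G, and the third derivatives of u are symmetric. *)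
Lemma covd_cayley_sym a v x : U x ->
  covd (fun y => a *m cayley y) v x = covd (fun y => v *m cayley y) a x.
Proof. by move=> Ux; rewrite !covd_cayley// tangent_hess_sym. Qed.

(** The Cauchy-Riemann equations: w |-> a S is antiholomorphic. By symmetry
    the derivative of a S in direction v I is that of v I S = - v S I in
    direction a, and the constant matrix I can be pulled out. *)
Lemma covd_cayley_cplx a v x : U x ->
  covd (fun y => a *m cayley y) (v *m cplx) x
  = covd (fun y => a *m cayley y) v x *m (- cplx).
Proof.
move=> Ux; rewrite covd_cayley_sym// [in RHS]covd_cayley_sym//.
rewrite -(covd_mulr _ _ (smooth_mul_cayley v) Ux).
apply: covd_eq_on => // y Uy.
by rewrite -mulmxA cplx_cayley// !mulmxN mulmxA.
Qed.

(** The vectors v N are the coordinate fields of the coordinates w, hence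
    commute. In the computation, the derivative of N in the direction w N
    produces v N dH(w N) N, which is symmetric in v and w, and Clairaut's
    theorem does the rest. *)
Lemma covdC q (F : 'rV[R]_n -> 'M[R]_(q, n)) v w x : smooth_mx U F -> U x ->
  covd (covd F v) w x = covd (covd F w) v x.
Proof.
move=> sF Ux; apply/matrixP => i j.
have covdE v1 w1 : covd (covd F v1) w1 x i j
    = tangent (fun y => covd F v1 y i j) x (w1 *m N x).
  exact: (tangent_mxE (covd F v1) x (w1 *m N x) i j).
apply: (etrans (covdE v w)); apply: (etrans _ (esym (covdE w v))).
pose f y := F y i j; have sf : smooth_on U f by exact: sF.
have E v1 : (fun y => covd F v1 y i j)
    = (fun y => \sum_k (v1 *m N y) 0 k * partial k f y).
  by apply/funext => y; rewrite mxE.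
have sN v1 : smooth_mx U (fun y => v1 *m N y).
  exact: (smooth_mxM oU (smooth_mx_cst oU v1) smooth_lewy_inv).
have step v1 w1 : tangent (fun y => covd F v1 y i j) x (w1 *m N x) =
    \sum_k (- (v1 *m N x *m tangent_mx H x (w1 *m N x) *m N x)) 0 k
       * partial k f x
    + \sum_k \sum_l (v1 *m N x) 0 k * (w1 *m N x) 0 l
       * partial l (partial k f) x.
  rewrite E (tangent_sum oU) => [|k|//]; last first.
    by apply: (smoothM oU); [exact: sN|exact: smooth_partial].
  rewrite -big_split; apply: eq_bigr => k _ /=.
  rewrite (tangentM _ (sN v1 0 k) (smooth_partial k sf) Ux); congr (_ * _ + _).
    have -> : tangent (fun y => (v1 *m N y) 0 k) x (w1 *m N x)
        = tangent_mx (fun y => v1 *m N y) x (w1 *m N x) 0 k by rewrite mxE.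
    rewrite (tangent_mxM oU _ (smooth_mx_cst oU v1) smooth_lewy_inv Ux).
    by rewrite tangent_mx_cst mul0mx add0r tangent_lewy_inv// mulmxN !mulmxA.
  by rewrite mulr_sumr; apply: eq_bigr => l _; rewrite mulrA.
rewrite (step v w) (step w v) tangent_hess_sym//; congr (_ + _).
rewrite exchange_big/=; apply: eq_bigr => k _; apply: eq_bigr => l _.
by rewrite (partialC oU k l sf Ux) [_ 0 l * _]mulrC.
Qed.

(** Applying the Cauchy-Riemann equations twice: the real Laplacian of a S
    along a complex line vanishes. *)
Lemma covd2_cayley_cplx a v x : U x ->
  covd (covd (fun y => a *m cayley y) (v *m cplx)) (v *m cplx) x
  = - covd (covd (fun y => a *m cayley y) v) v x.
Proof.
move=> Ux; have sa := smooth_mul_cayley a; have sv := smooth_covd v sa.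
rewrite (covd_eq_on _ (fun y Uy => covd_cayley_cplx a v Uy) Ux).
rewrite covd_mulr// covdC//.
rewrite (covd_eq_on _ (fun y Uy => covd_cayley_cplx a v Uy) Ux) covd_mulr//.
have II : - cplx *m - cplx = - 1%:M by rewrite mulNmx mulmxN opprK cplx_sqr.
by rewrite -mulmxA II mulmxN mulmx1.
Qed.

Lemma tangent_ip (M : 'M[R]_n) (F E : 'rV[R]_n -> 'rV[R]_n) x v :
  smooth_mx U F -> smooth_mx U E -> U x ->
  tangent (fun y => ip M (F y) (E y)) x v
  = ip M (tangent_mx F x v) (E x) + ip M (F x) (tangent_mx E x v).
Proof.
move=> sF sE Ux; have sM := smooth_mx_cst oU M.
have -> : tangent (fun y => ip M (F y) (E y)) x v
  = tangent_mx (fun y => F y *m M *m (E y)^T) x v 0 0 by rewrite mxE.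
rewrite (tangent_mxM oU _ (smooth_mxM oU sF sM) (smooth_mx_tr sE) Ux).
rewrite (tangent_mxM oU _ sF sM Ux) tangent_mx_cst mulmx0 addr0.
by rewrite tangent_mx_tr mxE.
Qed.

Lemma smooth_ip (M : 'M[R]_n) (F E : 'rV[R]_n -> 'rV[R]_n) :
  smooth_mx U F -> smooth_mx U E -> smooth_on U (fun y => ip M (F y) (E y)).
Proof.
move=> sF sE.
exact: (smooth_mxM oU (smooth_mxM oU sF (smooth_mx_cst oU M))
  (smooth_mx_tr sE) 0 0).
Qed.

Lemma smooth_energy a : smooth_on U (energy a).
Proof. by apply: smooth_ip; exact: smooth_mul_cayley. Qed.

Definition cov (f : 'rV[R]_n -> R) v x := tangent f x (v *m N x).

Lemma smooth_cov f v : smooth_on U f -> smooth_on U (cov f v).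
Proof.
move=> sf; apply: (smooth_tangent oU sf) => k.
exact: (smooth_mxM oU (smooth_mx_cst oU v) smooth_lewy_inv).
Qed.

Let Gis : (invmx G)^T = invmx G. Proof. exact: invmx_sym. Qed.
Let Gip : posdef (invmx G). Proof. exact: posdef_inv. Qed.

Lemma cov_energy a v x : U x -> cov (energy a) v x
  = 2 * ip (invmx G) (a *m cayley x) (covd (fun y => a *m cayley y) v x).
Proof.
move=> Ux; have sa := smooth_mul_cayley a.
apply: (etrans (tangent_ip (invmx G) (v *m N x) sa sa Ux)).
by rewrite (ipC _ _ Gis) mulr2n mulrDl mul1r.
Qed.

Lemma cov2_energy a v x : U x -> cov (cov (energy a) v) v x
  = 2 * (ip (invmx G) (covd (fun y => a *m cayley y) v x)
                      (covd (fun y => a *m cayley y) v x)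
    + ip (invmx G) (a *m cayley x)
         (covd (covd (fun y => a *m cayley y) v) v x)).
Proof.
move=> Ux; have sa := smooth_mul_cayley a; have sv := smooth_covd v sa.
rewrite /cov (tangent_eq_on oU _ (fun y Uy => cov_energy a v Uy) Ux).
rewrite (tangentM _ (smooth_cst oU 2) (smooth_ip _ sa sv) Ux).
by rewrite tangent_cst mul0r add0r tangent_ip.
Qed.

Lemma ip_cplx v w : ip (invmx G) (v *m cplx) (w *m cplx) = ip (invmx G) v w.
Proof.
have Gu := posdef_unit Gp.
have GiE : invmx G = - (J *m G *m J).
  have E : G *m (J *m G *m J) = - 1%:M by rewrite !mulmxA GS Jmx_sqr.
  by rewrite -[RHS](mulKmx Gu) mulmxN E opprK mulmx1.
rewrite ip_mulmx /cplx trmx_mul Gs Jmx_tr mulmxK//.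
by have -> : J *m (G *m - J) = invmx G by rewrite !mulmxN mulmxA GiE.
Qed.

Lemma ip_cplx0 v : ip (invmx G) v (v *m cplx) = 0.
Proof.
rewrite /ip trmx_mul /cplx trmx_mul Gs Jmx_tr mulmxN mulNmx mulmxN !mulmxA.
by rewrite mulmxKV ?posdef_unit// mxE Jmx_ip0 oppr0.
Qed.

(** For F with derivatives E and - E I along a complex line and second
    derivatives D and - D, the squared length A = |F|^2 satisfies |grad A|^2
    <= A Lap A. The second derivatives cancel, the Laplacian is 4 |E|^2, and E
    and E I are orthogonal of the same length. *)
Lemma cauchy_riemann_bound (F E D : 'rV[R]_n) :
  2 * ip (invmx G) F E * (2 * ip (invmx G) F E)
  + 2 * ip (invmx G) F (E *m - cplx) * (2 * ip (invmx G) F (E *m - cplx))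
  <= ip (invmx G) F F * (2 * (ip (invmx G) E E + ip (invmx G) F D)
     + 2 * (ip (invmx G) (E *m - cplx) (E *m - cplx) + ip (invmx G) F (- D))).
Proof.
rewrite mulmxN !(ipNl, ipNr) !opprK ip_cplx.
have := bessel2 F Gis Gip (ip_cplx0 E) (ip_cplx E E).
by nra.
Qed.

Lemma energy_logsub a v x : U x ->
  cov (energy a) v x * cov (energy a) v x
  + cov (energy a) (v *m cplx) x * cov (energy a) (v *m cplx) x
  <= energy a x * (cov (cov (energy a) v) v x
     + cov (cov (energy a) (v *m cplx)) (v *m cplx) x).
Proof.
move=> Ux; rewrite (cov_energy a v Ux) (cov_energy a (v *m cplx) Ux).
rewrite (cov2_energy a v Ux) (cov2_energy a (v *m cplx) Ux).
rewrite (covd2_cayley_cplx a v Ux) (covd_cayley_cplx a v Ux).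
exact: cauchy_riemann_bound.
Qed.

Lemma energy_ge0 a x : 0 <= energy a x.
Proof. exact: posdef_ge0. Qed.

(** With b = a N one has a = b H + b G and a S = b H - b G; the cross term of
    the square is a positive multiple of the value of the quadratic form H at
    b. *)
Lemma energy_le a x : U x -> energy a x <= ip (invmx G) a a.
Proof.
move=> Ux; have Gu := posdef_unit Gp.
pose b := a *m N x.
have aE : a = b *m H x + b *m G by rewrite -mulmxDr mulmxKV ?lewy_jac_unit.
have FE : a *m cayley x = b *m H x - b *m G.
  by rewrite cayleyE// mulmxA mulmxBr.
rewrite /energy FE [in leRHS]aE !(ipDl, ipDr, ipNl, ipNr) (ipC (b *m G) _ Gis).
have : 0 <= ip (invmx G) (b *m H x) (b *m G).
  have -> : ip (invmx G) (b *m H x) (b *m G) = ip (H x) b b.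
    by rewrite /ip trmx_mul Gs mulmxA mulmxKV.
  by apply: posdef_ge0; have [] := hu Ux.
by lra.
Qed.

End HessianSp.

(** * Curvature in terms of third derivatives *)

Section Curvature.
Variables (R : realType) (m : nat).
Local Notation n := (m + m)%N.
Variables (U : set 'rV[R]_n) (u : 'rV[R]_n -> R).
Hypotheses (oU : open U) (su : smooth_on U u).
Hypothesis hu : forall x, U x -> posdef (hess u x) /\ in_Sp (hess u x).
Local Notation J := (Jmx R m).
Local Notation H := (hess u).
Local Notation e k := (delta_mx 0 k : 'rV[R]_n).
Implicit Types (x v w a : 'rV[R]_n).

Let sH : smooth_mx U H := smooth_hess su.

Lemma hess_unit x : U x -> H x \in unitmx.
Proof. by move=> Ux; apply: posdef_unit; have [] := hu Ux. Qed.

Let sW : smooth_mx U (fun x => invmx (H x)) := smooth_mx_inv oU sH hess_unit.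

Lemma third_tangent k x i j :
  tangent_mx H x (e k) i j = partial k (partial i (partial j u)) x.
Proof.
by rewrite tangent_mxE tangent_delta hessE.
Qed.

(** Differentiating H J H = J gives H J dH = - dH J H. Since H^-1 = - J H J,
    cyclic permutation shows that the trace of H^-1 dH is its own opposite.
    Equivalently, det H is locally constant. *)
Lemma hess_trace0 x v : U x -> \tr (invmx (H x) *m tangent_mx H x v) = 0.
Proof.
move=> Ux; have Hu := hess_unit Ux.
have HJH y : U y -> H y *m J *m H y = J.
  by move=> Uy; apply: Sp_sym; [exact: (hess_sym oU su)|have [] := hu Uy].
set T := tangent_mx H x v.
have dHJH : H x *m J *m T = - (T *m J *m H x).
  have sJ := smooth_mx_cst oU J.
  have := tangent_mx_eq_on oU v HJH Ux; rewrite tangent_mx_cst.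
  rewrite (tangent_mxM oU v (smooth_mxM oU sH sJ) sH Ux).
  rewrite (tangent_mxM oU v sH sJ Ux) tangent_mx_cst mulmx0 addr0.
  by move/eqP; rewrite addrC addr_eq0 => /eqP.
have WE : invmx (H x) = - (J *m H x *m J).
  have E : H x *m (J *m H x *m J) = - 1%:M by rewrite !mulmxA HJH// Jmx_sqr.
  by rewrite -[RHS](mulKmx Hu) mulmxN E opprK mulmx1.
rewrite WE mulNmx linearN /=; apply/eqP; rewrite oppr_eq0.
have trE : \tr (J *m H x *m J *m T) = - \tr (J *m H x *m J *m T).
  rewrite -{1}mulmxA -{1}mulmxA (mulmxA (H x)) dHJH mulmxN linearN /=.
  by rewrite mxtrace_mulC -!mulmxA mxtrace_mulC !mulmxA.
by move: trE => /eqP; rewrite -addr_eq0 -mulr2n mulrn_eq0.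
Qed.

(** For a Hessian metric the three derivatives in the Koszul formula coincide,
    so two of them cancel. *)
Lemma christoffel_hess k i j x : U x -> christoffel H k i j x
  = 2^-1 * (invmx (H x) *m tangent_mx H x (e i)) k j.
Proof.
move=> Ux; rewrite /christoffel mxE; congr (_ * _); apply: eq_bigr => l _.
congr (_ * _); rewrite third_tangent /dmetric !hessE.
have -> : partial l (partial i (partial j u)) x
    = partial j (partial i (partial l u)) x.
  rewrite (third_sym oU su l i j Ux) [in RHS](third_sym oU su j i l Ux).
  exact: (partial_eq_on oU i (fun y Uy => partialC oU l j su Uy) Ux).
rewrite addrK.
exact: (partial_eq_on oU i (fun y Uy => partialC oU j l su Uy) Ux).
Qed.

Definition dthird i j x := tangent_mx (fun y => tangent_mx H y (e j)) x (e i).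

Lemma dthirdC i j x : U x -> dthird i j x = dthird j i x.
Proof.
move=> Ux; apply/matrixP => k l; rewrite /dthird !tangent_mxE !tangent_delta.
have E i1 : (fun y => tangent_mx H y (e i1) k l)
   = partial i1 (partial k (partial l u)).
  by apply/funext => y; rewrite third_tangent.
rewrite !E; apply: (partialC oU i j _ Ux).
exact: (smooth_partial k (smooth_partial l su)).
Qed.

Lemma partial_christoffel i l j k x : U x ->
  partial i (christoffel H l j k) x = 2^-1 *
   (invmx (H x) *m dthird i j x
    - invmx (H x) *m tangent_mx H x (e i) *m invmx (H x)
      *m tangent_mx H x (e j)) l k.
Proof.
move=> Ux.
rewrite (partial_eq_on oU i (fun y Uy => christoffel_hess l j k Uy) Ux).
have sT : smooth_mx U (fun y => tangent_mx H y (e j)).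
  exact: (smooth_tangent_mx oU sH (smooth_mx_cst oU (e j))).
rewrite (partialM i (smooth_cst oU _) (smooth_mxM oU sW sT l k) Ux).
rewrite partial_cst mul0r add0r; congr (_ * _).
rewrite -tangent_delta -(tangent_mxE (fun y => _ *m _)).
rewrite (tangent_mxM oU _ sW sT Ux) (tangent_mx_inv oU _ sH hess_unit Ux).
by rewrite mulNmx addrC.
Qed.

(** The fourth derivatives of u cancel by symmetry. *)
Lemma riemann_hess l k i j x : U x -> riemann H l k i j x = 4^-1 *
  ((invmx (H x) *m tangent_mx H x (e j) *m (invmx (H x) *m tangent_mx H x (e i)))
     l k
  - (invmx (H x) *m tangent_mx H x (e i) *m (invmx (H x) *m tangent_mx H x (e j)))
     l k).
Proof.
move=> Ux; rewrite /riemann !partial_christoffel// (dthirdC j i Ux).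
have E (X Y : 'M[R]_n) : \sum_p (2^-1 * X l p * (2^-1 * Y p k)) =
    4^-1 * (X *m Y) l k.
  by rewrite mxE mulr_sumr; apply: eq_bigr => p _; field.
have chE i1 j1 : \sum_p (christoffel H l i1 p x * christoffel H p j1 k x)
    = 4^-1 * (invmx (H x) *m tangent_mx H x (e i1)
              *m (invmx (H x) *m tangent_mx H x (e j1))) l k.
  by rewrite -E; apply: eq_bigr => p _; rewrite !christoffel_hess.
rewrite sumrB !chE.
have B (X Y : 'M[R]_n) : (X - Y) l k = X l k - Y l k by rewrite !mxE.
have F (d p q : R) : 2^-1 * (d - p) - 2^-1 * (d - q) + (4^-1 * p - 4^-1 * q)
    = 4^-1 * (q - p) by field.
by rewrite !B !mulmxA; exact: F.
Qed.

(** One of the two terms of the curvature tensor contracts to a multiple of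
    the trace of H^-1 dH, which is zero. *)
Lemma ricci_hess j k x : U x -> ricci H j k x = 4^-1 *
  \tr (invmx (H x) *m tangent_mx H x (e j)
       *m (invmx (H x) *m tangent_mx H x (e k))).
Proof.
move=> Ux; rewrite /ricci; under eq_bigr do rewrite riemann_hess//.
rewrite -mulr_sumr sumrB; congr (_ * _).
set W := invmx (H x).
have WT (i a b : 'I_n) : (W *m tangent_mx H x (e i)) a b
    = (W *m tangent_mx H x (e b)) a i.
  rewrite !mxE; apply: eq_bigr => c _; congr (_ * _).
  rewrite !third_tangent (third_sym oU su i c b Ux).
  rewrite [in RHS](third_sym oU su b c i Ux).
  exact: (partial_eq_on oU c (fun y Uy => partialC oU i b su Uy) Ux).
have -> : \sum_i (W *m tangent_mx H x (e i) *m (W *m tangent_mx H x (e j))) i k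
    = 0.
  under eq_bigr do rewrite mxE.
  rewrite exchange_big/= big1// => a _.
  under eq_bigr do rewrite WT.
  by rewrite -mulr_suml -/(\tr (W *m tangent_mx H x (e a))) hess_trace0// mul0r.
rewrite subr0; apply: eq_bigr => i _.
rewrite [LHS]mxE [RHS]mxE; apply: eq_bigr => a _; congr (_ * _).
exact: WT.
Qed.

(** The rows of P are an orthonormal basis of the metric, so that the inverse
    of H x is P^T P: the scalar curvature is a quarter of the squared norm of
    the tensor of third derivatives of u. *)
Lemma scalar_curvature_hess (P : 'M[R]_n) x : U x -> P *m H x *m P^T = 1%:M ->
  scalar_curvature H x = 4^-1 *
  \sum_a \sum_b \sum_c (P *m tangent_mx H x (row a P) *m P^T) b c ^+ 2.
Proof.
move=> Ux PHP; have Hu := hess_unit Ux.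
pose W := invmx (H x).
have WE : W = P^T *m P := orthonormal_inv Hu PHP.
have TE v : tangent_mx H x v = \sum_j v 0 j *: tangent_mx H x (e j).
  apply/matrixP => b c; rewrite summxE tangent_mxE; apply: eq_bigr => j _.
  by rewrite [RHS]mxE tangent_mxE tangent_delta.
have trE v : \tr (W *m tangent_mx H x v *m (W *m tangent_mx H x v))
   = \sum_j \sum_k v 0 j * v 0 k *
      \tr (W *m tangent_mx H x (e j) *m (W *m tangent_mx H x (e k))).
  have WTE : W *m tangent_mx H x v
      = \sum_j v 0 j *: (W *m tangent_mx H x (e j)).
    by rewrite TE mulmx_sumr; apply: eq_bigr => j _; rewrite -scalemxAr.
  rewrite WTE mulmx_suml linear_sum; apply: eq_bigr => j _.
  rewrite mulmx_sumr linear_sum; apply: eq_bigr => k _.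
  by rewrite -scalemxAl -scalemxAr scalerA linearZ.
rewrite /scalar_curvature; under eq_bigr do under eq_bigr do rewrite ricci_hess//.
transitivity (4^-1 * \sum_a \tr (W *m tangent_mx H x (row a P)
    *m (W *m tangent_mx H x (row a P)))).
  under [in RHS]eq_bigr do rewrite trE.
  rewrite [in RHS]exchange_big/= mulr_sumr; apply: eq_bigr => j _.
  rewrite exchange_big/= mulr_sumr; apply: eq_bigr => k _.
  rewrite -/W mulrCA; congr (_ * _); rewrite -mulr_suml; congr (_ * _).
  by rewrite WE mxE; apply: eq_bigr => a _; rewrite !mxE.
congr (_ * _); apply: eq_bigr => a _; rewrite WE.
set T := tangent_mx H x (row a P).
have -> : \tr (P^T *m P *m T *m (P^T *m P *m T))
   = \tr ((P *m T *m P^T) *m (P *m T *m P^T)).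
  by rewrite -!mulmxA mxtrace_mulC !mulmxA.
apply: eq_bigr => b _; rewrite mxE; apply: eq_bigr => c _.
rewrite expr2; congr (_ * _).
have Ts : (P *m T *m P^T)^T = P *m T *m P^T.
  by rewrite !trmx_mul trmxK (tangent_hess_tr oU su _ Ux) mulmxA.
by rewrite -[in LHS]Ts mxE.
Qed.

End Curvature.

(** * Norms, and surjectivity of the Lewy map *)

Section Norm.
Variables (R : realType) (n : nat) (M : 'M[R]_n).
Hypotheses (Ms : M^T = M) (Mp : posdef M).
Implicit Types (v w : 'rV[R]_n).

Definition mnorm (A : 'M[R]_n) v : R := Num.sqrt (ip A v v).

Lemma mnorm_ge0 v : 0 <= mnorm M v. Proof. exact: sqrtr_ge0. Qed.

Lemma mnorm_sq v : mnorm M v ^+ 2 = ip M v v.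
Proof. by rewrite sqr_sqrtr// posdef_ge0. Qed.

Lemma ip_le_mnorm v w : ip M v w <= mnorm M v * mnorm M w.
Proof.
rewrite -sqrtrM ?posdef_ge0// (le_trans (ler_norm _))// -sqrtr_sqr.
by rewrite ler_wsqrtr// expr2 cauchy_schwarz.
Qed.

Lemma mnormZ k v : mnorm M (k *: v) = `|k| * mnorm M v.
Proof.
rewrite /mnorm ipZl ipZr mulrA -expr2 sqrtrM ?sqr_ge0//.
by rewrite sqrtr_sqr.
Qed.

Lemma mnormN v : mnorm M (- v) = mnorm M v.
Proof. by rewrite -scaleN1r mnormZ normrN1 mul1r. Qed.

Lemma mnormD v w : mnorm M (v + w) <= mnorm M v + mnorm M w.
Proof.
rewrite -ler_sqr ?nnegrE ?mnorm_ge0 ?addr_ge0 ?mnorm_ge0//.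
rewrite sqrrD !mnorm_sq !(ipDl, ipDr) (ipC w v Ms).
have := ip_le_mnorm v w; rewrite mulr2n; lra.
Qed.

Lemma mnorm0 : mnorm M 0 = 0.
Proof. by rewrite /mnorm ip0l sqrtr0. Qed.

Lemma mnorm_eq0 v : mnorm M v = 0 -> v = 0.
Proof.
by move=> v0; apply: (posdef_eq0 Mp); rewrite -mnorm_sq v0 expr0n.
Qed.

End Norm.

Lemma mean_value01 (R : realType) (f df : R -> R) :
  (forall s : R, 0 <= s <= 1 -> is_derive s (1 : R) f (df s)) ->
  exists2 c, 0 <= c <= 1 & f 1 - f 0 = df c.
Proof.
move=> fd; have [||c] := @MVT_segment R f df 0 1 ler01.
- by move=> s; rewrite in_itv/= => /andP[s0 s1]; apply: fd; rewrite !ltW.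
- apply: continuous_in_subspaceT => s; rewrite inE/= in_itv/= => h.
  exact: is_derive_continuous (fd s h).
- by rewrite in_itv/= => c01 ->; exists c => //; rewrite subr0 mulr1.
Qed.

Lemma derive_ge0_right (R : realType) (f : R -> R) (s l d : R) : 0 < d ->
  is_derive s (1 : R) f l -> (forall h : R, 0 < h < d -> f s <= f (s + h)) ->
  0 <= l.
Proof.
move=> d0 df fh; rewrite leNgt; apply/negP => l0.
have dN : is_derive s (1 : R) (fun t => - f t) (- l) by exact: is_deriveN.
have [|e e0 eP] := derive_gt0_right dN; first by rewrite oppr_gt0.
pose h := Num.min d e / 2.
have h0 : 0 < h by rewrite divr_gt0// lt_min d0.
have hd : h < d by rewrite ltr_pdivrMr// gt_min ltr_pMr// ltr1n.
have he : h < e by rewrite ltr_pdivrMr// gt_min [e < _]ltr_pMr// ltr1n orbT.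
have := eP h; rewrite h0 he => /(_ isT); rewrite ltrN2 ltNge fh//.
by rewrite h0 hd.
Qed.

Section LewyMap.
Variables (R : realType) (m : nat).
Local Notation n := (m + m)%N.
Variables (U : set 'rV[R]_n) (u : 'rV[R]_n -> R).
Hypotheses (oU : open U) (su : smooth_on U u).
Hypothesis hu : forall x, U x -> posdef (hess u x) /\ in_Sp (hess u x).
Local Notation J := (Jmx R m).
Local Notation H := (hess u).
Implicit Types (x p q v w a : 'rV[R]_n).
Variable G : 'M[R]_n.
Hypotheses (Gs : G^T = G) (Gp : posdef G).
Local Notation Gi := (invmx G).
Local Notation gn := (mnorm G).
Local Notation gin := (mnorm Gi).

Definition grad x : 'rV[R]_n := \row_i partial i u x.
Definition lewy x : 'rV[R]_n := x *m G + grad x.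

Lemma smooth_id : smooth_mx U (fun x => x).
Proof. by move=> i j; rewrite (ord1 i); exact: (smooth_coord oU j). Qed.

Lemma smooth_grad : smooth_mx U grad.
Proof.
move=> i j; have -> : (fun x => grad x i j) = partial j u.
  by apply/funext => x; rewrite mxE.
exact: smooth_partial.
Qed.

Lemma tangent_id x v : tangent_mx (fun y => y) x v = v.
Proof.
apply/rowP => j; rewrite tangent_mxE /tangent (bigD1 j)//= big1 => [|k kj].
  by rewrite addr0 /partial (is_derive_coord j x _).(derive_val) mxE !eqxx mulr1.
rewrite /partial (is_derive_coord j x _).(derive_val) mxE eqxx/=.
by rewrite eq_sym (negbTE kj) mulr0.
Qed.

Lemma tangent_grad x v : tangent_mx grad x v = v *m H x.
Proof.
apply/rowP => j; rewrite tangent_mxE [RHS]mxE.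
have -> : (fun y => grad y 0 j) = partial j u.
  by apply/funext => y; rewrite mxE.
by apply: eq_bigr => k _; rewrite mxE.
Qed.

Lemma smooth_lewy : smooth_mx U lewy.
Proof.
exact: (smooth_mxD oU (smooth_mxM oU smooth_id (smooth_mx_cst oU G)) smooth_grad).
Qed.

Lemma tangent_lewy x v : U x -> tangent_mx lewy x v = v *m lewy_jac u G x.
Proof.
move=> Ux; have sG := smooth_mx_cst oU G.
rewrite (tangent_mxD v (smooth_mxM oU smooth_id sG) smooth_grad Ux).
rewrite (tangent_mxM oU v smooth_id sG Ux) tangent_mx_cst mulmx0 addr0.
by rewrite tangent_id tangent_grad /lewy_jac mulmxDr addrC.
Qed.

Definition segment_in p q := forall t : R, 0 <= t <= 1 -> U (p + t *: (q - p)).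

Lemma grad_monotone p q : segment_in p q ->
  0 <= ((grad q - grad p) *m (q - p)^T) 0 0.
Proof.
move=> seg; pose d := q - p.
pose f y := \sum_i partial i u y * d 0 i.
have sf : smooth_on U f.
  apply: (smooth_sum oU) => i.
  exact: (smoothM oU (smooth_partial i su) (smooth_cst oU _)).
have df y : U y -> tangent f y d = ip (H y) d d.
  move=> Uy; rewrite (tangent_sum oU) => [|i|//]; last first.
    exact: (smoothM oU (smooth_partial i su) (smooth_cst oU _)).
  rewrite /ip [RHS]mxE; apply: eq_bigr => i _.
  rewrite (tangentM _ (smooth_partial i su) (smooth_cst oU _) Uy).
  rewrite tangent_cst mulr0 addr0 [d^T _ _]mxE; congr (_ * _).
  by rewrite [RHS]mxE; apply: eq_bigr => k _; rewrite [H y k i]mxE.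
have [s s01|c c01] := @mean_value01 R (fun t => f (p + t *: d))
    (fun t => tangent f (p + t *: d) d).
  exact: (smooth_derive_line oU sf (seg s s01)).
rewrite scale1r scale0r addr0 [p + d]addrC subrK => E.
have -> : ((grad q - grad p) *m (q - p)^T) 0 0 = f q - f p.
  rewrite mxE -sumrB; apply: eq_bigr => i _.
  by rewrite [_^T _ _]mxE -mulrBl /grad; congr (_ * _); rewrite !mxE.
rewrite E df; last exact: seg.
by apply: posdef_ge0; have [] := hu (seg c c01).
Qed.

Lemma lewy_monotone p q : segment_in p q ->
  ip G (q - p) (q - p) <= ((lewy q - lewy p) *m (q - p)^T) 0 0.
Proof.
move=> /grad_monotone h.
have -> : lewy q - lewy p = (q - p) *m G + (grad q - grad p).
  by rewrite /lewy mulmxBl opprD addrACA.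
by rewrite mulmxDl mxE lerDl.
Qed.

Lemma dual_le v w : (v *m w^T) 0 0 <= gin v * gn w.
Proof.
rewrite -sqrtrM; last exact/posdef_ge0/posdef_inv.
rewrite (le_trans (ler_norm _))// -sqrtr_sqr ler_wsqrtr// expr2.
exact: dual_cauchy_schwarz.
Qed.

(** As u is convex on the segment, the pairing of lewy q - lewy p with q - p
    is at least |q - p|^2; conclude by Cauchy-Schwarz. *)
Lemma lewy_expanding p q : segment_in p q ->
  gn (q - p) <= gin (lewy q - lewy p).
Proof.
move=> /lewy_monotone h.
have := le_trans h (dual_le _ _); rewrite -(mnorm_sq Gp).
have := mnorm_ge0 G (q - p); rewrite le_eqVlt => /orP[/eqP <- _|n0].
  exact: mnorm_ge0.
by rewrite expr2 ler_pM2r.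
Qed.

Lemma gball_segment x d p q :
  (forall y, gn (y - x) <= d -> U y) -> gn (p - x) <= d -> gn (q - x) <= d ->
  segment_in p q.
Proof.
move=> bU px qx t /andP[t0 t1]; apply: bU.
have -> : p + t *: (q - p) - x = (1 - t) *: (p - x) + t *: (q - x).
  by apply/rowP => i; rewrite !mxE; ring.
apply: (le_trans (mnormD Gs Gp _ _)).
have t1' : 0 <= 1 - t by rewrite subr_ge0.
rewrite !mnormZ (ger0_norm t0) (ger0_norm t1').
have := ler_wpM2l t0 qx; have := ler_wpM2l t1' px; lra.
Qed.

Lemma gball_compact x d : compact [set y | gn (y - x) <= d].
Proof.
have [K K0 Kle] := coord_le_ip Gs Gp.
apply: bounded_closed_compact.
  exists (`|x| + K * d); split; first by rewrite num_real.
  move=> c cK y /= yd; rewrite (le_trans _ (ltW cK))//.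
  rewrite -[y](subrK x) addrC (le_trans (ler_normD _ _))// lerD2l.
  by rewrite (le_trans (Kle _))// ler_pM2l.
have -> : [set y | gn (y - x) <= d]
    = (fun y => gn (y - x)) @^-1` [set r | r <= d] by [].
apply: preimage_closed => [y _|]; last exact: closed_le.
have sip : smooth_on setT (fun y => ip G (y - x) (y - x)).
  have oT : open [set: 'rV[R]_n] by exact: openT.
  have sxT : smooth_mx setT (fun y : 'rV[R]_n => y - x).
    apply: (smooth_mxD oT _ (smooth_mx_cst oT (- x))) => i j.
    by rewrite (ord1 i); exact: (smooth_coord oT j).
  exact: (smooth_mxM oT (smooth_mxM oT sxT (smooth_mx_cst oT G))
    (smooth_mx_tr sxT) 0 0).
have h1 := smooth_continuous sip (I : setT y).
have h2 := @sqrt_continuous R (ip G (y - x) (y - x)).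
have h := continuous_comp h1 h2.
refine h.
Qed.

(** A solution of lewy p = w is a critical point of the strictly convex
    function E p = p G p / 2 + u p - w . p. Let c be its minimum on the closed
    ball of radius e around p0. As E does not decrease from c towards p0,
    monotonicity of lewy gives |c - p0| <= |w - lewy p0| < e, so that c is
    interior. *)
Lemma lewy_cover p0 e w : 0 < e -> (forall q, gn (q - p0) <= e -> U q) ->
  gin (w - lewy p0) < e -> exists2 p, gn (p - p0) < e & lewy p = w.
Proof.
move=> e0 bU we.
pose E p := 2^-1 * ip G p p + u p + (- w *m p^T) 0 0.
have sG := smooth_mx_cst oU G; have sw := smooth_mx_cst oU (- w).
have sq : smooth_on U (fun p => 2^-1 * ip G p p).
  apply: (smoothM oU (smooth_cst oU _)).
  exact: (smooth_mxM oU (smooth_mxM oU smooth_id sG) (smooth_mx_tr smooth_id) 0 0).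
have sl : smooth_on U (fun p => (- w *m p^T) 0 0).
  exact: (smooth_mxM oU sw (smooth_mx_tr smooth_id) 0 0).
have sE : smooth_on U E := smoothD oU (smoothD oU sq su) sl.
have dE p v : U p -> tangent E p v = ((lewy p - w) *m v^T) 0 0.
  move=> Up; rewrite (tangentD v (smoothD oU sq su) sl Up).
  rewrite (tangentD v sq su Up).
  have -> : tangent (fun y => 2^-1 * ip G y y) p v = ip G p v.
    have sip : smooth_on U (fun y => ip G y y).
      exact: (smooth_ip oU G smooth_id smooth_id).
    rewrite (tangentM v (smooth_cst oU _) sip Up) tangent_cst mul0r add0r.
    rewrite (tangent_ip oU G v smooth_id smooth_id Up) tangent_id (ipC v p Gs).
    by field.
  have -> : tangent (fun y => (- w *m y^T) 0 0) p v = (- w *m v^T) 0 0.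
    rewrite -(tangent_mxE (fun y => - w *m y^T)).
    rewrite (tangent_mxM oU v sw (smooth_mx_tr smooth_id) Up).
    by rewrite tangent_mx_cst mul0mx add0r tangent_mx_tr tangent_id.
  have -> : tangent u p v = (grad p *m v^T) 0 0.
    by rewrite mxE; apply: eq_bigr => k _; rewrite !mxE mulrC.
  by rewrite /ip /lewy !mulmxDl !mxE.
pose K := [set y | gn (y - p0) <= e].
have K0 : K !=set0 by exists p0; rewrite /K/= subrr mnorm0 ltW.
have cE : {within K, continuous E}.
  apply: continuous_in_subspaceT => y; rewrite inE => /bU Uy.
  exact: smooth_continuous sE Uy.
have [c] := EVT_min_rV K0 (@gball_compact p0 e) cE.
rewrite inE => Kc cmin; have Uc := bU _ Kc.
(* The one-sided derivative of E at the minimum c is nonnegative in every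
   direction v pointing into the ball. *)
have dir v d : 0 < d -> (forall h, 0 < h < d -> K (c + h *: v)) ->
    0 <= ((lewy c - w) *m v^T) 0 0.
  move=> d0 dK; rewrite -dE//.
  have := @smooth_derive_line _ _ _ oU E c v 0 sE.
  rewrite scale0r addr0 => /(_ Uc) /(derive_ge0_right d0); apply => h hd.
  by rewrite scale0r addr0 add0r; apply: cmin; rewrite inE; exact: dK.
have cp0 : gn (c - p0) < e.
  have : 0 <= ((lewy c - w) *m (p0 - c)^T) 0 0.
    apply: (dir _ 1 ltr01) => h /andP[h0 h1]; rewrite /K/=.
    have -> : c + h *: (p0 - c) - p0 = (1 - h) *: (c - p0).
      by apply/rowP => i; rewrite !mxE; ring.
    rewrite mnormZ ger0_norm ?subr_ge0 ?(ltW h1)//.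
    by rewrite (le_trans _ Kc)// ler_piMl ?mnorm_ge0// gerBl ltW.
  have seg : segment_in p0 c.
    by apply: (gball_segment bU) => //; rewrite subrr mnorm0 ltW.
  have := lewy_monotone seg.
  have -> : lewy c - w = (lewy c - lewy p0) - (w - lewy p0).
    by rewrite opprB addrA subrK.
  have -> : ((lewy c - lewy p0 - (w - lewy p0)) *m (p0 - c)^T) 0 0
    = ((w - lewy p0) *m (c - p0)^T) 0 0
      - ((lewy c - lewy p0) *m (c - p0)^T) 0 0.
    by rewrite -[p0 - c]opprB linearN /= mulmxN -mulNmx opprB mulmxBl !mxE.
  rewrite subr_ge0 => h2 h1.
  have := le_trans h2 (le_trans h1 (dual_le _ _)); rewrite -(mnorm_sq Gp).
  have := mnorm_ge0 G (c - p0); rewrite le_eqVlt => /orP[/eqP <- //|n0].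
  by rewrite expr2 ler_pM2r// => /le_lt_trans; apply.
exists c => //.
(* Since c is interior, the direction - z, opposite to the gradient of E, is
   allowed; it forces z = 0. *)
pose z := lewy c - w.
have : 0 <= (z *m (- z)^T) 0 0.
  have [z0|z0] := eqVneq z 0; first by rewrite z0 mul0mx mxE.
  have nz : 0 < gn (- z).
    rewrite mnormN lt_neqAle mnorm_ge0 andbT eq_sym.
    by apply: contra_neq z0; exact: (mnorm_eq0 Gp).
  apply: (dir _ ((e - gn (c - p0)) / gn (- z))).
    by rewrite divr_gt0// subr_gt0.
  move=> h /andP[h0 hd]; rewrite /K/= addrAC.
  rewrite (le_trans (mnormD Gs Gp _ _))// mnormZ gtr0_norm//.
  by move: hd; rewrite ltr_pdivlMr// => hd; rewrite -lerBrDl ltW.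
rewrite linearN /= mulmxN mxE oppr_ge0 => z0.
apply/eqP; rewrite -subr_eq0 -/z; apply/eqP.
have zz : forall i, z 0 i * z 0 i = 0.
  move: z0; rewrite mxE => z0 i; apply/eqP; rewrite eq_le -expr2 sqr_ge0 andbT.
  rewrite (le_trans _ z0)// (bigD1 i)//= [z^T _ _]mxE -expr2 lerDl.
  by rewrite sumr_ge0// => j _; rewrite [z^T _ _]mxE -expr2 sqr_ge0.
apply/rowP => i; rewrite [RHS]mxE.
by have /eqP := zz i; rewrite mulf_eq0 orbb => /eqP.
Qed.

End LewyMap.

(** * The inverse of the Lewy map on complex lines *)

Lemma mulmx_norm_le (R : realType) n (A : 'M[R]_n) :
  exists2 C, 0 < C & forall y : 'rV[R]_n, `|y *m A| <= C * `|y|.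
Proof.
exists (1 + \sum_i \sum_j `|A j i|) => [|y].
  by rewrite ltr_pwDl// sumr_ge0// => i _; rewrite sumr_ge0.
apply: rV_norm_le => [|i].
  rewrite mulr_ge0// addr_ge0// sumr_ge0// => i _; exact: sumr_ge0.
rewrite mxE (le_trans (ler_norm_sum _ _ _))//.
apply: (@le_trans _ _ (\sum_j `|A j i| * `|y|)).
  apply: ler_sum => j _; rewrite normrM mulrC ler_wpM2l//.
  exact: rV_coord_le.
rewrite -mulr_suml ler_wpM2r// [X in _ <= 1 + X](bigD1 i)//= addrCA lerDl addr_ge0//.
by rewrite sumr_ge0// => k _; rewrite sumr_ge0.
Qed.

Lemma smooth_mx_linear_approx (R : realType) n (U : set 'rV[R]_n) q
  (F : 'rV[R]_n -> 'rV[R]_q) x e : open U ->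
  smooth_mx U F -> U x -> 0 < e -> exists2 d, 0 < d & forall y, `|y - x| < d ->
    `|F y - F x - tangent_mx F x (y - x)| <= e * `|y - x|.
Proof.
move=> oU sF Ux e0.
have near_k : \forall y \near x, forall k,
    `|F y 0 k - F x 0 k - tangent (fun z => F z 0 k) x (y - x)| <= e * `|y - x|.
  apply: (@filter_forall _ 'I_q (fun k y => `|F y 0 k - F x 0 k
    - tangent (fun z => F z 0 k) x (y - x)| <= e * `|y - x|) _
    (nbhs_filter x)) => k.
  have [d d0 dP] := smooth_linear_approx oU (sF 0 k) Ux e0.
  apply/nbhs_ballP; exists d => // y; rewrite -ball_normE/= distrC => /dP[_].
  exact.
have /nbhs_ballP[d d0 dP] : nbhs x (fun y => forall k,
    `|F y 0 k - F x 0 k - tangent (fun z => F z 0 k) x (y - x)| <= e * `|y - x|).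
  exact: near_k.
exists d => // y yd; apply: rV_norm_le => [|k].
  by rewrite mulr_ge0// ltW.
rewrite !mxE; apply: dP.
by rewrite -ball_normE/= distrC.
Qed.

Lemma smooth_mx_lipschitz (R : realType) n (U : set 'rV[R]_n) q
  (F : 'rV[R]_n -> 'rV[R]_q) x : open U -> smooth_mx U F -> U x ->
  exists2 d, 0 < d & exists2 L, 0 < L & forall y, `|y - x| < d ->
    `|F y - F x| <= L * `|y - x|.
Proof.
move=> oU sF Ux.
have [d d0 dP] := smooth_mx_linear_approx oU sF Ux (@ltr01 R).
pose c k := \sum_j `|partial j (fun y => F y 0 k) x|.
have c0 k : 0 <= c k by apply: sumr_ge0.
exists d => //; exists (1 + \sum_k c k); first by rewrite ltr_pwDl// sumr_ge0.
move=> y /dP; rewrite mul1r => h.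
rewrite -[F y - F x](subrK (tangent_mx F x (y - x))).
rewrite (le_trans (ler_normD _ _))// mulrDl mul1r lerD//.
apply: rV_norm_le => [|k]; first by rewrite mulr_ge0// sumr_ge0.
rewrite tangent_mxE (le_trans (ler_norm_sum _ _ _))//.
apply: (@le_trans _ _ (c k * `|y - x|)).
  rewrite mulr_suml; apply: ler_sum => j _.
  by rewrite normrM mulrC ler_wpM2l// rV_coord_le.
by rewrite ler_wpM2r// (bigD1 k)//= lerDl sumr_ge0.
Qed.

Lemma ip_norm_le (R : realType) n (M : 'M[R]_n) :
  exists2 C, 0 < C & forall y : 'rV[R]_n, ip M y y <= C * (`|y| * `|y|).
Proof.
have [C C0 CP] := mulmx_norm_le M.
exists (n.+1%:R * C) => [|y]; first by rewrite mulr_gt0.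
rewrite /ip mxE (le_trans (ler_norm _))// (le_trans (ler_norm_sum _ _ _))//.
apply: (@le_trans _ _ (\sum_(i < n) C * (`|y| * `|y|))).
  apply: ler_sum => i _; rewrite [y^T _ _]mxE normrM mulrA ler_pM//.
    by rewrite (le_trans (rV_coord_le _ _)).
  exact: rV_coord_le.
rewrite sumr_const card_ord -[leLHS]mulr_natl -[leRHS]mulrA.
by apply: ler_wpM2r; rewrite ?ler_nat// !mulr_ge0// ltW.
Qed.

Lemma norm_le_normsq (R : realType) (z : 'rV[R]_2) : `|z| * `|z| <= normsq z.
Proof.
have h : `|z| <= Num.sqrt (normsq z).
  apply: rV_norm_le => [|i]; first exact: sqrtr_ge0.
  rewrite -sqrtr_sqr ler_wsqrtr// expr2 /normsq.
  by case: (ord2P i) => ->; rewrite ?lerDl ?lerDr -expr2 sqr_ge0.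
by rewrite -[leRHS]sqr_sqrtr ?normsq_ge0// expr2 ler_pM.
Qed.

Section Slice.
Variables (R : realType) (m : nat).
Local Notation n := (m + m)%N.
Variables (U : set 'rV[R]_n) (u : 'rV[R]_n -> R).
Hypotheses (oU : open U) (su : smooth_on U u).
Hypothesis hu : forall x, U x -> posdef (hess u x) /\ in_Sp (hess u x).
Local Notation J := (Jmx R m).
Local Notation H := (hess u).
Variables (x : 'rV[R]_n) (d : R).
Hypotheses (Ux : U x) (d0 : 0 < d).
Local Notation G := (hess u x).
Local Notation Gi := (invmx G).
Local Notation gn := (mnorm G).
Local Notation gin := (mnorm Gi).
Local Notation lw := (lewy u G).
Local Notation N := (lewy_inv u G).
Hypothesis bU : forall y, gn (y - x) <= d -> U y.
Implicit Types (p q v w a : 'rV[R]_n).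

Let Gs : G^T = G := hess_sym oU su Ux.
Let Gp : posdef G := (hu Ux).1.
Let GS : G *m J *m G = J := Sp_sym Gs (hu Ux).2.
Let Gu : G \in unitmx := posdef_unit Gp.
Let Gis : Gi^T = Gi := invmx_sym Gs.
Let Gip : posdef Gi := posdef_inv Gs Gp.

Definition covers r := forall w, gin (w - lw x) < r ->
  exists p, gn (p - x) < d /\ lw p = w.

Variables (r : R) (Psi : 'rV[R]_n -> 'rV[R]_n).
Hypothesis r0 : 0 < r.
Hypothesis PsiP : forall w, gin (w - lw x) < r ->
  gn (Psi w - x) < d /\ lw (Psi w) = w.

Lemma inverse_in w : gin (w - lw x) < r -> U (Psi w).
Proof. by move=> /PsiP[wd _]; apply: bU; exact: ltW. Qed.

Lemma inverse_lipschitz w1 w2 : gin (w1 - lw x) < r -> gin (w2 - lw x) < r ->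
  gn (Psi w2 - Psi w1) <= gin (w2 - w1).
Proof.
move=> /PsiP[d1 E1] /PsiP[d2 E2]; rewrite -{2}E1 -{2}E2.
apply: (lewy_expanding oU su hu Gs Gp).
exact: (gball_segment Gs Gp bU (ltW d1) (ltW d2)).
Qed.

Lemma inverse_center : Psi (lw x) = x.
Proof.
have c0 : gin (lw x - lw x) < r by rewrite subrr mnorm0.
have [d1 E1] := PsiP c0.
have c1 : gn (x - x) <= d by rewrite subrr mnorm0 ltW.
have := lewy_expanding oU su hu Gs Gp (gball_segment Gs Gp bU c1 (ltW d1)).
rewrite E1 subrr mnorm0 => n0; apply/eqP; rewrite -subr_eq0; apply/eqP.
by apply: (mnorm_eq0 Gp); apply/eqP; rewrite eq_le n0 mnorm_ge0.
Qed.

Lemma inverse_near w v : gin (w - lw x) < r ->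
  exists2 e, 0 < e & forall t : R, `|t| < e -> gin (w + t *: v - lw x) < r.
Proof.
move=> wr; have k0 : 0 < gin v + 1 by rewrite ltr_wpDl// mnorm_ge0.
exists ((r - gin (w - lw x)) / (gin v + 1)).
  by rewrite divr_gt0// subr_gt0.
move=> t; rewrite ltr_pdivlMr// => h; rewrite addrAC.
rewrite (le_lt_trans (mnormD Gis Gip _ _))// mnormZ -ltrBrDl.
apply: le_lt_trans h; rewrite ler_wpM2l//.
by rewrite lerDl.
Qed.

(** The inverse function theorem along a line. The expansion property bounds
    the increment of Psi by the increment of its argument; then the linear
    approximation of lewy at Psi w, multiplied by N, is the claim. *)
Lemma inverse_curve w v : gin (w - lw x) < r ->
  is_derive (0 : R) (1 : R) (fun t => Psi (w + t *: v)) (v *m N (Psi w)).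
Proof.
move=> wr; have Up := inverse_in wr; set p := Psi w in Up *.
have [e e0 eP] := inverse_near v wr.
have [K K0 KP] := coord_le_ip Gs Gp.
have [C C0 CP] := mulmx_norm_le (N p).
have lim_q : h^-1 *: (Psi (w + (h *: (1 : R) + 0) *: v) - Psi (w + 0 *: v))
    @[h --> 0^'] --> v *m N p.
  apply/cvgrPdist_le => eps eps0.
  have k0 : 0 < K * (gin v + 1) by rewrite mulr_gt0// ltr_wpDl// mnorm_ge0.
  pose eta := eps / (C * (K * (gin v + 1))).
  have eta0 : 0 < eta by rewrite divr_gt0// mulr_gt0.
  have [s s0 sP] := smooth_mx_linear_approx oU
    (smooth_lewy oU su G) Up eta0.
  near=> h.
  have h0 : h != 0 by near: h; exact: nbhs_dnbhs_neq.
  have he : `|h| < e by near: h; exact: dnbhs0_lt.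
  have hs : `|h| < s / (K * (gin v + 1)).
    by near: h; apply: dnbhs0_lt; rewrite divr_gt0.
  rewrite addr0 scale0r addr0 [h *: (1 : R)]mulr1 -/p.
  set p' := Psi (w + h *: v).
  have w'r := eP h he.
  have [_ E'] := PsiP w'r; have [_ E] := PsiP wr.
  have pp : `|p' - p| <= K * (gin v + 1) * `|h|.
    rewrite (le_trans (KP _))// -mulrA ler_pM2l//.
    rewrite (le_trans (inverse_lipschitz wr w'r))// addrC addKr mnormZ mulrC.
    by rewrite ler_wpM2r// lerDl.
  have := sP p'; rewrite (le_lt_trans pp); last first.
    by rewrite mulrC -ltr_pdivlMr.
  move=> /(_ isT); rewrite E' -/p E (tangent_lewy oU su G _ Up).
  rewrite [w + _ - w]addrC addKr => lin.
  have Nu := lewy_jac_unit hu Gp Up.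
  have -> : v *m N p - h^-1 *: (p' - p)
      = h^-1 *: ((h *: v - (p' - p) *m lewy_jac u G p) *m N p).
    rewrite mulmxBl /lewy_inv mulmxK// [RHS]scalerBr -scalemxAl scalerA mulVf//.
    by rewrite scale1r.
  rewrite normrZ normfV.
  rewrite ler_pdivrMl ?normr_gt0//.
  rewrite (le_trans (CP _))// (le_trans (ler_wpM2l (ltW C0) lin))//.
  rewrite mulrA (le_trans (ler_wpM2l (ltW (mulr_gt0 C0 eta0)) pp))//.
  rewrite le_eqVlt; apply/orP; left; apply/eqP; rewrite /eta; field.
  by rewrite !gt_eqF// ltr_wpDl// mnorm_ge0.
by apply: DeriveDef; [apply/cvg_ex; exists (v *m N p)|apply/cvg_lim].
Unshelve. all: by end_near. Qed.

Lemma inverse_comp_curve f w v : smooth_on U f -> gin (w - lw x) < r ->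
  is_derive (0 : R) (1 : R) (fun t => f (Psi (w + t *: v)))
    (cov u G f v (Psi w)).
Proof.
move=> sf wr.
have := @smooth_comp_curve _ _ _ oU f (fun t => Psi (w + t *: v)) 0
  (v *m N (Psi w)) sf.
rewrite scale0r addr0 => /(_ (inverse_in wr)); apply.
exact: inverse_curve.
Qed.

Variable v : 'rV[R]_n.
Hypothesis v1 : gin v = 1.
Local Notation I := (cplx G).

Definition slice_dir (i : 'I_2) : 'rV[R]_n := if i == 0 then v else v *m I.
(** A complex line through the image of x, which Psi maps back to U. *)
Definition slice_pt (z : 'rV[R]_2) : 'rV[R]_n :=
  lw x + (z 0 0 *: v + z 0 1 *: (v *m I)).
Definition slice z := Psi (slice_pt z).

Lemma slice_pt_norm (z : 'rV[R]_2) :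
  gin (z 0 0 *: v + z 0 1 *: (v *m I)) = Num.sqrt (normsq z).
Proof.
have ip1 : ip Gi v v = 1 by rewrite -(mnorm_sq Gip) v1 expr1n.
rewrite /mnorm !(ipDl, ipDr, ipZl, ipZr).
rewrite (ip_cplx Gs Gp GS) (ipC _ v Gis) (ip_cplx0 Gs Gp) ip1.
by congr Num.sqrt; rewrite /normsq; ring.
Qed.

Lemma slice_ptP z : disc r z -> gin (slice_pt z - lw x) < r.
Proof.
move=> zr; rewrite /slice_pt addrC addKr slice_pt_norm.
rewrite -[ltRHS](gtr0_norm r0) -sqrtr_sqr ltr_sqrt ?expr2//.
by rewrite mulr_gt0.
Qed.

Lemma slice_pt_line z (i : 'I_2) (t : R) :
  slice_pt (z + t *: delta_mx 0 i) = slice_pt z + t *: slice_dir i.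
Proof.
rewrite /slice_pt /slice_dir -!addrA; congr (_ + _); rewrite !mxE /=.
move: (v *m I) => w; apply/rowP => k.
by case: (ord2P i) => ->; rewrite /= !mxE; ring.
Qed.

Lemma disc_open : open (disc (R := R) r).
Proof.
have -> : disc r = @normsq R @^-1` [set t | t < r * r] by [].
apply: open_comp => [z _|]; last exact: open_lt.
exact: normsq_continuous.
Qed.

Lemma slice_continuous z : disc r z -> {for z, continuous slice}.
Proof.
move=> zr; have [K K0 KP] := coord_le_ip Gs Gp.
apply/(@cvgrPdist_lt _ _ _ (nbhs z) (nbhs_filter z) slice (slice z)) => e e0.
have : \forall y \near z, disc r y /\ K * Num.sqrt (normsq (y - z)) < e.
  apply: (filterI (open_nbhs_nbhs (conj disc_open zr))).
  have nc : {for z, continuous (fun y : 'rV[R]_2 => normsq (y - z))}.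
    have h1 : {for z, continuous (fun y : 'rV[R]_2 => y - z)}.
      apply: (@continuousB _ _ _ (fun y : 'rV[R]_2 => y) (fun=> z)).
        by move=> A; apply.
      exact: cst_continuous.
    exact: (continuous_comp h1 (@normsq_continuous R _)).
  have ek0 : 0 < (e / K) * (e / K) by rewrite mulr_gt0// divr_gt0.
  have nz : normsq (z - z) < (e / K) * (e / K).
    by rewrite subrr /normsq !mxE mulr0 addr0.
  apply: filterS (cvgr_lt _ nc _ nz) => y yz.
  rewrite mulrC -ltr_pdivlMr// -[ltRHS]gtr0_norm ?divr_gt0// -sqrtr_sqr.
  by rewrite ltr_sqrt ?expr2.
apply: filterS => y [yr ye]; rewrite distrC (le_lt_trans (KP _))//.
rewrite (le_lt_trans _ ye)// ler_pM2l// -slice_pt_norm.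
rewrite (le_trans (inverse_lipschitz (slice_ptP zr) (slice_ptP yr)))//.
rewrite /slice_pt opprD addrACA subrr add0r opprD addrACA -!scalerBl !mxE.
by rewrite lexx.
Qed.

Lemma slice_is_derive f z i : smooth_on U f -> disc r z ->
  is_derive z (delta_mx 0 i) (fun y => f (slice y))
    (cov u G f (slice_dir i) (slice z)).
Proof.
move=> sf zr.
have := inverse_comp_curve (slice_dir i) sf (slice_ptP zr).
have -> : (fun t : R => f (Psi (slice_pt z + t *: slice_dir i)))
    = (fun t : R => f (slice (z + t *: delta_mx 0 i))).
  by apply/funext => t; rewrite /slice slice_pt_line.
move/(is_derive_line (fun y => f (slice y)) z (delta_mx 0 i) 0 _).2.
by rewrite scale0r addr0.
Qed.

Lemma slice_partial f z i : smooth_on U f -> disc r z ->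
  partial i (fun y => f (slice y)) z = cov u G f (slice_dir i) (slice z).
Proof. by move=> sf zr; exact: (slice_is_derive i sf zr).(derive_val). Qed.

(** Composites of smooth functions with slice form a class stable under
    partial derivatives, by the chain rule for the coordinates w. *)
Lemma slice_smooth f : smooth_on U f ->
  smooth_on (disc r) (fun z => f (slice z)).
Proof.
move=> sf; apply: (smooth_coind disc_open (P := fun F =>
    exists2 g, smooth_on U g & F = (fun z => g (slice z)))); last by exists f.
  move=> F z [g sg ->] zr.
  apply: (continuous_comp (slice_continuous zr)).
  by apply: smooth_continuous sg _; exact/inverse_in/slice_ptP.
move=> F i [g sg ->]; exists (fun z => cov u G g (slice_dir i) (slice z)).
  exists (cov u G g (slice_dir i)); last by [].
  exact: (smooth_cov oU su hu Gp).
by move=> z; exact: slice_is_derive.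
Qed.

Lemma slice0 : slice 0 = x.
Proof.
by rewrite /slice /slice_pt !mxE !scale0r !addr0 inverse_center.
Qed.

Lemma disc0 : disc r 0.
Proof. by rewrite /disc/= /normsq !mxE mulr0 addr0 mulr_gt0. Qed.

(** The Cayley transform vanishes at the centre x and is Lipschitz near it. *)
Lemma energy_near a : exists2 L, 0 < L & exists2 e, 0 < e &
  forall z, normsq z < e -> energy u G a (slice z) <= L * normsq z.
Proof.
pose F p := a *m cayley u G p.
have sF : smooth_mx (disc r) (fun z => F (slice z)).
  move=> i j; apply: (slice_smooth (f := fun p => F p i j)).
  exact: (smooth_mul_cayley oU su hu Gp).
have F0 : F (slice 0) = 0.
  by rewrite slice0 /F (cayleyE hu Gp Ux) subrr mulmx0 mulmx0.
have [e e0 [L L0 LP]] := smooth_mx_lipschitz disc_open sF disc0.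
have [C C0 CP] := ip_norm_le Gi.
exists (C * (L * L)); first by rewrite !mulr_gt0.
exists (e * e); first by rewrite mulr_gt0.
move=> z ze; have ze' : `|z - 0| < e.
  rewrite subr0 -(ltr_pXn2r (n := 2)) ?nnegrE ?(ltW e0)//.
  by rewrite !expr2 (le_lt_trans (norm_le_normsq z)).
have := LP z ze'; rewrite F0 !subr0 => zF.
apply: (le_trans (CP (F (slice z)))).
rewrite -mulrA ler_pM2l//.
apply: (@le_trans _ _ ((L * `|z|) * (L * `|z|))); first by rewrite ler_pM.
by rewrite mulrACA ler_wpM2l ?norm_le_normsq// mulr_ge0 ?(ltW L0).
Qed.

(** The Schwarz lemma applied to |a S|^2 on a complex line: S has norm at most
    1 and vanishes at the centre, so its norm at z is at most |z| / r. *)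
Lemma energy_schwarz a z : disc r z ->
  energy u G a (slice z) * (r * r) <= ip Gi a a * normsq z.
Proof.
have [->|a0] := eqVneq a 0.
  move=> _; have -> : energy u G 0 (slice z) = 0.
    by rewrite /energy mul0mx ip0l.
  by rewrite ip0l !mul0r.
have M0 : 0 < ip Gi a a by exact: Gip.
have sE := smooth_energy oU su hu Gp a.
have sP i : smooth_on U (cov u G (energy u G a) (slice_dir i)).
  exact: (smooth_cov oU su hu Gp).
apply: (schwarz_disc (slice_smooth sE) _ _ M0 (energy_near a)) => y yr.
  have Uy := inverse_in (slice_ptP yr).
  by rewrite (energy_ge0 u Gs Gp)/= (energy_le hu Gs Gp _ Uy).
have Uy := inverse_in (slice_ptP yr).
have p2 i : partial i (partial i (fun z => energy u G a (slice z))) y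
    = cov u G (cov u G (energy u G a) (slice_dir i)) (slice_dir i) (slice y).
  rewrite -(slice_partial i (sP i) yr).
  by apply: (partial_eq_on disc_open) yr => t tr; exact: slice_partial.
rewrite !sum_ord2 !p2 !(slice_partial _ sE yr) /slice_dir /=.
exact: (energy_logsub oU su hu Gs Gp GS).
Qed.

Lemma normsq_axis (s : R) :
  normsq (0 + s *: delta_mx 0 0 : 'rV[R]_2) = s * s.
Proof. by rewrite normsq_line /normsq !mxE; ring. Qed.

Lemma slice_line_derive f s : smooth_on U f -> 0 <= s < r ->
  is_derive s (1 : R) (fun t => f (slice (0 + t *: delta_mx 0 0)))
    (cov u G f v (slice (0 + s *: delta_mx 0 0))).
Proof.
move=> sf /andP[s0 sr].
have zr : disc r (0 + s *: delta_mx 0 0 : 'rV[R]_2).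
  by rewrite /disc/= normsq_axis ltr_pM.
exact: (is_derive_line (fun z => f (slice z)) 0 (delta_mx 0 0) s _).1
  (slice_is_derive 0 sf zr).
Qed.

Lemma energy_line a s : 0 <= s < r ->
  mnorm Gi (a *m cayley u G (slice (0 + s *: delta_mx 0 0))) <= gin a * (s / r).
Proof.
move=> /andP[s0 sr].
have zr : disc r (0 + s *: delta_mx 0 0 : 'rV[R]_2).
  by rewrite /disc/= normsq_axis ltr_pM.
have := energy_schwarz a zr; rewrite normsq_axis.
set S := a *m _ => h.
have p0 : 0 <= gin a * (s / r) by rewrite mulr_ge0 ?mnorm_ge0 ?divr_ge0// ltW.
rewrite -(ler_pXn2r (n := 2)) ?nnegrE ?mnorm_ge0//.
rewrite exprMn !(mnorm_sq Gip) expr_div_n !expr2 mulrA ler_pdivlMr ?mulr_gt0//.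
Qed.

Lemma lewy_invE p : N p = 2^-1 *: ((1%:M - cayley u G p) *m Gi).
Proof.
rewrite /cayley opprB addrC subrK -scalemxAl scalerA mulVf ?scale1r ?mulmxK//.
Qed.

(** Since dp/dw = N = (1 - S) G^-1 / 2, the speed of the preimage along the
    ray is at most (1 + t / r) / 2 by the Schwarz lemma; integrate over
    [0, s]. The bound is better than the speed 1 given by the expansion
    property, and this is what enlarges the radius from d to 4 d / 3. *)
Lemma displacement s : 0 <= s < r ->
  gn (slice (0 + s *: delta_mx 0 0) - x) <= s / 2 + s * s / (4 * r).
Proof.
move=> /andP[s0 sr].
set p := slice (0 + s *: delta_mx 0 0); set D := gn (p - x).
have rhs0 : 0 <= s / 2 + s * s / (4 * r).
  by rewrite addr_ge0// divr_ge0// ?mulr_ge0// ltW.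
have [D0|Dn] := leP D 0; first exact: le_trans D0 rhs0.
(* The distance |p - x| is read off from the linear form paired with p - x,
   and the integration is replaced by the mean value theorem for k + b, where
   k is the value of that form along the ray and - b its bound. *)
pose xi := (p - x) *m G.
have nxi : gin xi = D by rewrite /mnorm /xi ip_inv_mulmx.
pose f q := ((q - x) *m xi^T) 0 0.
have sx : smooth_mx U (fun q => q - x).
  exact: (smooth_mxD oU (smooth_id oU) (smooth_mx_cst oU (- x))).
have sf : smooth_on U f.
  exact: (smooth_mxM oU sx (smooth_mx_cst oU xi^T) 0 0).
have df q h : U q -> tangent f q h = (h *m xi^T) 0 0.
  move=> Uq; rewrite -(tangent_mxE (fun y => (y - x) *m xi^T)).
  rewrite (tangent_mxM oU h sx (smooth_mx_cst oU xi^T) Uq).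
  rewrite (tangent_mxD h (smooth_id oU) (smooth_mx_cst oU (- x)) Uq).
  by rewrite !tangent_mx_cst mulmx0 !addr0 tangent_id.
pose k t := f (slice (0 + t *: delta_mx 0 0)).
pose b t := - (2^-1 * D) * (t + t * t * (2 * r)^-1).
have rn0 : r != 0 by rewrite gt_eqF.
have db t : is_derive t (1 : R) b (- (2^-1 * D) * (1 + t / r)).
  have did : is_derive t (1 : R) (fun t : R => t) 1 by exact: is_derive_id.
  have dcst (c : R) : is_derive t (1 : R) (fun _ : R => c) 0.
    exact: is_derive_cst.
  have h := is_derive_mul (dcst (- (2^-1 * D))) (is_derive_add did
    (is_derive_mul (is_derive_mul did did) (dcst (2 * r)^-1))).
  by apply: (is_derive_eq h); field.
have Ut t : 0 <= t < r -> U (slice (0 + t *: delta_mx 0 0)).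
  move=> /andP[t0 tr]; apply/inverse_in/slice_ptP.
  by rewrite /disc/= normsq_axis ltr_pM.
have dk t : 0 <= t < r -> is_derive t (1 : R) (fun t => k t + b t)
    (cov u G f v (slice (0 + t *: delta_mx 0 0)) + - (2^-1 * D) * (1 + t / r)).
  by move=> tr; exact: (is_derive_add (slice_line_derive sf tr) (db t)).
have neg t : 0 <= t < r ->
    cov u G f v (slice (0 + t *: delta_mx 0 0)) + - (2^-1 * D) * (1 + t / r) <= 0.
  move=> tr; rewrite /cov df; last exact: Ut.
  rewrite lewy_invE -scalemxAr mulmxA mulmxBr mulmx1 -scalemxAl mxE.
  rewrite -/(ip Gi _ xi) ipDl ipNl.
  have h1 := ip_le_mnorm Gis Gip v xi.
  have h2 := ip_le_mnorm Gis Gip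
    (- (v *m cayley u G (slice (0 + t *: delta_mx 0 0)))) xi.
  rewrite ipNl (mnormN Gi) in h2.
  rewrite v1 nxi mul1r in h1; rewrite nxi in h2.
  have h3 := ler_wpM2r (ltW Dn) (energy_line v tr).
  rewrite v1 mul1r in h3.
  have := le_trans h2 h3; lra.
have [||c] := @MVT_segment R (fun t => k t + b t) (fun t =>
    cov u G f v (slice (0 + t *: delta_mx 0 0)) + - (2^-1 * D) * (1 + t / r)) 0 s s0.
- move=> t; rewrite in_itv/= => /andP[t0 ts]; apply: dk.
  by rewrite ltW//= (lt_trans ts).
- apply: continuous_in_subspaceT => t; rewrite inE/= in_itv/= => /andP[t0 ts].
  apply: (is_derive_continuous (dk t _)).
  by rewrite t0/= (le_lt_trans ts).
rewrite in_itv/= => /andP[c0 cs]; rewrite subr0 => E.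
have k0 : k 0 = 0.
  by rewrite /k scale0r addr0 slice0 /f subrr mul0mx mxE.
have ks : k s = D ^+ 2.
  rewrite /D (mnorm_sq Gp) /k /f -/p /xi trmx_mul Gs mulmxA.
  by [].
have cr : 0 <= c < r by rewrite c0/= (le_lt_trans cs).
have b0 : b 0 = 0 by rewrite /b; ring.
have := mulr_le0_ge0 (neg c cr) s0; rewrite -E k0 b0 ks => h.
have e : D * (s / 2 + s * s / (4 * r)) = - b s by rewrite /b; field.
by rewrite -(ler_pM2l Dn) e -expr2; lra.
Qed.

(** Differentiate the Schwarz bound at the centre: the function t |-> <a S, E>
    vanishes at 0 and is at most (|a| t / r) |E|, so its derivative |E|^2 is
    at most |a| |E| / r. *)
Lemma covd_bound a :
  ip Gi (covd u G (fun y => a *m cayley u G y) v x)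
        (covd u G (fun y => a *m cayley u G y) v x) * (r * r) <= ip Gi a a.
Proof.
have [E EE] : {E | E = covd u G (fun y => a *m cayley u G y) v x}.
  by exists (covd u G (fun y => a *m cayley u G y) v x).
rewrite -EE.
pose f q := ip Gi (a *m cayley u G q) E.
have sa := smooth_mul_cayley oU su hu Gp a.
have sE := smooth_mx_cst oU E.
have sf : smooth_on U f := smooth_ip oU Gi sa sE.
have df : cov u G f v x = ip Gi E E.
  rewrite /cov (tangent_ip oU Gi _ sa sE Ux) tangent_mx_cst ip0r addr0.
  by rewrite EE.
have d1 : is_derive (0 : R) (1 : R)
    (fun t => f (slice (0 + t *: delta_mx 0 0))) (ip Gi E E).
  have := @slice_line_derive f 0 sf; rewrite lexx r0 => /(_ isT).
  by rewrite scale0r addr0 slice0 df.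
pose K := gin a / r * gin E.
have d2 : is_derive (0 : R) (1 : R)
    (fun t => K * t - f (slice (0 + t *: delta_mx 0 0))) (K - ip Gi E E).
  have did : is_derive (0 : R) (1 : R) (fun t : R => t) 1 by exact: is_derive_id.
  have dcst : is_derive (0 : R) (1 : R) (fun _ : R => K) 0.
    exact: is_derive_cst.
  have h := is_deriveB (is_derive_mul dcst did) d1.
  by apply: (is_derive_eq h); rewrite mul0r add0r mulr1.
have := derive_ge0_right r0 d2; rewrite subr_ge0 => le_K.
have {le_K} : ip Gi E E <= K.
  apply: le_K => h /andP[h0 hr].
  rewrite mulr0 [0 + h]add0r.
  have -> : slice (0 + 0 *: delta_mx 0 0) = x by rewrite scale0r addr0 slice0.
  have -> : f x = 0.
    by rewrite /f (cayleyE hu Gp Ux) subrr !mulmx0 ip0l.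
  rewrite subr0 subr_ge0 (le_trans (ip_le_mnorm Gis Gip _ _))//.
  have hr' : 0 <= h < r by rewrite hr ltW.
  rewrite (le_trans (ler_wpM2r (mnorm_ge0 _ _) (energy_line a hr')))//.
  by rewrite le_eqVlt; apply/orP; left; apply/eqP; rewrite /K; ring.
rewrite -!(mnorm_sq Gip) /K => le_K.
have [E0|E0] := leP (gin E) 0.
  have -> : gin E = 0 by apply/eqP; rewrite eq_le E0 mnorm_ge0.
  by rewrite expr0n mul0r sqr_ge0.
rewrite expr2 ler_pM2r// ler_pdivlMr// in le_K.
rewrite -[r * r]expr2 -exprMn ler_pXn2r// nnegrE ?mulr_ge0 ?mnorm_ge0//.
exact: ltW.
Qed.

End Slice.

(** * Enlarging the radius, and the curvature estimate *)

(** This turns estimates on all smaller closed balls into the estimate at the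
    limiting radius. *)
Lemma mul_le_lim (R : realType) (s D M : R) : 0 <= s -> 0 <= M -> 0 < D ->
  (forall d, 0 < d -> d < D -> s * d <= M) -> s * D <= M.
Proof.
move=> s0 M0 D0 h; rewrite leNgt; apply/negP => MD.
have sp : 0 < s.
  by rewrite lt_neqAle s0 andbT; apply/eqP => sE; move: MD; rewrite -sE mul0r ltNge M0.
have k1 : M / s < D by rewrite ltr_pdivrMr// [D * s]mulrC.
have k0 : 0 <= M / s by rewrite divr_ge0.
have d0 : 0 < (M / s + D) / 2 by lra.
have dD : (M / s + D) / 2 < D by lra.
have := h _ d0 dD.
have -> : s * ((M / s + D) / 2) = (M + s * D) / 2 by field; rewrite gt_eqF.
by lra.
Qed.

Section Bootstrap.
Variables (R : realType) (m : nat).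
Local Notation n := (m + m)%N.
Variables (U : set 'rV[R]_n) (u : 'rV[R]_n -> R).
Hypotheses (oU : open U) (su : smooth_on U u).
Hypothesis hu : forall x, U x -> posdef (hess u x) /\ in_Sp (hess u x).
Variables (x : 'rV[R]_n) (d : R).
Hypotheses (Ux : U x) (d0 : 0 < d).
Local Notation G := (hess u x).
Local Notation Gi := (invmx G).
Local Notation gn := (mnorm G).
Local Notation gin := (mnorm Gi).
Local Notation lw := (lewy u G).
Hypothesis bU : forall y, gn (y - x) <= d -> U y.
Implicit Types (p q v w a : 'rV[R]_n).

Let Gs : G^T = G := hess_sym oU su Ux.
Let Gp : posdef G := (hu Ux).1.
Let Gis : Gi^T = Gi := invmx_sym Gs.
Let Gip : posdef Gi := posdef_inv Gs Gp.

Lemma covers_inverse r : covers u x d r -> exists Psi, forall w,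
  gin (w - lw x) < r -> gn (Psi w - x) < d /\ lw (Psi w) = w.
Proof.
move=> cr.
have ex w : exists p, gin (w - lw x) < r -> gn (p - x) < d /\ lw p = w.
  have [/cr[p pP]|wr] := ltP (gin (w - lw x)) r; first by exists p.
  by exists 0.
by have [Psi PsiP] := choice ex; exists Psi.
Qed.

Lemma covers_base : covers u x d d.
Proof.
move=> w wd; have [p pd pw] := lewy_cover oU su hu Gs Gp d0 bU wd.
by exists p.
Qed.

(** A point w at distance l >= r from lw x: follow the ray towards w up to a
    radius rho slightly below r. Its preimage p lies within 3 r / 4 of x by
    the displacement bound, so the ball of radius d - 3 r / 4 around p is
    still in the domain, and lewy maps it over the ball of that radius around
    lewy p, which contains w. *)
Lemma covers_step r : 0 < r -> r < 4 / 3 * d -> covers u x d r ->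
  covers u x d (r / 4 + d).
Proof.
move=> r0 rd cr w wr; have [/cr//|rl] := ltP (gin (w - lw x)) r.
have [Psi PsiP] := covers_inverse cr.
have [l lE] : {l | l = gin (w - lw x)} by exists (gin (w - lw x)).
rewrite -lE in wr rl; have l0 : 0 < l := lt_le_trans r0 rl.
pose v := l^-1 *: (w - lw x).
have v1 : gin v = 1.
  by rewrite mnormZ -lE gtr0_norm ?invr_gt0// mulVf// gt_eqF.
(* rho has to be below r and above l - d + 3 r / 4, and nonnegative. *)
pose rho := (Num.max (l - d + 3 / 4 * r) 0 + r) / 2.
have mr : Num.max (l - d + 3 / 4 * r) 0 < r.
  by rewrite gt_max r0 andbT; lra.
have rhor : rho < r by rewrite /rho; lra.
have rho1 : l - d + 3 / 4 * r < rho.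
  have : l - d + 3 / 4 * r <= Num.max (l - d + 3 / 4 * r) 0 by rewrite le_max lexx.
  by rewrite /rho; lra.
have rho0 : 0 <= rho.
  have : 0 <= Num.max (l - d + 3 / 4 * r) 0 by rewrite le_max lexx orbT.
  by rewrite /rho; lra.
have rhor' : 0 <= rho < r by rewrite rho0.
have := displacement oU su hu Ux d0 bU r0 PsiP v1 rhor'.
set p := slice _ _ _ _ _ => px.
have rho34 : rho / 2 + rho * rho / (4 * r) <= 3 / 4 * r.
  have : rho * rho / (4 * r) <= r / 4.
    rewrite ler_pdivrMr ?mulr_gt0//; have -> : r / 4 * (4 * r) = r * r by field.
    by rewrite ler_pM// ltW.
  by move: rhor; lra.
have {}px := le_trans px rho34.
have pE : lw p = lw x + rho *: v.
  have zr : gin (lw x + rho *: v - lw x) < r.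
    by rewrite addrC addKr mnormZ v1 mulr1 ger0_norm.
  rewrite /p /slice /slice_pt !mxE !add0r /= mulr1 mulr0 scale0r addr0.
  by have [] := PsiP _ zr.
have e0 : 0 < d - 3 / 4 * r by lra.
have bp q : gn (q - p) <= d - 3 / 4 * r -> U q.
  move=> qp; apply: bU; have -> : q - x = (q - p) + (p - x).
    by rewrite addrA subrK.
  apply: (le_trans (mnormD Gs Gp (q - p) (p - x))).
  by apply: (le_trans (lerD qp px)); rewrite subrK.
have wp : gin (w - lw p) < d - 3 / 4 * r.
  have -> : w - lw p = (l - rho) *: v.
    rewrite pE opprD addrA scalerBl; congr (_ - _).
    by rewrite /v scalerA mulfV ?scale1r// gt_eqF.
  by rewrite mnormZ v1 mulr1 ger0_norm ?subr_ge0; lra.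
have [q qp qw] := lewy_cover oU su hu Gs Gp e0 bp wp.
exists q; split => //; have -> : q - x = (q - p) + (p - x).
  by rewrite addrA subrK.
apply: (le_lt_trans (mnormD Gs Gp (q - p) (p - x))).
by apply: (lt_le_trans (ltr_leD qp px)); rewrite subrK.
Qed.

(** The step r |-> r / 4 + d has fixed point 4 d / 3 and divides the distance
    to it by 4; the rate d / (k + 1) is weaker but enough for the limit. *)
Lemma covers_seq k : exists2 s, covers u x d s &
  [/\ 0 < s, s < 4 / 3 * d & 4 / 3 * d - d / k.+1%:R <= s].
Proof.
elim: k => [|k [s cs [s0 sd ds]]].
  exists d; first exact: covers_base.
  by rewrite mulr1n divr1; move: d0 => d1; split; [exact: d1|lra|lra].
exists (s / 4 + d); first exact: covers_step.
split; [lra|lra|].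
have k2 : d / k.+1%:R / 4 <= d / k.+2%:R.
  rewrite -mulrA ler_pM2l// -invfM lef_pV2 ?posrE ?mulr_gt0//.
  by rewrite -natrM ler_nat mulSn -add2n leq_add// leq_pmulr.
by move: (d / k.+1%:R) (d / k.+2%:R) k2 ds => A B k2 ds; lra.
Qed.

Lemma covers_all r : r < 4 / 3 * d -> covers u x d r.
Proof.
move=> rd; have e0 : 0 < 4 / 3 * d - r by rewrite subr_gt0.
pose k := Num.bound (d / (4 / 3 * d - r)).
have kP : d / (4 / 3 * d - r) < k%:R.
  by rewrite archi_boundP// divr_ge0// ltW.
have [s cs [_ _ ds]] := covers_seq k.
move=> w wr; apply: cs; rewrite (lt_le_trans wr)// (le_trans _ ds)//.
rewrite lerBrDr -lerBrDl ler_pdivrMr//.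
rewrite ltr_pdivrMr// in kP; rewrite ltW// (lt_le_trans kP)// mulrC.
by rewrite ler_pM2l// ler_nat.
Qed.

Lemma tangent_mxZ (k1 k2 : nat) (M : 'rV[R]_n -> 'M[R]_(k1, k2)) y k v :
  tangent_mx M y (k *: v) = k *: tangent_mx M y v.
Proof.
apply/matrixP => i j; rewrite [RHS]mxE !tangent_mxE /tangent mulr_sumr.
by apply: eq_bigr => l _; rewrite mxE mulrA.
Qed.

(** At the centre S = 0, hence N = G^-1 / 2, and the derivative of S is a
    quarter of the tensor of third derivatives. *)
Lemma covd_center a v :
  covd u G (fun y => (a *m G) *m cayley u G y) (v *m G) x
  = 4^-1 *: (a *m tangent_mx (hess u) x v).
Proof.
have Gu := posdef_unit Gp.
have NE : lewy_inv u G x = 2^-1 *: Gi.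
  by rewrite (lewy_invE hu Ux) (cayleyE hu Gp Ux) subrr mulmx0 subr0 mul1mx.
rewrite (covd_cayley oU su hu Gp) // NE.
have aN w : w *m G *m (2^-1 *: Gi) = 2^-1 *: w by rewrite -scalemxAr mulmxK.
rewrite !aN tangent_mxZ; move: (tangent_mx _ _ _) => T.
do ![rewrite -scalemxAl | rewrite -scalemxAr].
rewrite mulmxKV// !scalerA; congr (_ *: _).
by field.
Qed.

(** The left side is r^2 times the squared dual norm of the third derivative
    with two unit vectors inserted. *)
Lemma third_bound (P : 'M[R]_n) r i j : 0 < r -> r < 4 / 3 * d ->
  P *m G *m P^T = 1%:M ->
  \sum_k (P *m tangent_mx (hess u) x (row i P) *m P^T) j k ^+ 2 * (r * r) <= 16.
Proof.
move=> r0 rd PGP; have Gu := posdef_unit Gp.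
have [Psi PsiP] := covers_inverse (covers_all rd).
have rowP1 i1 : ip G (row i1 P) (row i1 P) = 1.
  rewrite /ip -row_mul tr_row -[_ *m _]/(_ *m _).
  have -> : (row i1 (P *m G) *m col i1 P^T) 0 0 = (P *m G *m P^T) i1 i1.
    by rewrite !mxE; apply: eq_bigr => l _; rewrite !mxE.
  by rewrite PGP mxE eqxx.
have v1 : gin (row i P *m G) = 1.
  by rewrite /mnorm ip_inv_mulmx// rowP1 sqrtr1.
have := covd_bound oU su hu Ux d0 bU r0 PsiP v1 (row j P *m G).
rewrite covd_center ip_inv_mulmx// rowP1 ipZl ipZr.
have GiE : Gi = P^T *m P := orthonormal_inv Gu PGP.
move: (tangent_mx (hess u) x (row i P)) => T.
have -> : ip Gi (row j P *m T) (row j P *m T)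
    = \sum_k (P *m T *m P^T) j k ^+ 2.
  have -> : ip Gi (row j P *m T) (row j P *m T)
      = ((row j P *m T *m P^T) *m (row j P *m T *m P^T)^T) 0 0.
    by rewrite /ip GiE (trmx_mul (_ *m T)) trmxK !mulmxA.
  rewrite -!row_mul mxE mxE; apply: eq_bigr => k _.
  by rewrite [X in _ * X]mxE [X in _ * X]mxE expr2.
rewrite -mulr_suml.
by lra.
Qed.

(** Sum the bound 16 over the (2 m)^2 pairs of basis vectors and divide by
    4. *)
Lemma curvature_bound r : 0 < r -> r < 4 / 3 * d ->
  scalar_curvature (hess u) x * (r * r) <= 16 * (m%:R * m%:R).
Proof.
move=> r0 rd; have [P PGP] := orthonormal_basis Gs Gp.
rewrite (scalar_curvature_hess oU su hu Ux PGP) -mulrA mulr_suml.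
apply: (@le_trans _ _ (4^-1 * \sum_(i < n) \sum_(j < n) 16)); last first.
  have -> : \sum_(i < n) \sum_(j < n) 16 = 16 * ((m%:R + m%:R) * (m%:R + m%:R)) :> R.
    by rewrite !sumr_const !card_ord -mulrnA -natrD -natrM mulr_natr.
  by rewrite le_eqVlt; apply/orP; left; apply/eqP; field.
rewrite ler_pM2l ?invr_gt0//; apply: ler_sum => i _.
rewrite mulr_suml; apply: ler_sum => j _.
by rewrite mulr_suml; exact: third_bound.
Qed.

(** Let r tend to 4 d / 3 in the bound 4 m / r of the square root. *)
Lemma sqrt_curvature_bound :
  Num.sqrt (scalar_curvature (hess u) x) * d <= 3 * m%:R.
Proof.
set S := scalar_curvature (hess u) x.
have bound r : 0 < r -> r < 4 / 3 * d -> Num.sqrt S * r <= 4 * m%:R.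
  move=> r0 rd; have h := curvature_bound r0 rd.
  have m0 : 0 <= 4 * m%:R :> R by rewrite mulr_ge0.
  have [S0|S0] := leP S 0.
    by rewrite (eqP (_ : Num.sqrt S == 0)) ?mul0r// sqrtr_eq0.
  rewrite -(ler_pXn2r (n := 2)) ?nnegrE ?mulr_ge0 ?sqrtr_ge0 ?(ltW r0)//.
  rewrite exprMn sqr_sqrtr ?(ltW S0)// !expr2 (le_trans h)//.
  by rewrite le_eqVlt; apply/orP; left; apply/eqP; ring.
have m0 : 0 <= 4 * m%:R :> R by rewrite mulr_ge0.
have D0 : 0 < 4 / 3 * d by rewrite mulr_gt0.
have := mul_le_lim (sqrtr_ge0 S) m0 D0 bound.
by move: (Num.sqrt S) => t; lra.
Qed.

End Bootstrap.

(** * Balls inside the domain *)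

Section SegmentToBoundary.
Variables (R : realType) (n : nat) (G : 'M[R]_n).
Hypotheses (Gs : G^T = G) (Gp : posdef G).

(** Let t be the infimum of the parameters in [0, 1] whose point lies outside
    U. The parameters just below t, or t = 0 itself, give points of U, so the
    point at t is in the closure; parameters of points outside U are
    arbitrarily close to t, so it is not interior. *)
Lemma boundary_on_segment (U : set 'rV[R]_n) x y : open U -> U x -> ~ U y ->
  exists2 t : R, 0 <= t <= 1 & boundary U (x + t *: (y - x)).
Proof.
move=> oU Ux Uy; pose c (t : R) := x + t *: (y - x).
have cc : continuous c.
  move=> t; have [/derivable1_diffP cd _] := is_derive_affine x (y - x) t.
  exact: differentiable_continuous cd.
pose S := [set t : R | 0 <= t <= 1 /\ ~ U (c t)].
have S1 : S 1.
  by split; [rewrite ler01 lexx|rewrite /c scale1r addrC subrK].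
have lS : has_inf S.
  by split; [exists 1|exists 0 => t [/andP[]]].
pose t := inf S.
have t0 : 0 <= t by apply: lb_le_inf; [exists 1|move=> s [/andP[]]].
have t1 : t <= 1 by apply: ge_inf => //; case: lS.
exists t; first by rewrite t0.
split.
  move=> B /cc /nbhs_ballP[e /= e0 eB].
  have [tE|tn] := eqVneq t 0.
    exists (c t); split; last by apply: eB; exact: ballxx.
    by rewrite tE /c scale0r addr0.
  have tp : 0 < t by rewrite lt_neqAle eq_sym tn.
  pose s := Num.max 0 (t - e / 2).
  have st : s < t by rewrite gt_max tp/= ltrBlDr ltrDl divr_gt0.
  have s0 : 0 <= s by rewrite le_max lexx.
  exists (c s); split.
    apply: contrapT => nU.
    have : t <= s.
      apply: ge_inf; first by case: lS.
      by split => //; rewrite s0 (le_trans (ltW st)).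
    by rewrite leNgt st.
  apply: eB; rewrite -ball_normE/= ger0_norm ?subr_ge0 ?(ltW st)//.
  have : t - e / 2 <= s by rewrite le_max lexx orbT.
  by lra.
rewrite /interior => /cc /nbhs_ballP[e /= e0 eU].
have [s Ss ste] := inf_adherent e0 lS.
have ts : t <= s by apply: ge_inf => //; case: lS.
case: Ss => _; apply; apply: eU; rewrite -ball_normE/= distrC.
by rewrite ger0_norm ?subr_ge0// ltrBlDl.
Qed.

Lemma gball_in_domain (U : set 'rV[R]_n) x (d : R) : open U -> U x ->
  (d%:E < dist_boundary G x U)%E -> forall y, mnorm G (y - x) <= d -> U y.
Proof.
move=> oU Ux dU y yd; apply: contrapT => nUy.
have [t /andP[t0 t1] bt] := boundary_on_segment oU Ux nUy.
have : (dist_boundary G x U <= (mnorm G (x + t *: (y - x) - x))%:E)%E.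
  by apply: ereal_inf_lbound; exists (x + t *: (y - x)).
move=> /(lt_le_trans dU); rewrite lte_fin addrC addKr mnormZ ger0_norm// ltNge.
by rewrite (le_trans _ yd)// ler_piMl ?mnorm_ge0.
Qed.

End SegmentToBoundary.

(** * Vanishing curvature *)

Section Entire.
Variables (R : realType) (m : nat).
Local Notation n := (m + m)%N.
Variable u : 'rV[R]_n -> R.
Hypothesis su : smooth_on setT u.

Lemma partial_coord k j (x : 'rV[R]_n) :
  partial k (fun y => y 0 j) x = (k == j)%:R.
Proof.
rewrite /partial (is_derive_coord j x _).(derive_val) mxE eqxx/=.
by rewrite eq_sym.
Qed.

Lemma partial0_constant (f : 'rV[R]_n -> R) : smooth_on setT f ->
  (forall k x, partial k f x = 0) -> forall x, f x = f 0.
Proof.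
move=> sf f0 x; have oT : open [set: 'rV[R]_n] := openT.
have [s s01|c c01] := @mean_value01 R (fun t => f (0 + t *: x))
    (fun t => tangent f (0 + t *: x) x).
  exact: (smooth_derive_line oT sf).
rewrite scale1r scale0r add0r addr0 /tangent big1; last first.
  by move=> k _; rewrite f0 mulr0.
by move/eqP; rewrite subr_eq0 => /eqP.
Qed.

(** Subtract the Taylor polynomial of degree two at 0, first from the first
    derivatives and then from u: what remains has zero gradient and is
    constant. *)
Lemma third0_quadratic :
  (forall k i j x, partial k (partial i (partial j u)) x = 0) ->
  quadratic_polynomial u.
Proof.
move=> u3; have oT : open [set: 'rV[R]_n] := openT.
have sc j := smooth_coord (U := setT) oT j : smooth_on setT (fun x : 'rV[R]_n => x 0 j).
have scst c := smooth_cst (U := setT) oT c : smooth_on setT (fun=> c : R).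
pose h i j := partial i (partial j u) 0.
have u2 i j x : partial i (partial j u) x = h i j.
  apply: partial0_constant => [|k y]; last exact: u3.
  exact: (smooth_partial i (smooth_partial j su)).
have hs i j : h i j = h j i by exact: (partialC oT i j su).
have slin j : smooth_on setT (fun x : 'rV[R]_n => \sum_i - h i j * x 0 i).
  by apply: (smooth_sum oT) => i; exact: (smoothM oT (scst _) (sc i)).
have u1 j x : partial j u x = partial j u 0 + \sum_i h i j * x 0 i.
  pose g y := partial j u y + \sum_i - h i j * y 0 i.
  have sg : smooth_on setT g := smoothD oT (smooth_partial j su) (slin j).
  have g0 k y : partial k g y = 0.
    rewrite (partialD k (smooth_partial j su) (slin j)) // u2.
    rewrite (partial_sum oT _ _ k
      (fun i => smoothM oT (scst (- h i j)) (sc i)) (I : setT y)).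
    rewrite (bigD1 k)//= big1 => [|i ik].
      rewrite (partialM k (scst _) (sc k)) // partial_cst partial_coord eqxx.
      by rewrite mul0r add0r mulr1 addr0 subrr.
    rewrite (partialM k (scst _) (sc i)) // partial_cst partial_coord.
    by rewrite eq_sym (negbTE ik) mulr0 mul0r addr0.
  have := partial0_constant sg g0 x; rewrite /g.
  rewrite [in RHS]big1 ?addr0 => [|i _]; last by rewrite mxE mulr0.
  move=> <-; rewrite -addrA -big_split big1 ?addr0// => i _.
  by rewrite /= mulNr addNr.
pose q (x : 'rV[R]_n) := \sum_i \sum_j - 2^-1 * h i j * (x 0 i * x 0 j) : R.
pose l (x : 'rV[R]_n) := \sum_i - partial i u 0 * x 0 i : R.
have sxx i j : smooth_on setT (fun x : 'rV[R]_n => x 0 i * x 0 j).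
  exact: (smoothM oT (sc i) (sc j)).
have sqi i : smooth_on setT (fun x : 'rV[R]_n => \sum_j - 2^-1 * h i j * (x 0 i * x 0 j)).
  by apply: (smooth_sum oT) => j; exact: (smoothM oT (scst _) (sxx i j)).
have sq : smooth_on setT q by apply: (smooth_sum oT); exact: sqi.
have sl : smooth_on setT l.
  by apply: (smooth_sum oT) => i; exact: (smoothM oT (scst _) (sc i)).
pose g x := u x + q x + l x.
have sg : smooth_on setT g := smoothD oT (smoothD oT su sq) sl.
have pq k x : partial k q x = - \sum_i h i k * x 0 i.
  rewrite /q (partial_sum oT _ _ k sqi (I : setT x)).
  under eq_bigr => i _.
    rewrite (partial_sum oT _ _ k
      (fun j => smoothM oT (scst (- 2^-1 * h i j)) (sxx i j)) (I : setT x)).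
    under eq_bigr => j _.
      rewrite (partialM k (scst _) (sxx i j))// partial_cst mul0r add0r.
      rewrite (partialM k (sc i) (sc j))// !partial_coord mulrDr.
      over.
    rewrite big_split /=.
    over.
  rewrite big_split /= (bigD1 k)//= [X in _ + X + _]big1 => [|i ik].
    rewrite addr0 [X in _ + X](eq_bigr (fun i => - 2^-1 * (h i k * x 0 i))).
      rewrite [X in X + _](eq_bigr (fun i => - 2^-1 * (h i k * x 0 i))).
        by rewrite -mulr_sumr; move: (\sum_i h i k * x 0 i) => s; lra.
      by move=> i _; rewrite eqxx mul1r hs mulrA.
    move=> i _; rewrite (bigD1 k)//= eqxx mulr1 big1 ?addr0 => [|j jk].
      by rewrite mulrA.
    by rewrite eq_sym (negbTE jk) !mulr0.
  by rewrite big1 // => j _; rewrite eq_sym (negbTE ik) mul0r mulr0.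
have pl k x : partial k l x = - partial k u 0.
  rewrite /l (partial_sum oT _ _ k
    (fun i => smoothM oT (scst (- partial i u 0)) (sc i)) (I : setT x)).
  rewrite (bigD1 k)//= big1 => [|i ik].
    rewrite (partialM k (scst _) (sc k)) // partial_cst partial_coord eqxx.
    by rewrite mul0r add0r mulr1 addr0.
  rewrite (partialM k (scst _) (sc i)) // partial_cst partial_coord.
  by rewrite eq_sym (negbTE ik) mulr0 mul0r addr0.
have g0 k x : partial k g x = 0.
  rewrite /g (partialD k (smoothD oT su sq) sl)// (partialD k su sq)//.
  by rewrite pq pl u1 addrK subrr.
exists (fun i j => 2^-1 * h i j), (fun i => partial i u 0), (g 0) => x.
rewrite -(partial0_constant sg g0 x) /g addrC addrA.
have -> : \sum_i \sum_j 2^-1 * h i j * (x 0 i * x 0 j) = - q x.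
  rewrite /q -sumrN; apply: eq_bigr => i _; rewrite -sumrN; apply: eq_bigr => j _.
  by rewrite !mulNr opprK.
have -> : \sum_i partial i u 0 * x 0 i = - l x.
  by rewrite /l -sumrN; apply: eq_bigr => i _; rewrite mulNr opprK.
by ring.
Qed.

End Entire.

Lemma sum3_sqr_eq0 (R : realDomainType) (k : nat)
  (F : 'I_k -> 'I_k -> 'I_k -> R) : \sum_a \sum_b \sum_c F a b c ^+ 2 = 0 ->
  forall a b c, F a b c = 0.
Proof.
have p1 a b : 0 <= \sum_c F a b c ^+ 2.
  by apply: sumr_ge0 => c _; exact: sqr_ge0.
have p2 a : 0 <= \sum_b \sum_c F a b c ^+ 2 by apply: sumr_ge0 => b _.
move=> s0 a b c; apply/eqP; rewrite -sqrf_eq0; apply/eqP.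
have s1 := psumr_eq0P (fun a _ => p2 a) s0 (i := a) isT.
have s2 := psumr_eq0P (fun b _ => p1 a b) s1 (i := b) isT.
exact: (psumr_eq0P (fun c _ => sqr_ge0 (F a b c)) s2 (i := c) isT).
Qed.

Section CurvatureZero.
Variables (R : realType) (m : nat).
Local Notation n := (m + m)%N.
Variables (U : set 'rV[R]_n) (u : 'rV[R]_n -> R).
Hypotheses (oU : open U) (su : smooth_on U u).
Hypothesis hu : forall x, U x -> posdef (hess u x) /\ in_Sp (hess u x).

Lemma scalar_curvature_ge0 x : U x -> 0 <= scalar_curvature (hess u) x.
Proof.
move=> Ux; have [P PGP] := orthonormal_basis (hess_sym oU su Ux) (hu Ux).1.
rewrite (scalar_curvature_hess oU su hu Ux PGP) mulr_ge0 ?invr_ge0//.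
by do 3 (apply: sumr_ge0 => ? _); rewrite sqr_ge0.
Qed.

(** A vanishing sum of squares; the rows of P span, so the third derivatives
    vanish in the coordinate directions too. *)
Lemma scalar_curvature0_third x k i j : U x ->
  scalar_curvature (hess u) x = 0 -> partial k (partial i (partial j u)) x = 0.
Proof.
move=> Ux; have [P PGP] := orthonormal_basis (hess_sym oU su Ux) (hu Ux).1.
rewrite (scalar_curvature_hess oU su hu Ux PGP) => /eqP.
rewrite mulf_eq0 invr_eq0 pnatr_eq0/= => /eqP s0.
have [Pu _] := mulmx1_unit (etrans (mulmxA P _ P^T) PGP).
have PTu : P^T \in unitmx by rewrite unitmx_tr.
have T0 a : tangent_mx (hess u) x (row a P) = 0.
  have : P *m tangent_mx (hess u) x (row a P) *m P^T = 0.
    by apply/matrixP => b c; rewrite [RHS]mxE; exact: (sum3_sqr_eq0 s0).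
  move=> h; rewrite -[LHS](mulKmx Pu) -[P *m _](mulmxK PTu) h.
  by rewrite mul0mx mulmx0.
rewrite -third_tangent.
have -> : tangent_mx (hess u) x (delta_mx 0 k)
    = \sum_a (delta_mx 0 k *m invmx P : 'rV[R]_n) 0 a *:
       tangent_mx (hess u) x (row a P).
  apply/matrixP => b c; rewrite summxE !tangent_mxE.
  rewrite -[delta_mx 0 k in LHS](mulmxKV Pu).
  transitivity (\sum_a (delta_mx 0 k *m invmx P : 'rV[R]_n) 0 a *
      tangent (fun y => hess u y b c) x (row a P)); last first.
    by apply: eq_bigr => a _; rewrite [RHS]mxE tangent_mxE.
  rewrite /tangent; under eq_bigr do rewrite mxE mulr_suml.
  rewrite exchange_big/=; apply: eq_bigr => a _; rewrite mulr_sumr.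
  by apply: eq_bigr => l _; rewrite [row a P 0 l]mxE mulrA.
rewrite summxE big1// => a _.
by rewrite T0 scaler0 mxE.
Qed.

End CurvatureZero.

(** * An example with curvature m at distance one from the boundary *)

(** Each summand x^2 / (2 y) + y^3 / 6 has a positive definite Hessian of
    determinant 1, with rows (1/y, - x/y^2) and (- x/y^2, y + x^2/y^3). At
    (x, y) = (0, 1) the Hessian is the identity, and the third derivatives
    that do not vanish are the yyy derivative 1 and the three xxy derivatives
    - 1: they add (1 + 3) / 4 = 1 to the curvature for each of the m
    summands. *)
Section HalfSpace.
Variables (R : realType) (m : nat).
Local Notation n := (m + m)%N.
Local Notation J := (Jmx R m).
Implicit Types (p q : 'rV[R]_n) (i j k l : 'I_n) (s : 'I_m).

Definition half_space : set 'rV[R]_n :=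
  [set p | forall s : 'I_m, 0 < p 0 (rshift m s)].
Local Notation U := half_space.
Definition xcoord s p : R := p 0 (lshift m s).
Definition ycoord s p : R := p 0 (rshift m s).
Definition yinv s p : R := (ycoord s p)^-1.
Local Notation X := xcoord.
Local Notation Y := ycoord.
Local Notation V := yinv.

Definition half_space_potential p : R :=
  \sum_s (2^-1 * (X s p * X s p * V s p) + 6^-1 * (Y s p * Y s p * Y s p)).
Local Notation u := half_space_potential.

Lemma half_space_open : open U.
Proof.
rewrite openE => p Up; rewrite /interior.
apply: (@filter_forall _ 'I_m (fun s q => 0 < q 0 (rshift m s)) _ (nbhs_filter p)) => s.
have c : {for p, continuous (Y s)} by exact: coord_continuous.
exact: (cvgr_gt _ c _ (Up s)).
Qed.
Let oU := half_space_open.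

Let sX s : smooth_on U (X s) := smooth_coord oU (lshift m s).
Let sY s : smooth_on U (Y s) := smooth_coord oU (rshift m s).
Let sC c : smooth_on U (fun=> c) := smooth_cst oU c.

Lemma half_space_neq0 s p : U p -> Y s p != 0.
Proof. by move=> Up; rewrite gt_eqF// Up. Qed.

Let sV s : smooth_on U (V s) := smoothV oU (sY s) (half_space_neq0 s).

Definition dX i s : R := (i == lshift m s)%:R.
Definition dY i s : R := (i == rshift m s)%:R.

Lemma partial_X i s p : partial i (X s) p = dX i s.
Proof. exact: partial_coord. Qed.
Lemma partial_Y i s p : partial i (Y s) p = dY i s.
Proof. exact: partial_coord. Qed.
Lemma partial_V i s p : U p -> partial i (V s) p = - dY i s * (V s p * V s p).
Proof.
move=> Up; rewrite -(partial_Y i s p).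
have d := smooth_is_derive i (sY s) Up.
exact: (is_derive_inv (half_space_neq0 s Up) d).(derive_val).
Qed.

Let sXX s := smoothM oU (sX s) (sX s).
Let sYY s := smoothM oU (sY s) (sY s).
Let sVV s := smoothM oU (sV s) (sV s).
Let sXV s := smoothM oU (sX s) (sV s).
Let sXVV s := smoothM oU (sX s) (sVV s).
Let sXXV s := smoothM oU (sXX s) (sV s).
Let sXXVV s := smoothM oU (sXX s) (sVV s).
Let sYYY s := smoothM oU (sYY s) (sY s).
Let sXXVVV s := smoothM oU (sXXVV s) (sV s).

Let term s p := 2^-1 * (X s p * X s p * V s p) + 6^-1 * (Y s p * Y s p * Y s p).
Let sterm s : smooth_on U (term s) :=
  smoothD oU (smoothM oU (sC 2^-1) (sXXV s)) (smoothM oU (sC 6^-1) (sYYY s)).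

Lemma half_space_smooth : smooth_on U u.
Proof. exact: (smooth_sum oU _ _ sterm). Qed.

Let d1 i s p := dX i s * (X s p * V s p)
  + dY i s * (2^-1 * (Y s p * Y s p) + - 2^-1 * (X s p * X s p * (V s p * V s p))).
Let sd1 i s : smooth_on U (d1 i s) :=
  smoothD oU (smoothM oU (sC (dX i s)) (sXV s))
   (smoothM oU (sC (dY i s)) (smoothD oU (smoothM oU (sC 2^-1) (sYY s))
      (smoothM oU (sC (- 2^-1)) (sXXVV s)))).

Lemma half_space_partial i p : U p -> partial i u p = \sum_s d1 i s p.
Proof.
move=> Up; rewrite (partial_sum oU _ _ i sterm Up); apply: eq_bigr => s _.
rewrite (partialD i (smoothM oU (sC 2^-1) (sXXV s))
  (smoothM oU (sC 6^-1) (sYYY s)) Up).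
rewrite (partialM i (sC 2^-1) (sXXV s) Up) (partialM i (sC 6^-1) (sYYY s) Up).
rewrite (partialM i (sXX s) (sV s) Up) (partialM i (sYY s) (sY s) Up).
rewrite (partialM i (sX s) (sX s) Up) (partialM i (sY s) (sY s) Up).
rewrite partial_X partial_Y (partial_V i s Up) !partial_cst /d1.
have VY : V s p * Y s p = 1 by rewrite /yinv mulVf// half_space_neq0.
move: (V s p) (Y s p) (X s p) (dX i s) (dY i s) => v y x a b.
by field.
Qed.

Let d2 i j s p := dX i s * dX j s * V s p
  + - (dX i s * dY j s + dY i s * dX j s) * (X s p * (V s p * V s p))
  + dY i s * dY j s * (Y s p + X s p * X s p * (V s p * V s p) * V s p).
Let sd2 i j s : smooth_on U (d2 i j s) :=
  smoothD oU (smoothD oU (smoothM oU (sC _) (sV s)) (smoothM oU (sC _) (sXVV s)))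
   (smoothM oU (sC _) (smoothD oU (sY s) (sXXVVV s))).

Lemma half_space_partial2 j i p : U p ->
  partial j (partial i u) p = \sum_s d2 i j s p.
Proof.
move=> Up; rewrite (partial_eq_on oU j (fun q Uq => half_space_partial i Uq) Up).
rewrite (partial_sum oU _ _ j (sd1 i) Up); apply: eq_bigr => s _.
have s1 := smoothM oU (sC 2^-1) (sYY s).
have s2 := smoothM oU (sC (- 2^-1)) (sXXVV s).
rewrite (partialD j (smoothM oU (sC (dX i s)) (sXV s))
  (smoothM oU (sC (dY i s)) (smoothD oU s1 s2)) Up).
rewrite (partialM j (sC _) (sXV s) Up) (partialM j (sC _) (smoothD oU s1 s2) Up).
rewrite (partialM j (sX s) (sV s) Up) (partialD j s1 s2 Up).
rewrite (partialM j (sC _) (sYY s) Up) (partialM j (sC _) (sXXVV s) Up).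
rewrite (partialM j (sY s) (sY s) Up) (partialM j (sXX s) (sVV s) Up).
rewrite (partialM j (sX s) (sX s) Up) (partialM j (sV s) (sV s) Up).
rewrite partial_X partial_Y (partial_V j s Up) !partial_cst /d2.
move: (V s p) (Y s p) (X s p) (dX i s) (dY i s) (dX j s) (dY j s).
by move=> v y x a b a' b'; field.
Qed.

Definition half_space_base : 'rV[R]_n := row_mx 0 (const_mx 1).
Local Notation p0 := half_space_base.

Lemma half_space_baseX s : X s p0 = 0. Proof. by rewrite /xcoord row_mxEl mxE. Qed.
Lemma half_space_baseY s : Y s p0 = 1. Proof. by rewrite /ycoord row_mxEr mxE. Qed.
Lemma half_space_base_in : U p0.
Proof. by move=> s; rewrite -[p0 0 _]/(ycoord s p0) half_space_baseY. Qed.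

Lemma half_space_partial3 k j i : partial k (partial j (partial i u)) p0
  = \sum_s (dY i s * dY j s * dY k s - (dX i s * dX j s * dY k s
     + dX i s * dY j s * dX k s + dY i s * dX j s * dX k s)).
Proof.
have Up := half_space_base_in.
rewrite (partial_eq_on oU k (fun q Uq => half_space_partial2 j i Uq) Up).
rewrite (partial_sum oU _ _ k (sd2 i j) Up); apply: eq_bigr => s _.
have s1 := smoothM oU (sC (dX i s * dX j s)) (sV s).
have s2 := smoothM oU (sC (- (dX i s * dY j s + dY i s * dX j s))) (sXVV s).
have s3 := smoothD oU (sY s) (sXXVVV s).
rewrite (partialD k (smoothD oU s1 s2) (smoothM oU (sC (dY i s * dY j s)) s3) Up).
rewrite (partialD k s1 s2 Up) (partialM k (sC _) s3 Up) (partialM k (sC _) (sV s) Up).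
rewrite (partialM k (sC _) (sXVV s) Up) (partialD k (sY s) (sXXVVV s) Up).
rewrite (partialM k (sX s) (sVV s) Up) (partialM k (sXXVV s) (sV s) Up).
rewrite (partialM k (sXX s) (sVV s) Up) (partialM k (sX s) (sX s) Up).
rewrite partial_X partial_Y (partial_V k s Up) !partial_cst.
rewrite half_space_baseX /yinv half_space_baseY invr1.
by ring.
Qed.

Lemma dX_lshift r s : dX (lshift m r) s = (r == s)%:R.
Proof. by rewrite /dX (inj_eq (@lshift_inj _ _)). Qed.
Lemma dX_rshift r s : dX (rshift m r) s = 0.
Proof. by rewrite /dX eq_rlshift. Qed.
Lemma dY_rshift r s : dY (rshift m r) s = (r == s)%:R.
Proof. by rewrite /dY (inj_eq (@rshift_inj _ _)). Qed.
Lemma dY_lshift r s : dY (lshift m r) s = 0.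
Proof. by rewrite /dY eq_lrshift. Qed.

Let dXYE := (dX_lshift, dX_rshift, dY_rshift, dY_lshift).

Lemma sum_delta (r : 'I_m) (F : 'I_m -> R) : \sum_s (r == s)%:R * F s = F r.
Proof.
rewrite (bigD1 r)//= eqxx mul1r big1 ?addr0// => s sr.
by rewrite eq_sym (negbTE sr) mul0r.
Qed.

Lemma sum_delta2 (r t : 'I_m) (F : 'I_m -> R) :
  \sum_s (r == s)%:R * (t == s)%:R * F s = F r *+ (r == t).
Proof.
under eq_bigr do rewrite -mulrA.
by rewrite sum_delta eq_sym mulr_natl.
Qed.

Lemma half_space_hess p : U p -> hess u p =
  block_mx (diag_mx (\row_s V s p)) (diag_mx (\row_s - (X s p * (V s p * V s p))))
    (diag_mx (\row_s - (X s p * (V s p * V s p))))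
    (diag_mx (\row_s (Y s p + X s p * X s p * (V s p * V s p) * V s p))).
Proof.
move=> Up; apply/matrixP => i j; rewrite [LHS]mxE half_space_partial2//.
case: (split_ordP i) => r ->; case: (split_ordP j) => t ->.
- rewrite block_mxEul [RHS]mxE [in RHS]mxE.
  rewrite -(sum_delta2 r t (fun s => V s p)); apply: eq_bigr => s _.
  by rewrite /d2 !dX_lshift !dY_lshift; ring.
- rewrite block_mxEur [RHS]mxE [in RHS]mxE.
  rewrite -(sum_delta2 r t (fun s => - (X s p * (V s p * V s p)))); apply: eq_bigr => s _.
  by rewrite /d2 !dX_lshift !dY_lshift !dX_rshift !dY_rshift; ring.
- rewrite block_mxEdl [RHS]mxE [in RHS]mxE.
  rewrite -(sum_delta2 r t (fun s => - (X s p * (V s p * V s p)))); apply: eq_bigr => s _.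
  by rewrite /d2 !dX_lshift !dY_lshift !dX_rshift !dY_rshift; ring.
- rewrite block_mxEdr [RHS]mxE [in RHS]mxE.
  rewrite -(sum_delta2 r t
    (fun s => Y s p + X s p * X s p * (V s p * V s p) * V s p)); apply: eq_bigr => s _.
  by rewrite /d2 !dX_rshift !dY_rshift; ring.
Qed.

Lemma half_space_posdef p : U p -> posdef (hess u p).
Proof.
move=> Up w w0; rewrite half_space_hess//.
move: (lsubmx w) (rsubmx w) (hsubmxK w) => x y wE; rewrite -wE in w0 *.
rewrite mul_row_block tr_row_mx mul_row_col mxE.
(* Completing the square in each of the m planes. *)
pose F s := V s p * (x 0 s - X s p * V s p * y 0 s) ^+ 2 + Y s p * y 0 s ^+ 2.
have V0 s : 0 < V s p by rewrite invr_gt0; exact: Up.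
have F0 s : 0 <= F s.
  by rewrite addr_ge0// mulr_ge0 ?sqr_ge0 ?(ltW (V0 s))// ltW//; exact: Up.
have -> : ((x *m diag_mx (\row_s V s p)
   + y *m diag_mx (\row_s - (X s p * (V s p * V s p)))) *m x^T) 0 0
   + ((x *m diag_mx (\row_s - (X s p * (V s p * V s p)))
   + y *m diag_mx (\row_s (Y s p + X s p * X s p * (V s p * V s p) * V s p)))
     *m y^T) 0 0 = \sum_s F s.
  rewrite [X in X + _]mxE [X in _ + X]mxE -big_split; apply: eq_bigr => s _ /=.
  by rewrite !mul_mx_diag !mxE /F; ring.
rewrite lt_neqAle sumr_ge0 ?andbT//; apply: contra_neq w0 => s0.
have Fs := psumr_eq0P (fun s _ => F0 s) (esym s0).
have y0 s : y 0 s = 0.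
  have /eqP := Fs s isT; rewrite paddr_eq0; last 2 first.
  - by rewrite mulr_ge0 ?sqr_ge0 ?(ltW (V0 s)).
  - by rewrite mulr_ge0 ?sqr_ge0// ltW//; exact: Up.
  by move=> /andP[_]; rewrite mulf_eq0 (negbTE (half_space_neq0 s Up)) sqrf_eq0 => /eqP.
have x0 s : x 0 s = 0.
  have /eqP := Fs s isT; rewrite /F y0 mulr0 subr0 expr0n mulr0 addr0.
  by rewrite mulf_eq0 gt_eqF//= sqrf_eq0 => /eqP.
have -> : x = 0 by apply/rowP => s; rewrite x0 mxE.
have -> : y = 0 by apply/rowP => s; rewrite y0 mxE.
exact: row_mx0.
Qed.

Lemma half_space_Sp p : U p -> in_Sp (hess u p).
Proof.
move=> Up; rewrite /in_Sp half_space_hess// /Jmx tr_block_mx !tr_diag_mx.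
set A := diag_mx _; set B := diag_mx _; set C := diag_mx _.
have AB : A *m B = B *m A by rewrite diag_mxC.
have CB : C *m B = B *m C by rewrite diag_mxC.
have AC : A *m C = 1%:M + B *m B.
  rewrite !mulmx_diag -diag_const_mx -linearD /=; congr diag_mx; apply/rowP => s.
  rewrite !mxE /yinv; have := half_space_neq0 s Up.
  by move: (Y s p) (X s p) => a b a0; field.
have CA : C *m A = 1%:M + B *m B by rewrite -AC diag_mxC.
rewrite !mulmx_block !mulmx0 !mulmx1 !add0r !addr0 !mulmxN !mulmx1.
by rewrite !mulNmx AB subrr CB subrr CA AC opprD addrCA subrr addr0 addrK.
Qed.

Lemma half_space_hess_base : hess u p0 = 1%:M.
Proof.
rewrite half_space_hess; last exact: half_space_base_in.
rewrite scalar_mx_block -!diag_const_mx.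
have E0 : \row_s - (X s p0 * (V s p0 * V s p0)) = 0.
  by apply/rowP => s; rewrite !mxE half_space_baseX mul0r oppr0.
have E1 : \row_s V s p0 = const_mx 1.
  by apply/rowP => s; rewrite !mxE /yinv half_space_baseY invr1.
have E2 : \row_s (Y s p0 + X s p0 * X s p0 * (V s p0 * V s p0) * V s p0)
    = const_mx 1.
  apply/rowP => s; rewrite !mxE half_space_baseX half_space_baseY.
  by rewrite !mul0r addr0.
by rewrite E0 E1 E2 linear0.
Qed.

(** The four blocks of third derivatives that do not vanish are diagonal with
    entries 1 or - 1. *)
Lemma sum_delta3 (f : 'I_m -> 'I_m -> 'I_m -> R) :
  (forall a b c, f a b c ^+ 2
     = (\sum_s (a == s)%:R * (b == s)%:R * (c == s)%:R) ^+ 2) ->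
  \sum_a \sum_b \sum_c f a b c ^+ 2 = m%:R.
Proof.
move=> fE; transitivity (\sum_(a < m) (1 : R)); last first.
  by rewrite sumr_const card_ord.
apply: eq_bigr => a _; transitivity (\sum_b (a == b)%:R * (1 : R)); last first.
  by rewrite sum_delta.
apply: eq_bigr => b _; transitivity (\sum_c (a == c)%:R * (a == b)%:R : R).
  apply: eq_bigr => c _; rewrite fE sum_delta2.
  by rewrite mulrb; case: (a == b); rewrite ?mulr0 ?mulr1 ?expr0n//;
    rewrite eq_sym; case: (a == c); rewrite ?expr1n ?expr0n.
by rewrite sum_delta mulr1.
Qed.

Lemma sum3_eq0 (f : 'I_m -> 'I_m -> 'I_m -> R) :
  (forall a b c, f a b c = 0) -> \sum_a \sum_b \sum_c f a b c ^+ 2 = 0.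
Proof.
by move=> f0; do 3 (rewrite big1// => ? _); rewrite f0 expr0n.
Qed.

Lemma half_space_curvature : scalar_curvature (hess u) p0 = m%:R.
Proof.
have hu q : U q -> posdef (hess u q) /\ in_Sp (hess u q).
  by move=> Uq; split; [exact: half_space_posdef|exact: half_space_Sp].
have P1 : 1%:M *m hess u p0 *m 1%:M^T = 1%:M.
  by rewrite trmx1 mul1mx mulmx1 half_space_hess_base.
rewrite (scalar_curvature_hess oU half_space_smooth hu half_space_base_in P1).
pose t a b c := \sum_s (dY c s * dY b s * dY a s - (dX c s * dX b s * dY a s
     + dX c s * dY b s * dX a s + dY c s * dX b s * dX a s)).
transitivity (4^-1 * \sum_a \sum_b \sum_c t a b c ^+ 2).
  congr (_ * _); apply: eq_bigr => a _; apply: eq_bigr => b _.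
  apply: eq_bigr => c _; rewrite trmx1 mul1mx mulmx1 row1 third_tangent.
  by rewrite half_space_partial3.
rewrite big_split_ord /=.
under eq_bigr => a _.
  rewrite big_split_ord /=.
  under eq_bigr => b _ do rewrite big_split_ord /=.
  under [X in _ + X]eq_bigr => b _ do rewrite big_split_ord /=.
  rewrite !big_split /=.
  over.
under [X in _ + X]eq_bigr => a _.
  rewrite big_split_ord /=.
  under eq_bigr => b _ do rewrite big_split_ord /=.
  under [X in _ + X]eq_bigr => b _ do rewrite big_split_ord /=.
  rewrite !big_split /=.
  over.
rewrite !big_split /=.
rewrite (sum3_eq0 (f := fun a b c =>
  t (lshift m a) (lshift m b) (lshift m c)));
  last by move=> a b c; apply: big1 => s _; rewrite !dXYE; ring.
rewrite (sum_delta3 (f := fun a b c =>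
  t (lshift m a) (lshift m b) (rshift m c))); last first.
  move=> a b c; rewrite -sqrrN; congr (_ ^+ 2); rewrite /t -sumrN.
  by apply: eq_bigr => s _; rewrite !dXYE; ring.
rewrite (sum_delta3 (f := fun a b c =>
  t (lshift m a) (rshift m b) (lshift m c))); last first.
  move=> a b c; rewrite -sqrrN; congr (_ ^+ 2); rewrite /t -sumrN.
  by apply: eq_bigr => s _; rewrite !dXYE; ring.
rewrite (sum3_eq0 (f := fun a b c =>
  t (lshift m a) (rshift m b) (rshift m c)));
  last by move=> a b c; apply: big1 => s _; rewrite !dXYE; ring.
rewrite (sum_delta3 (f := fun a b c =>
  t (rshift m a) (lshift m b) (lshift m c))); last first.
  move=> a b c; rewrite -sqrrN; congr (_ ^+ 2); rewrite /t -sumrN.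
  by apply: eq_bigr => s _; rewrite !dXYE; ring.
rewrite (sum3_eq0 (f := fun a b c =>
  t (rshift m a) (lshift m b) (rshift m c)));
  last by move=> a b c; apply: big1 => s _; rewrite !dXYE; ring.
rewrite (sum3_eq0 (f := fun a b c =>
  t (rshift m a) (rshift m b) (lshift m c)));
  last by move=> a b c; apply: big1 => s _; rewrite !dXYE; ring.
rewrite (sum_delta3 (f := fun a b c =>
  t (rshift m a) (rshift m b) (rshift m c))); last first.
  move=> a b c; congr (_ ^+ 2); rewrite /t.
  by apply: eq_bigr => s _; rewrite !dXYE; ring.
by field.
Qed.

(** A boundary point has some coordinate y_s <= 0, whereas the base point has
    y_s = 1 and its Hessian is the identity. *)
Lemma half_space_dist : (1 <= dist_boundary (hess u p0) p0 U)%E.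
Proof.
rewrite half_space_hess_base; apply: le_ereal_inf_tmp => _ [q [_ qU] <-].
rewrite lee_fin.
have [s qs] : exists s, Y s q <= 0.
  apply: contrapT => nq; apply: qU.
  apply: (open_nbhs_nbhs (conj oU _)) => s.
  by rewrite ltNge; apply/negP => qs; apply: nq; exists s.
rewrite -[leLHS]sqrtr1 ler_wsqrtr// mulmx1 mxE (bigD1 (rshift m s))//=.
rewrite -[leLHS]addr0 lerD//; last first.
  by rewrite sumr_ge0// => i _; rewrite [_^T _ _]mxE -expr2 sqr_ge0.
rewrite [_^T _ _]mxE; have -> : (q - p0) 0 (rshift m s) = Y s q - 1.
  by rewrite -(half_space_baseY s) /ycoord [LHS]mxE [in LHS]mxE.
by have := qs; move: (Y s q) => y y0; nra.
Qed.

End HalfSpace.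

(** * The theorem *)

Lemma mul_bounded_eq0 (R : realType) (s M : R) : 0 <= s ->
  (forall d, 0 < d -> s * d <= M) -> s = 0.
Proof.
move=> s0 h; apply/eqP; rewrite eq_le s0 andbT leNgt; apply/negP => sp.
have M0 : 0 < M by have := h 1 ltr01; rewrite mulr1; exact: lt_le_trans.
have := h (2 * (M / s)); rewrite mulr_gt0 ?divr_gt0// => /(_ isT).
have -> : s * (2 * (M / s)) = 2 * M by field; rewrite gt_eqF.
by lra.
Qed.

Lemma dist_boundary_ge0 (R : realType) n (G : 'M[R]_n) x U :
  (0 <= dist_boundary G x U)%E.
Proof. by apply: le_ereal_inf_tmp => _ [q _ <-]; rewrite lee_fin sqrtr_ge0. Qed.

Section Estimate.
Variables (R : realType) (m : nat).
Hypothesis hm : (1 <= m)%N.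
Local Notation n := (m + m)%N.
Variables (U : set 'rV[R]_n) (u : 'rV[R]_n -> R).
Hypotheses (oU : open U) (su : smooth_on U u).
Hypothesis hu : forall x, U x -> posdef (hess u x) /\ in_Sp (hess u x).

(** The estimate holds with any d below the distance to the boundary, and so
    in the limit; for an infinite distance it forces the curvature to
    vanish. *)
Lemma sqrt_curvature_le_dist x : U x ->
  ((Num.sqrt (scalar_curvature (hess u) x))%:E
     <= (3 * m%:R)%:E / dist_boundary (hess u x) x U)%E.
Proof.
move=> Ux; have Gs := hess_sym oU su Ux; have Gp := (hu Ux).1.
have m0 : 0 < 3 * m%:R :> R by rewrite mulr_gt0// ltr0n.
have bound d : 0 < d -> (d%:E < dist_boundary (hess u x) x U)%E ->
    Num.sqrt (scalar_curvature (hess u) x) * d <= 3 * m%:R.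
  move=> d0 dU; apply: (sqrt_curvature_bound oU su hu Ux d0).
  exact: (gball_in_domain oU Ux dU).
have := dist_boundary_ge0 (hess u x) x U.
have s0 := sqrtr_ge0 (scalar_curvature (hess u) x).
move: (Num.sqrt _) s0 bound => s s0.
case: (dist_boundary _ _ _) => [D| |//] bound D0.
- have [->|Dn] := eqVneq D 0.
    by rewrite inve0 gt0_muley ?leey ?lte_fin.
  have Dp : 0 < D by rewrite lt_neqAle eq_sym Dn.
  rewrite inver (negbTE Dn) -EFinM lee_fin ler_pdivlMr//.
  by apply: (mul_le_lim s0 (ltW m0) Dp) => d d0 dD; apply: bound.
- rewrite invey mule0 (mul_bounded_eq0 s0 (M := 3 * m%:R))// => d d0.
  by apply: bound => //; exact: ltry.
Qed.

End Estimate.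

Lemma entire_flat (R : realType) (m : nat) (u : 'rV[R]_(m + m) -> R) :
  smooth_on setT u ->
  (forall x, setT x -> posdef (hess u x) /\ in_Sp (hess u x)) ->
  forall x, scalar_curvature (hess u) x = 0.
Proof.
move=> su hu x; have oT : open [set: 'rV[R]_(m + m)] := openT.
apply/eqP; rewrite eq_le (scalar_curvature_ge0 oT su hu)// andbT.
rewrite -sqrtr_eq0; apply/eqP.
apply: (mul_bounded_eq0 (M := 3 * m%:R) (sqrtr_ge0 _)) => d d0.
by apply: (sqrt_curvature_bound oT su hu _ d0).
Qed.

(* In \bar R one has (+oo)^-1 = 0, so the right-hand side of the estimate is 0
   when the boundary of U is empty. *)
Theorem theorem1p1 (R : realType) (m : nat) (hm : (1 <= m)%N) :
  (forall (U : set 'rV[R]_(m + m)) (u : 'rV[R]_(m + m) -> R),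
     open U -> smooth_on U u ->
     (forall x, U x -> posdef (hess u x) /\ in_Sp (hess u x)) ->
     (forall x, U x ->
        0 <= scalar_curvature (hess u) x /\
        ((Num.sqrt (scalar_curvature (hess u) x))%:E
           <= (3 * m%:R)%:E / dist_boundary (hess u x) x U)%E) /\
     (U = setT ->
        (forall x, scalar_curvature (hess u) x = 0) /\
        quadratic_polynomial u)) /\
  (forall C : R,
     (forall (U : set 'rV[R]_(m + m)) (u : 'rV[R]_(m + m) -> R),
        open U -> smooth_on U u ->
        (forall x, U x -> posdef (hess u x) /\ in_Sp (hess u x)) ->
        forall x, U x ->
          ((Num.sqrt (scalar_curvature (hess u) x))%:E
             <= C%:E / dist_boundary (hess u x) x U)%E) ->
     Num.sqrt m%:R <= C).
Proof.
split=> [U u oU su hu|C CP].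
  split=> [x Ux|UT].
    split; first exact: (scalar_curvature_ge0 oU su hu).
    exact: (sqrt_curvature_le_dist hm oU su hu).
  subst U; have S0 := entire_flat su hu; split => //.
  apply: (third0_quadratic su) => k i j x.
  exact: (scalar_curvature0_third openT su hu).
have hu (q : 'rV[R]_(m + m)) : half_space q ->
    posdef (hess (@half_space_potential R m) q)
    /\ in_Sp (hess (@half_space_potential R m) q).
  by move=> Uq; split; [exact: half_space_posdef|exact: half_space_Sp].
have := CP _ _ (@half_space_open R m) (@half_space_smooth R m) hu _
  (@half_space_base_in R m).
rewrite half_space_curvature.
have := @half_space_dist R m.
have s0 : 0 < Num.sqrt m%:R :> R by rewrite sqrtr_gt0 ltr0n.
case: (dist_boundary _ _ _) => [D| |]; last by rewrite leeNy_eq.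
- rewrite lee_fin => D1; have D0 := lt_le_trans ltr01 D1.
  rewrite inver gt_eqF// -EFinM lee_fin ler_pdivlMr// => h.
  by apply: le_trans h; rewrite ler_peMr ?(ltW s0).
- by move=> _; rewrite invey mule0 lee_fin leNgt s0.
Qed.
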